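(* Let $\alpha\in\mathbb Z$ and let $\beta$ be arbitrary (complex). For $s_1,s_2\in\{+1,-1\}$ let $M_{-,-}=KKer_{\mathcal F_{(\alpha;\beta)}}$, $M_{+,-}=CKer_{\mathcal F_{(\alpha;\beta)}}$, $M_{-,+}=KCoker_{\mathcal F_{(\alpha;\beta)}}$, $M_{+,+}=CCoker_{\mathcal F_{(\alpha;\beta)}}$ (the indices being the signs of $s_1,s_2$). Their characters and supercharacters are $$Ch_{M_{s_1,s_2}}(q,x_1,x_2,x_3,x_4)=\frac{q^{\frac12\alpha(2\beta+1)}}{\prod_{n=1}^\infty(1-q^n)^6}\sum_{l_1,l_2=1}^\infty(-1)^{l_1+l_2}q^{\frac12(l_1^2+l_2^2+s_1(1-2\alpha)l_1+s_2l_2)}\sum_{i,j,k\in\mathbb Z}q^{\frac12(i^2+j^2+k^2-2kj+(1+2s_1l_1)i+(1-2s_1l_1)j+(1+2s_2l_2)k)}x_1^{\alpha+j}x_2^{1-\alpha+i-k}x_3^{-j}x_4^{4\beta+2-\alpha+2i-2j+2k},$$ $$Sch_{M_{s_1,s_2}}(q,x_1,x_2,x_3,x_4)=\frac{q^{\frac12\alpha(2\beta+1)}}{\prod_{n=1}^\infty(1-q^n)^6}\sum_{l_1,l_2=1}^\infty(-1)^{l_1+l_2}q^{\frac12(l_1^2+l_2^2+s_1(1-2\alpha)l_1+s_2l_2)}\sum_{i,j,k\in\mathbb Z}(-1)^{1-\alpha+i-j+k}q^{\frac12(i^2+j^2+k^2-2kj+(1+2s_1l_1)i+(1-2s_1l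_1)j+(1+2s_2l_2)k)}x_1^{\alpha+j}x_2^{1-\alpha+i-k}x_3^{-j}x_4^{4\beta+2-\alpha+2i-2j+2k}.$$
   Context: $0<|q|<1$ with a fixed branch of $\log q$, $q^x=e^{x\log q}$, $[x]_q=(q^x-q^{-x})/(q-q^{-1})$. Oscillators: $a^j_n,Q_{a^j}$ ($1\le j\le4$), $c^l_n,Q_{c^l}$ ($l=1,2$), $n\in\mathbb Z$, with $[a^j_n,a^{j'}_m]=(-1)^{j+1}\delta_{jj'}\delta_{m+n,0}\frac{[n]_q^2}n$ and $[c^l_n,c^{l'}_m]=\delta_{ll'}\delta_{m+n,0}\frac{[n]_q^2}n$ for $n\ne0$, $[a^j_0,Q_{a^{j'}}]=\delta_{jj'}$, $[c^l_0,Q_{c^{l'}}]=\delta_{ll'}$, all other commutators zero. The vacuum satisfies $a^j_m|0\rangle=c^l_m|0\rangle=0$ for $m\ge0$; $F_{\lambda_1,\lambda_2,\lambda_3,\lambda_4;\lambda_5,\lambda_6}$ is the Fock space generated freely by the $a^j_{-m},c^l_{-m}$ ($m>0$) over $e^{\sum_{i=1}^4\lambda_iQ_{a^i}+\lambda_5Q_{c^1}+\lambda_6Q_{c^2}}|0\rangle$. Define $$\mathcal F_{(\alpha;\beta)}=\bigoplus_{i,j,k\in\mathbb Z}F_{\beta+1+i,\,-\beta-1+\alpha-i+j,\,\beta-j+k,\,-\beta-k;\,-\alpha+i-j,\,k}.$$ It is a level-one $U_q[\widehat{gl(2|2)}]$-module under the free boson realization, in which $h_j$ acts as $A^j_0$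 ($1\le j\le4$) and the derivation $d$ as below. For $i=1,2$: $c^i(z)=Q_{c^i}+c^i_0\ln z-\sum_{n\ne0}\frac{c^i_n}{[n]_q}z^{-n}$, $\eta^i(z)=\sum_n\eta^i_nz^{-n-1}=:e^{c^i(z)}:$, $\xi^i(z)=\sum_n\xi^i_nz^{-n}=:e^{-c^i(z)}:$ (normal ordering puts negative modes and $Q$'s to the left). For $\mathcal F=\mathcal F_{(\alpha;\beta)}$ with $\alpha\in\mathbb Z$, the following submodules are defined: $KKer_{\mathcal F}=\eta^1_0\xi^1_0\eta^2_0\xi^2_0\mathcal F$, $KCoker_{\mathcal F}=\eta^1_0\xi^1_0\xi^2_0\eta^2_0\mathcal F$, $CKer_{\mathcal F}=\xi^1_0\eta^1_0\eta^2_0\xi^2_0\mathcal F$, $CCoker_{\mathcal F}=\xi^1_0\eta^1_0\xi^2_0\eta^2_0\mathcal F$ (images of commuting projectors on $\mathcal F$). $A^i_n=(-1)^{i+1}(a^i_n+a^{i+1}_n)$ ($i=1,2,3$), $A^4_n=\frac{q^n+q^{-n}}2\sum_{l=1}^4(-1)^{l+1}a^l_n$. Let $(a_{ij})_{1\le i,j\le4}$ be the symmetric invertible matrix with zero diagonal, $a_{12}=1$, $a_{23}=-1$, $a_{13}=0$, $a_{14}=2$, $a_{24}=-2$, $a_{34}=2$. Put $A^{*i}_n=\sum_{l=1}^3a^{-1}_{il}A^l_n+\frac2{q^n+q^{-n}}a^{-1}_{i4}A^4_n$ ($i=1,2,3$), $A^{*4}_n=4\sum_{l=1}^4a^{-1}_{4l}A^l_n$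 ($n\ne0$), $A^{*j}_0=\sum_{l=1}^4a^{-1}_{jl}A^l_0$. Then $$d=-\sum_{m>0}\frac{m^2}{[m]_q^2}\Big\{\sum_{i=1}^3A^i_{-m}A^{*i}_m+\frac1{2(q^m+q^{-m})}A^4_{-m}A^{*4}_m+c^1_{-m}c^1_m+c^2_{-m}c^2_m\Big\}-\frac12\Big\{\sum_{i=1}^4A^i_0A^{*i}_0+c^1_0(c^1_0+1)+c^2_0(c^2_0+1)\Big\}.$$ $Ch_M=\mathrm{tr}_M(q^{-d}x_1^{h_1}x_2^{h_2}x_3^{h_3}x_4^{h_4})$ and $Sch_M=\mathrm{tr}_M((-1)^{N_f}q^{-d}x_1^{h_1}x_2^{h_2}x_3^{h_3}x_4^{h_4})$, where $N_f=a^2_0+a^4_0$ and $(-1)^{N_f}$ is normalized by omitting the overall constant phase $(-1)^{-2\beta}$, i.e. it acts as $e^{\sqrt{-1}\pi(a^2_0+a^4_0+2\beta)}$. Both are formal generating series in complex powers of $x_1,\dots,x_4$; the coefficient of each monomial is a convergent function of $q$. *)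

(* Defs.v *)
From HB Require Import structures.
From mathcomp Require Import all_boot all_order all_algebra.
From mathcomp Require Import finmap freeg complex.
From mathcomp Require Import boolp classical_sets fsbigop reals topology.
From mathcomp Require Import normedtype sequences exp trigo summability.

Set Implicit Arguments.
Unset Strict Implicit.
Unset Printing Implicit Defensive.

Import Order.TTheory GRing.Theory Num.Theory numFieldNormedType.Exports.

Local Open Scope classical_set_scope.
Local Open Scope complex_scope.
Local Open Scope ring_scope.

Definition cexp (R : realType) (z : R[i]) : R[i] :=
  let: x +i* y := z in (expR x * cos y) +i* (expR x * sin y).

(* Throughout, [logq] is the fixed branch of log q; q itself is [cexp logq]. *)
Definition qpow (R : realType) (logq x : R[i]) : R[i] := cexp (x * logq).

Definition qnum (R : realType) (logq x : R[i]) : R[i] :=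
  (qpow logq x - qpow logq (- x)) / (qpow logq 1 - qpow logq (- 1)).

(* Unconditional summation, in the norm topology of R[i]. *)
Definition has_sum (R : realType) (T : choiceType) (f : T -> R[i]) (s : R[i])
    : Prop :=
  partial_sum f @ totally --> (s : R[i]^o).

(* [inl j] is a^{j+1} and [inr l] is c^{l+1}: indices are shifted to start
   at 0, here and everywhere below. *)
Definition boson : finType := ('I_4 + 'I_2)%type.

(* The charges (lambda_1, ..., lambda_4; lambda_5, lambda_6). *)
Notation charge R := {ffun boson -> R[i]}.

(* Exponents of a monomial in the creation operators:
   the key (b, m) stands for the mode -(m+1) of the boson b. *)
Notation occupation := {fsfun (boson * nat)%type -> nat with 0%N}.

(* The direct sum of the Fock spaces F_lambda over all charges, as the free
   module on the monomials in creation operators applied to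
   exp(sum_b lambda_b Q_b)|0>. *)
Notation fock R := {freeg (charge R * occupation)%type / R[i]}.

Definition raise (n : occupation) (k : boson * nat) : occupation :=
  [fsfun x in (k |` finsupp n)%fset => (n x + (x == k))%N].

Definition lower (n : occupation) (k : boson * nat) : occupation :=
  [fsfun x in finsupp n => (n x - (x == k))%N].

Definition bsign (R : realType) (b : boson) : R[i] :=
  match b with inl j => (-1) ^+ j | inr _ => 1 end.

(* The mode n of the boson b; for n > 0 it is the derivation with
   [b_n, b_{-n}] = bsign b * [n]_q^2 / n. *)
Definition osc (R : realType) (logq : R[i]) (b : boson) (n : int)
    : fock R -> fock R :=
  fglift (fun s : (charge R * occupation)%type =>
    match n with
    | Posz 0 => s.1 b *: << s >>
    | Posz m.+1 =>
        ((s.2 (b, m))%:R * (bsign R b * qnum logq m.+1%:R ^+ 2 / m.+1%:R))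
          *: << (s.1, lower s.2 (b, m)) >>
    | Negz m => << (s.1, raise s.2 (b, m)) >>
    end : fock R).

(* The operator exp(e Q_b). *)
Definition expQ (R : realType) (b : boson) (e : int) : fock R -> fock R :=
  fglift (fun s : (charge R * occupation)%type =>
    << ([ffun b' => s.1 b' + (if b' == b then e%:~R else 0)] : charge R, s.2) >>
      : fock R).

(* The projection onto the eigenspace of the zero mode b_0 for the integer
   eigenvalue r, so that z^{b_0} is the sum over r of z^r [eig0 b r] on
   vectors of integral b-charge. *)
Definition eig0 (R : realType) (b : boson) (r : int) : fock R -> fock R :=
  fglift (fun s : (charge R * occupation)%type =>
    (if s.1 b == r%:~R then << s >> else 0) : fock R).

(* Coefficient of z^k in X(z)^r, and in exp(X(z)), for the formal series
   X(z) = \sum_(m >= 1) X_m z^m with operator coefficients. *)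
Fixpoint pow_coef (V : zmodType) (X : nat -> V -> V) (r k : nat) (v : V) : V :=
  if r is r'.+1 then \sum_(1 <= m < k.+1) X m (pow_coef X r' (k - m) v)
  else if k == 0%N then v else 0.

Definition exp_coef (F : fieldType) (V : lmodType F) (X : nat -> V -> V)
    (k : nat) (v : V) : V :=
  \sum_(r < k.+1) (r`!%:R)^-1 *: pow_coef X r k v.

(* The coefficient of z^(-n) in e times the oscillator part of c^l(z). *)
Definition cmode (R : realType) (logq : R[i]) (l : 'I_2) (e : int) (n : int)
    (v : fock R) : fock R :=
  (- e%:~R / qnum logq n%:~R) *: osc logq (inr l) n v.

(* The coefficient of z^p in :exp(e c^l(z)): =
     exp(\sum_(m > 0) cmode_{-m} z^m) exp(e Q) z^{e c_0}
       exp(\sum_(m > 0) cmode_m z^{-m}).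
   The index is (k, k', r), for the contribution z^k z^(-k') z^(e r); only
   finitely many of them contribute on a given vector. *)
Definition vertex_coef (R : realType) (logq : R[i]) (l : 'I_2) (e : int)
    (p : int) (v : fock R) : fock R :=
  \sum_(x \in [set x : (nat * nat * int)%type |
                 x.1.1%:Z - x.1.2%:Z + e * x.2 = p])
    exp_coef (fun m => cmode logq l e (- m%:Z)) x.1.1
      (expQ (inr l) e (eig0 (inr l) x.2
        (exp_coef (fun m => cmode logq l e m%:Z) x.1.2 v))).

Definition eta (R : realType) (logq : R[i]) (l : 'I_2) (n : int)
    : fock R -> fock R := vertex_coef logq l 1 (- n - 1).

Definition xi (R : realType) (logq : R[i]) (l : 'I_2) (n : int)
    : fock R -> fock R := vertex_coef logq l (- 1) (- n).

Definition chargeF (R : realType) (alpha : int) (beta : R[i])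
    (t : int * int * int) : charge R :=
  let: (i, j, k) := t in
  let i : R[i] := i%:~R in let j : R[i] := j%:~R in let k : R[i] := k%:~R in
  let alpha : R[i] := alpha%:~R in
  [ffun b : boson => match b with
    | inl p => [:: beta + 1 + i; - beta - 1 + alpha - i + j;
                   beta - j + k; - beta - k]`_p
    | inr l => [:: - alpha + i - j; k]`_l
    end].

Definition calF (R : realType) (alpha : int) (beta : R[i]) : set (fock R) :=
  [set v | forall s, s \in dom v -> exists t, s.1 = chargeF alpha beta t].

Section Submodules.
Variables (R : realType) (logq : R[i]) (alpha : int) (beta : R[i]).
Let eta0 (l : 'I_2) := eta logq l 0.
Let xi0 (l : 'I_2) := xi logq l 0.
Let c1 : 'I_2 := ord0.
Let c2 : 'I_2 := ord_max.

Definition KKer : set (fock R) :=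
  (eta0 c1 \o xi0 c1 \o eta0 c2 \o xi0 c2) @` calF alpha beta.
Definition KCoker : set (fock R) :=
  (eta0 c1 \o xi0 c1 \o xi0 c2 \o eta0 c2) @` calF alpha beta.
Definition CKer : set (fock R) :=
  (xi0 c1 \o eta0 c1 \o eta0 c2 \o xi0 c2) @` calF alpha beta.
Definition CCoker : set (fock R) :=
  (xi0 c1 \o eta0 c1 \o xi0 c2 \o eta0 c2) @` calF alpha beta.

(* The booleans are sign bits: [true] stands for the sign -1. *)
Definition submodM (s1 s2 : bool) : set (fock R) :=
  match s1, s2 with
  | true, true => KKer
  | false, true => CKer
  | true, false => KCoker
  | false, false => CCoker
  end.
End Submodules.

Section Operators.
Variables (R : realType) (logq : R[i]).
Local Notation C := R[i].
Local Notation V := (fock R).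

Definition a_ (j : 'I_4) : int -> V -> V := osc logq (inl j).
Definition c_ (l : 'I_2) : int -> V -> V := osc logq (inr l).

Definition qplus (n : int) : C := qpow logq n%:~R + qpow logq (- n%:~R).

Definition A_ (i : 'I_4) (n : int) (v : V) : V :=
  if (i < 3)%N then (-1) ^+ i *: (a_ i n v + a_ (inord i.+1) n v)
  else (qplus n / 2) *: \sum_(l < 4) (-1) ^+ l *: a_ l n v.

Definition amat : 'M[C]_4 :=
  \matrix_(i, j) nth 0 (nth [::]
    [:: [:: 0;  1;  0;  2];
        [:: 1;  0; -1; -2];
        [:: 0; -1;  0;  2];
        [:: 2; -2;  2;  0]] i) j.

Definition Astar (i : 'I_4) (n : int) (v : V) : V :=
  if n == 0 then \sum_(l < 4) invmx amat i l *: A_ l 0 v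
  else if (i < 3)%N then
    \sum_(l < 4 | (l < 3)%N) invmx amat i l *: A_ l n v
      + (2 / qplus n * invmx amat i ord_max) *: A_ ord_max n v
  else 4 *: \sum_(l < 4) invmx amat i l *: A_ l n v.

(* The sum over m is finite on each vector. *)
Definition d_ (v : V) : V :=
  - (\sum_(m \in [set m : nat | (0 < m)%N])
       (m%:R ^+ 2 / qnum logq m%:R ^+ 2) *:
         (\sum_(i < 4 | (i < 3)%N) A_ i (- m%:Z) (Astar i m%:Z v)
          + (2 * qplus m%:Z)^-1 *: A_ ord_max (- m%:Z) (Astar ord_max m%:Z v)
          + \sum_(l < 2) c_ l (- m%:Z) (c_ l m%:Z v)))
  - 2^-1 *: (\sum_(i < 4) A_ i 0 (Astar i 0 v)
             + \sum_(l < 2) c_ l 0 (c_ l 0 v + v)).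

Definition h_ (j : 'I_4) : V -> V := A_ j 0.

Definition Nf (v : V) : V := a_ (inord 1) 0 v + a_ (inord 3) 0 v.

Definition joint_eigen (M : set V) (mu : {ffun 'I_4 -> C}) (delta nu : C)
    : set V :=
  [set v | [/\ M v, forall j, h_ j v = mu j *: v,
               d_ v = delta *: v & Nf v = nu *: v]].

Definition has_dim (W : set V) (n : nat) : Prop :=
  exists b : 'I_n -> V,
    W = range (fun x : {ffun 'I_n -> C} => \sum_i x i *: b i) /\
    (forall x : {ffun 'I_n -> C}, \sum_i x i *: b i = 0 -> x = 0).

(* tr_M(phi(d, N_f) x_1^{h_1} x_2^{h_2} x_3^{h_3} x_4^{h_4}) = f as a formal
   series, f mu being the coefficient of \prod_j x_j^(mu j): the commuting
   operators h_j, d, N_f are simultaneously diagonalizable on M with finite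
   multiplicities, and each coefficient is the absolutely convergent sum of
   the eigenvalues of phi(d, N_f), counted with multiplicity. *)
Definition has_trace_series (M : set V) (phi : C -> C -> C)
    (f : {ffun 'I_4 -> C} -> C) : Prop :=
  (forall v, M v -> exists2 s : seq V, v = \sum_(u <- s) u &
     forall u, u \in s -> exists mu delta nu, joint_eigen M mu delta nu u) /\
  exists2 mult : {ffun 'I_4 -> C} -> C -> C -> nat,
    forall mu delta nu, has_dim (joint_eigen M mu delta nu) (mult mu delta nu)
    & forall mu, has_sum
        (fun p : (C * C)%type => (mult mu p.1 p.2)%:R * phi p.1 p.2) (f mu).

Definition has_character (M : set V) (f : {ffun 'I_4 -> C} -> C) : Prop :=
  has_trace_series M (fun delta _ => qpow logq (- delta)) f.

(* [beta] enters through the normalization of (-1)^{N_f}. *)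
Definition has_supercharacter (beta : C) (M : set V)
    (f : {ffun 'I_4 -> C} -> C) : Prop :=
  has_trace_series M
    (fun delta nu => cexp ('i * pi%:C * (nu + 2 * beta)) * qpow logq (- delta))
    f.

(* The exponents of x_1, ..., x_4 in the (i, j, k) term. *)
Definition x_exponent (alpha : int) (beta : C) (t : int * int * int)
    : {ffun 'I_4 -> C} :=
  let: (i, j, k) := t in
  let i : C := i%:~R in let j : C := j%:~R in let k : C := k%:~R in
  let alpha : C := alpha%:~R in
  [ffun p : 'I_4 => [:: alpha + j; 1 - alpha + i - k; - j;
     4 * beta + 2 - alpha + 2 * i - 2 * j + 2 * k]`_p].

(* The coefficient of x^mu in \sum_(t in Z^3) u t x^(x_exponent t); since
   x_exponent is injective, at most one term contributes. *)
Definition x_series (alpha : int) (beta : C) (u : int * int * int -> C)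
    (mu : {ffun 'I_4 -> C}) : C :=
  \sum_(t \in [set t : (int * int * int)%type | x_exponent alpha beta t = mu])
    u t.
End Operators.

(* Main.v *)
Require Import Defs.
From HB Require Import structures.
From mathcomp Require Import all_boot all_order all_algebra.
From mathcomp Require Import finmap freeg complex.
From mathcomp Require Import boolp classical_sets fsbigop reals topology.
From mathcomp Require Import normedtype sequences exp trigo summability.
From mathcomp Require Import cardinality zify ring lra.
Import Order.TTheory GRing.Theory Num.Theory numFieldNormedType.Exports.
Local Open Scope classical_set_scope.
Local Open Scope complex_scope.
Local Open Scope ring_scope.

(** A trace on a submodule is computed one monomial in x_1, ..., x_4 at a time.
    The operators h_j, d and N_f are diagonal on the basis states of the Fock
    space: h_j and N_f see the charge only, and -d is the weight of the
    occupation plus a quadratic energy of the charge ([d_E]), because the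
    A^{*i} are dual to the A^i for the form of the oscillators ([rootmx_diag],
    [casimir_pos]). The exponents of a monomial determine the integers i, j, k
    ([x_exponent_inj]), hence the charge. It remains to find the dimensions of
    the homogeneous components of the submodule at a given charge, and to sum
    them against powers of q.

    The submodule is the image of a product of operators eta_0 xi_0 or
    xi_0 eta_0, one for each of c^1 and c^2. The commutators of the exponents of
    two vertex operators are logarithms of 1 - w/z, so reordering gives the
    factor 1 - w/z or its inverse ([expz_exchange_same], [expz_exchange_opp]).
    Together with the symmetry of normal ordered products this yields
    eta_0^2 = xi_0^2 = 0 and eta_0 xi_0 + xi_0 eta_0 = 1 ([ghost_sqr0],
    [ghost_anticomm]), while the zero modes of c^1 and c^2 commute ([ghostC]).
    All coefficients are obtained from the derivation rule
    (exp X)' = X' exp X ([expz_euler]).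

    Hence the two products are commuting idempotents, which preserve charge and
    weight, and the dimension of the image is a trace ([has_dim_idempotent]).
    Let P = xi_0 eta_0, say. Cyclicity of the trace moves eta_0 to the other end
    and to the neighbouring charge, where eta_0 xi_0 = 1 - P, so the trace of P
    at one charge is the dimension of the next component minus the trace of P on
    it ([trace_proj_step]). The energies grow quadratically along the charges,
    so after finitely many steps the component is zero and the trace has become
    an alternating sum over l >= 1 of dimensions of components of the full Fock
    space; the sums over l_1 and l_2 arise from the two fermions
    ([trace_proj2]).

    The generating function of the weights of the occupations of six bosons is
    the product of the (1 - q^n)^-6 ([has_sum_occupations]). All families are
    absolutely summable, by geometric series and the quadratic growth of the
    exponents, and so the sum over an occupation, l_1 and l_2 may be regrouped by
    total degree ([has_sum_fibres], [has_sum_trace]); its parts of fixed degree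
    are the dimensions. For the supercharacter each charge only acquires the sign
    given by the parity of N_f. *)

Set Implicit Arguments.
Unset Strict Implicit.
Unset Printing Implicit Defensive.

(** * Exponentials of commuting operators *)

Section ExpCoef.
Variables (F : numFieldType) (V : lmodType F).
Implicit Types (X Y : nat -> {linear V -> V}) (v w : V).

Lemma pow_coef_is_linear X r k : linear (pow_coef X r k).
Proof.
elim: r k => [|r IHr] k a v w /=.
  by case: ifP; rewrite ?scaler0 ?addr0.
rewrite scaler_sumr -big_split; apply: eq_bigr => m _.
by rewrite IHr linearP.
Qed.

HB.instance Definition _ X r k :=
  GRing.isLinear.Build F V V *:%R (pow_coef X r k) (pow_coef_is_linear X r k).

Lemma exp_coef_is_linear X k : linear (exp_coef X k).
Proof.
move=> a v w; rewrite /exp_coef scaler_sumr -big_split; apply: eq_bigr => r _.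
by rewrite linearP scalerDr !scalerA mulrC.
Qed.

HB.instance Definition _ X k :=
  GRing.isLinear.Build F V V *:%R (exp_coef X k) (exp_coef_is_linear X k).

Lemma pow_coef_gt X r k v : (k < r)%N -> pow_coef X r k v = 0.
Proof.
elim: r k => [|r IHr] k //= kr; rewrite big_nat big1 // => m mk.
by rewrite IHr ?linear0 //; lia.
Qed.

Lemma exp_coef_widen X n k v : (k < n)%N ->
  exp_coef X k v = \sum_(r < n) (r`!%:R)^-1 *: pow_coef X r k v.
Proof.
move=> kn; rewrite /exp_coef -!(big_mkord xpredT (fun r => (r`!%:R)^-1 *: pow_coef X r k v)).
rewrite (big_cat_nat (n := k.+1) (m := 0%N) (p := n)) //=.
rewrite [X in _ + X]big_nat [X in _ + X]big1 ?addr0 //.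
by move=> r kr; rewrite pow_coef_gt ?scaler0 //; lia.
Qed.

Lemma exp_coef0 X v : exp_coef X 0 v = v.
Proof. by rewrite /exp_coef big_ord1 /= invr1 scale1r. Qed.

Lemma pow_coef_comm X (f : {linear V -> V}) :
  (forall m v, (0 < m)%N -> f (X m v) = X m (f v)) ->
  forall r k v, f (pow_coef X r k v) = pow_coef X r k (f v).
Proof.
move=> fX; elim=> [|r IHr] k v /=; first by case: ifP; rewrite ?linear0.
rewrite linear_sum [LHS]big_nat [RHS]big_nat; apply: eq_bigr => m mk.
by rewrite fX ?IHr //; lia.
Qed.

Lemma exp_coef_comm X (f : {linear V -> V}) :
  (forall m v, (0 < m)%N -> f (X m v) = X m (f v)) ->
  forall k v, f (exp_coef X k v) = exp_coef X k (f v).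
Proof.
move=> fX k v; rewrite linear_sum; apply: eq_bigr => r _.
by rewrite linearZ /= pow_coef_comm.
Qed.

Definition commuting X :=
  forall m n v, (0 < m)%N -> (0 < n)%N -> X m (X n v) = X n (X m v).

(** The rule (X^(r+1))' = (r+1) X^r X', coefficient by coefficient; the X_m
    commute, so it holds as for scalar series. *)
Lemma pow_coef_euler X : commuting X -> forall r k v,
  k%:R *: pow_coef X r.+1 k v
  = r.+1%:R *: \sum_(1 <= m < k.+1) m%:R *: X m (pow_coef X r (k - m) v).
Proof.
move=> Xc; elim=> [|r IHr] k v.
  rewrite scale1r /= scaler_sumr [LHS]big_nat [RHS]big_nat; apply: eq_bigr => m mk.
  by case: ifP => km; rewrite ?linear0 ?scaler0 //; congr (_%:R *: _); lia.
have -> : k%:R *: pow_coef X r.+2 k v =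
    \sum_(1 <= m < k.+1) m%:R *: X m (pow_coef X r.+1 (k - m) v)
    + \sum_(1 <= m < k.+1) X m ((k - m)%:R *: pow_coef X r.+1 (k - m) v).
  transitivity (\sum_(1 <= m < k.+1) (m%:R *: X m (pow_coef X r.+1 (k - m) v)
      + X m ((k - m)%:R *: pow_coef X r.+1 (k - m) v))); last exact: big_split.
  rewrite [pow_coef X r.+2 k v]/= scaler_sumr.
  rewrite [LHS]big_nat [RHS]big_nat; apply: eq_bigr => m mk.
  by rewrite [X m (_ *: _)]linearZ -scalerDl -natrD; congr (_%:R *: _); lia.
have -> : \sum_(1 <= m < k.+1) X m ((k - m)%:R *: pow_coef X r.+1 (k - m) v)
   = r.+1%:R *: \sum_(1 <= m < k.+1) m%:R *: X m (pow_coef X r.+1 (k - m) v).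
  transitivity (r.+1%:R *: \sum_(1 <= m < k.+1) \sum_(1 <= n < k.+1)
     if (n <= k - m)%N then n%:R *: X m (X n (pow_coef X r (k - m - n) v)) else 0).
    rewrite scaler_sumr [LHS]big_nat [RHS]big_nat; apply: eq_bigr => m mk.
    rewrite IHr linearZ /= linear_sum; congr (_ *: _).
    rewrite [RHS](big_cat_nat (n := (k - m).+1) (p := k.+1)) //=; last by lia.
    rewrite [X in _ + X]big_nat [X in _ + X]big1 ?addr0 => [|n nk]; last first.
      by case: ifP => //; lia.
    rewrite [LHS]big_nat [RHS]big_nat; apply: eq_bigr => n nk.
    by rewrite linearZ ifT //; lia.
  congr (_ *: _); rewrite exchange_big_nat /= [LHS]big_nat [RHS]big_nat.
  apply: eq_bigr => n nk; rewrite linear_sum scaler_sumr.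
  rewrite [LHS](big_cat_nat (n := (k - n).+1) (p := k.+1)) //=; last by lia.
  rewrite [X in _ + X]big_nat [X in _ + X]big1 ?addr0 => [|m mk]; last first.
    by case: ifP => //; lia.
  rewrite [LHS]big_nat [RHS]big_nat; apply: eq_bigr => m mk.
  rewrite ifT; last by lia.
  by rewrite subnAC; congr (_ *: _); apply: Xc; lia.
by rewrite -[X in X + _]scale1r -scalerDl nat1r.
Qed.

(** The coefficients of [exp X] extended by zero to negative exponents: with
    them no boundary case arises in the convolutions below. *)
Definition expz X (k : int) : V -> V :=
  locked (if k is Posz n then exp_coef X n else fun=> 0).

Lemma expz_nat X (k : nat) v : expz X k%:Z v = exp_coef X k v.
Proof. by rewrite /expz -lock. Qed.

Lemma expz_lt0 X k v : k < 0 -> expz X k v = 0.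
Proof. by rewrite /expz -lock; case: k. Qed.

Lemma expz_is_linear X k : linear (expz X k).
Proof.
case: k => k a v w; first by rewrite !expz_nat linearP.
by rewrite !expz_lt0 // scaler0 addr0.
Qed.

HB.instance Definition _ X k :=
  GRing.isLinear.Build F V V *:%R (expz X k) (expz_is_linear X k).

Lemma expz_zero X k : expz X k 0 = 0.
Proof. exact: linear0. Qed.

Lemma expz_sum X k (I : Type) (r : seq I) (P : pred I) (G : I -> V) :
  expz X k (\sum_(i <- r | P i) G i) = \sum_(i <- r | P i) expz X k (G i).
Proof. exact: linear_sum. Qed.

Lemma expz0 X v : expz X 0 v = v.
Proof. by rewrite expz_nat exp_coef0. Qed.

Lemma expz_comm X (f : {linear V -> V}) :
  (forall m v, (0 < m)%N -> f (X m v) = X m (f v)) ->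
  forall k v, f (expz X k v) = expz X k (f v).
Proof.
by move=> fX [k|k] v; [rewrite !expz_nat exp_coef_comm | rewrite !expz_lt0 ?linear0].
Qed.

(** The coefficients of (exp X)' = X' exp X. This recursion determines [expz X]
    and replaces the explicit exponential series from here on. *)
Lemma expz_euler X : commuting X -> forall (B : nat) (k : int) v, k < B%:Z ->
  k%:~R *: expz X k v = \sum_(1 <= m < B) m%:R *: X m (expz X (k - m%:Z) v).
Proof.
move=> Xc B [k|k] v kB; last first.
  rewrite expz_lt0 //.
  by rewrite scaler0 big1 // => m _; rewrite expz_lt0 ?linear0 ?scaler0 //; lia.
have -> : \sum_(1 <= m < B) m%:R *: X m (expz X (k%:Z - m%:Z) v)
   = \sum_(1 <= m < k.+1) m%:R *: X m (exp_coef X (k - m) v).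
  rewrite (big_cat_nat (n := k.+1)) //=.
  rewrite [X in _ + X]big_nat [X in _ + X]big1 ?addr0 => [|m mk].
    rewrite [LHS]big_nat [RHS]big_nat; apply: eq_bigr => m mk.
    by rewrite -expz_nat; congr (_ *: X m (expz X _ _)); lia.
  by rewrite expz_lt0 ?linear0 ?scaler0 //; lia.
rewrite expz_nat -pmulrn.
have -> : \sum_(1 <= m < k.+1) m%:R *: X m (exp_coef X (k - m) v) =
  \sum_(1 <= m < k.+1) m%:R *: X m (\sum_(r < k) (r`!%:R)^-1 *: pow_coef X r (k - m) v).
  rewrite [LHS]big_nat [RHS]big_nat; apply: eq_bigr => m mk.
  by rewrite (@exp_coef_widen _ k) //; lia.
rewrite /exp_coef big_ord_recl scalerDr.
have -> : k%:R *: (((ord0 : 'I_k.+1)`!%:R)^-1 *: pow_coef X (ord0 : 'I_k.+1) k v) = 0.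
  by rewrite /=; case: eqP => [->|_]; rewrite ?scale0r // !scaler0.
rewrite add0r scaler_sumr.
transitivity (\sum_(r < k) \sum_(1 <= m < k.+1)
   (m%:R * (r`!%:R)^-1) *: X m (pow_coef X r (k - m) v)).
  apply: eq_bigr => r _; rewrite scalerA mulrC -scalerA.
  rewrite -[nat_of_ord (fintype.lift ord0 r)]/(r.+1).
  rewrite (pow_coef_euler Xc) scalerA factS natrM invfM -mulrA mulrC.
  rewrite -mulrA divff ?pnatr_eq0 // mulr1 scaler_sumr.
  by apply: eq_bigr => m _; rewrite scalerA mulrC.
rewrite exchange_big; apply: eq_bigr => m _ /=.
rewrite linear_sum scaler_sumr; apply: eq_bigr => r _.
by rewrite linearZ /= scalerA.
Qed.

(** Bracketing with f is a derivation, so a scalar bracket kappa with X_m alone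
    gives [f, exp X(z)] = kappa z^m exp X(z); on coefficients this follows from
    the Euler recursion by induction on k. *)
Lemma expz_bracket X (f : {linear V -> V}) (m : nat) (kappa : F) :
  commuting X -> (0 < m)%N ->
  (forall n v, (0 < n)%N -> f (X n v) = X n (f v) + (kappa *+ (n == m)) *: v) ->
  forall k v, f (expz X k v) = expz X k (f v) + kappa *: expz X (k - m%:Z) v.
Proof.
move=> Xc m0 fX k v; have [n kn] : exists n : nat, k < n%:Z.
  by exists `|k|%N.+1; lia.
elim: n k kn => [|n IHn] k kn; first by rewrite !expz_lt0 ?linear0 ?scaler0 ?addr0 //; lia.
have [k0|k0] := ltrP k 0.
  by rewrite !expz_lt0 ?linear0 ?scaler0 ?addr0 //; lia.
have [->|kn0] := eqVneq k 0.
  by rewrite !expz0 expz_lt0 ?scaler0 ?addr0 //; lia.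
have kF : (k%:~R : F) != 0 by rewrite intr_eq0.
apply: (scalerI kF); rewrite scalerDr -[k%:~R *: f _]linearZ /=.
pose B := (n + m).+2.
rewrite !(expz_euler Xc (B := B)); try lia.
rewrite linear_sum.
transitivity (\sum_(1 <= i < B)
   (i%:R *: X i (expz X (k - i%:Z) (f v))
    + kappa *: (i%:R *: X i (expz X (k - m%:Z - i%:Z) v))
    + (i%:R * (kappa *+ (i == m))) *: expz X (k - i%:Z) v)).
  rewrite [LHS]big_nat [RHS]big_nat; apply: eq_bigr => i iB.
  rewrite linearZ /= fX; last by lia.
  rewrite scalerDr scalerA; congr (_ + _).
  rewrite IHn; last by lia.
  rewrite linearD scalerDr; congr (_ + _); rewrite linearZ /= !scalerA mulrC.
  by congr (_ *: X i (expz X _ v)); lia.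
rewrite !big_split /= -addrA; congr (_ + _).
rewrite -scaler_sumr -(expz_euler Xc); last by lia.
rewrite (bigD1_seq m) ?iota_uniq ?mem_index_iota //=; last by lia.
rewrite eqxx mulr1n big1 ?addr0 => [|i /negPf->]; last by rewrite mulr0 scale0r.
rewrite !scalerA -scalerDl; congr (_ *: _).
by rewrite mulrC -mulrDl intrB -!pmulrn subrK.
Qed.

(** exp X exp(-X) = 1: the Euler recursion for both factors turns s times the
    sum into terms that cancel after a shift of i. *)
Lemma expz_inverse X Y : commuting X -> commuting Y ->
  (forall m v, (0 < m)%N -> Y m v = - X m v) ->
  forall (B : nat) (s : int) v, s < B%:Z ->
  \sum_(i < B) expz X i%:Z (expz Y (s - i%:Z) v) = if s == 0 then v else 0.
Proof.
move=> Xc Yc YX B s v sB.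
have XY m n w : (0 < m)%N -> (0 < n)%N -> X m (Y n w) = Y n (X m w).
  by move=> m0 n0; rewrite !YX // linearN /= Xc.
have [s0|s0] := ltrP s 0.
  rewrite big1 => [|i _]; last by rewrite (@expz_lt0 Y) ?linear0 //; lia.
  by case: eqP => //; lia.
have [->|sn0] := eqVneq s 0.
  case: B sB => [|B] sB; first by lia.
  rewrite big_ord_recl (expz0 X) subr0 (expz0 Y) big1 ?addr0 // => i _.
  by rewrite (@expz_lt0 Y) ?linear0.
have sF : (s%:~R : F) != 0 by rewrite intr_eq0.
apply: (scalerI sF); rewrite scaler0 scaler_sumr.
have shift m : \sum_(i < B) expz X (i%:Z - m%:Z) (expz Y (s - i%:Z) v)
   = \sum_(i < B) expz X i%:Z (expz Y (s - m%:Z - i%:Z) v).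
  have [mB|Bm] := leqP m B; last first.
    rewrite !big1 // => i _; first by rewrite (@expz_lt0 Y) ?linear0 //; lia.
    by rewrite (@expz_lt0 X) //; have := ltn_ord i; lia.
  rewrite -!(big_mkord xpredT (fun i : nat => expz X (i%:Z - _) (expz Y (s - i%:Z) v))).
  rewrite -!(big_mkord xpredT (fun i : nat => expz X i%:Z (expz Y (s - m%:Z - i%:Z) v))).
  rewrite (big_cat_nat (n := m)) //= big_nat big1 ?add0r => [|i im]; last first.
    by rewrite (@expz_lt0 X) //; lia.
  rewrite [RHS](big_cat_nat (n := (B - m)%N)) //=; last by lia.
  rewrite [X in _ = _ + X]big_nat [X in _ = _ + X]big1 ?addr0 => [|i im]; last first.
    by rewrite (@expz_lt0 Y) ?linear0 //; lia.
  rewrite -[X in \sum_(X <= _ < _) _]add0n big_addn; apply: eq_bigr => i _.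
  by congr (expz X _ (expz Y _ _)); lia.
transitivity (\sum_(i < B) (\sum_(1 <= m < B) m%:R *: X m (expz X (i%:Z - m%:Z) (expz Y (s - i%:Z) v))
   - \sum_(1 <= m < B) m%:R *: X m (expz X i%:Z (expz Y (s - i%:Z - m%:Z) v)))).
  apply: eq_bigr => i _.
  have -> : (s%:~R : F) = i%:Z%:~R + (s - i%:Z)%:~R by rewrite -intrD addrC subrK.
  rewrite scalerDl (expz_euler Xc (B := B)); last by have := ltn_ord i; lia.
  congr (_ + _); rewrite -linearZ /= (expz_euler Yc (B := B)); last by lia.
  rewrite linear_sum -sumrN [LHS]big_nat [RHS]big_nat; apply: eq_bigr => m mB.
  rewrite linearZ /= YX; last by lia.
  rewrite linearN scalerN; congr (- (_ *: _)).
  by rewrite [RHS](expz_comm (f := X m)) // => n w n0; apply: Xc => //; lia.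
rewrite sumrB exchange_big [X in _ - X]exchange_big /= -sumrB big1 // => m _.
apply/eqP; rewrite subr_eq0 -!scaler_sumr -!linear_sum shift; apply/eqP.
congr (_ *: X m _); apply: eq_bigr => i _; congr (expz X _ (expz Y _ _)); lia.
Qed.

End ExpCoef.
Section Exchange.
Variables (F : numFieldType) (V : lmodType F).
Variables (A C : nat -> {linear V -> V}) (c : F).
Hypotheses (Ac : commuting A) (Cc : commuting C).
Hypothesis AC : forall m n v, (0 < m)%N -> (0 < n)%N ->
  A m (C n v) = C n (A m v) + ((c / m%:R) *+ (n == m)) *: v.
Implicit Type v : V.
Local Notation e := (expz A).
Local Notation f := (expz C).

Let A_f m j v : (0 < m)%N ->
  m%:R *: A m (f j v) = m%:R *: f j (A m v) + c *: f (j - m%:Z) v.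
Proof.
move=> m0; rewrite (expz_bracket Cc m0 (kappa := c / m%:R)) => [|n w n0]; last first.
  exact: AC.
by rewrite scalerDr scalerA mulrCA divff ?mulr1 // pnatr_eq0; lia.
Qed.

(** For c = -1 the logarithms have the bracket log (1 - w/z), so e(z) f(w) = (1
    - w/z) f(w) e(z), the exchange relation for two equal vertex operators. The
    Euler recursion in k proves it: the terms that do not match telescope. *)
Lemma expz_exchange_same : c = -1 -> forall k j v,
  e k (f j v) = f j (e k v) - f (j - 1) (e (k - 1) v).
Proof.
move=> c1 k j v; have [n kn] : exists n : nat, k < n%:Z by exists `|k|%N.+1; lia.
elim: n k kn j v => [|n IHn] k kn j v.
  by rewrite !(@expz_lt0 _ _ A) ?expz_zero ?subr0 //; lia.
have [k0|k0] := ltrP k 0; first by rewrite !(@expz_lt0 _ _ A) ?expz_zero ?subr0 //; lia.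
have [->|kn0] := eqVneq k 0.
  by rewrite !expz0 (@expz_lt0 _ _ A) ?expz_zero ?subr0.
have kF : (k%:~R : F) != 0 by rewrite intr_eq0.
pose B := n.+2; pose t m := f (j - m%:Z) (e (k - m%:Z) v).
have euler i (w : V) : i < B%:Z -> i%:~R *: e i w = \sum_(1 <= m < B) m%:R *: A m (e (i - m%:Z) w).
  exact: expz_euler.
apply: (scalerI kF); rewrite euler; last by lia.
have -> : \sum_(1 <= m < B) m%:R *: A m (e (k - m%:Z) (f j v)) =
  \sum_(1 <= m < B) (m%:R *: f j (A m (e (k - m%:Z) v))
    - m%:R *: f (j - 1) (A m (e (k - 1 - m%:Z) v)) + (t m.+1 - t m)).
  rewrite [LHS]big_nat [RHS]big_nat; apply: eq_bigr => m mB.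
  rewrite IHn; last by lia.
  rewrite linearB scalerBr !A_f; try lia.
  rewrite opprD addrACA; congr (_ - _ *: f _ (A _ (e _ _)) + _); first by lia.
  rewrite c1 !scaleN1r opprK addrC /t; congr (f _ (e _ _) - _); lia.
have tB : t B = 0 by rewrite /t (@expz_lt0 _ _ A) ?expz_zero //; lia.
rewrite big_split telescope_sumr //= tB sub0r.
rewrite sumrB scalerBr -linearZ /= euler; last by lia.
rewrite -addrA; congr (_ + _).
  by rewrite linear_sum; apply: eq_bigr => m _; rewrite linearZ.
have -> : \sum_(1 <= m < B) m%:R *: f (j - 1) (A m (e (k - 1 - m%:Z) v))
   = (k - 1)%:~R *: f (j - 1) (e (k - 1) v).
  rewrite -linearZ /= euler; last by lia.
  by rewrite linear_sum; apply: eq_bigr => m _; rewrite linearZ.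
by rewrite -opprD /t -{2}[f _ _]scale1r -scalerDl intrB subrK.
Qed.

(** For c = 1, which belongs to opposite vertex operators, the exchange factor
    is the series 1 / (1 - w/z); multiplied out, the relation stays finite. *)
Lemma expz_exchange_opp : c = 1 -> forall k j v,
  f j (e k v) = e k (f j v) - e (k - 1) (f (j - 1) v).
Proof.
move=> c1 k j v; have [n kn] : exists n : nat, k < n%:Z by exists `|k|%N.+1; lia.
elim: n k kn j v => [|n IHn] k kn j v.
  by rewrite !(@expz_lt0 _ _ A) ?expz_zero ?subr0 //; lia.
have [k0|k0] := ltrP k 0; first by rewrite !(@expz_lt0 _ _ A) ?expz_zero ?subr0 //; lia.
have [->|kn0] := eqVneq k 0.
  by rewrite !expz0 (@expz_lt0 _ _ A) ?expz_zero ?subr0.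
have kF : (k%:~R : F) != 0 by rewrite intr_eq0.
pose B := n.+2; pose t m := e (k - m%:Z) (f (j - m%:Z) v).
have euler i (w : V) : i < B%:Z -> i%:~R *: e i w = \sum_(1 <= m < B) m%:R *: A m (e (i - m%:Z) w).
  exact: expz_euler.
apply: (scalerI kF); rewrite -linearZ /= euler; last by lia.
rewrite linear_sum.
have -> : \sum_(1 <= m < B) f j (m%:R *: A m (e (k - m%:Z) v)) =
  \sum_(1 <= m < B) (m%:R *: A m (e (k - m%:Z) (f j v))
    - m%:R *: A m (e (k - 1 - m%:Z) (f (j - 1) v)) + (t m.+1 - t m)).
  rewrite [LHS]big_nat [RHS]big_nat; apply: eq_bigr => m mB.
  rewrite linearZ /=; have := @A_f m j (e (k - m%:Z) v); rewrite c1 scale1r.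
  move/(_ ltac:(lia))/eqP; rewrite -subr_eq => /eqP <-.
  rewrite !IHn; try lia.
  rewrite linearB scalerBr opprB; congr (_ - _ *: A _ (e _ _) + (_ - _)); try lia.
  by rewrite /t; congr (e _ (f _ _)); lia.
have tB : t B = 0 by rewrite /t (@expz_lt0 _ _ A) //; lia.
rewrite big_split telescope_sumr //= tB sub0r.
rewrite sumrB scalerBr euler; last by lia.
rewrite -addrA; congr (_ + _).
rewrite -euler; last by lia.
by rewrite -opprD /t -{2}[e _ _]scale1r -scalerDl intrB subrK.
Qed.

End Exchange.

(** * Vertex operators with opposite exponents *)

Section Grading.
Variables (F : numFieldType) (V : lmodType F) (D : int -> V -> Prop).
Hypotheses (D0 : forall n, D n 0)
           (DD : forall n v w, D n v -> D n w -> D n (v + w))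
           (DZ : forall n a v, D n v -> D n (a *: v)).
Variables (X : nat -> {linear V -> V}) (sg : int).
Hypothesis DX : forall m n v, (0 < m)%N -> D n v -> D (n + sg * m%:Z) (X m v).

Lemma graded_sum (I : eqType) (r : seq I) (P : pred I) (G : I -> V) n :
  (forall i, i \in r -> P i -> D n (G i)) -> D n (\sum_(i <- r | P i) G i).
Proof. by move=> DG; rewrite big_seq_cond; apply: big_ind => [||i /andP[]]; auto. Qed.

Lemma pow_coef_graded r k n v : D n v -> D (n + sg * k%:Z) (pow_coef X r k v).
Proof.
elim: r k n => [|r IHr] k n Dv /=.
  by case: eqP => [->|_] //; rewrite mulr0 addr0.
apply: graded_sum => m; rewrite mem_index_iota => mk _.
have -> : n + sg * k%:Z = n + sg * (k - m)%:Z + sg * m%:Z.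
  by rewrite -addrA -mulrDr; congr (_ + _ * _); lia.
by apply: DX; [lia | exact: IHr].
Qed.

Lemma expz_graded k n v : D n v -> D (n + sg * k) (expz X k v).
Proof.
case: k => k Dv; last by rewrite expz_lt0.
rewrite expz_nat; by apply: graded_sum => r _ _; apply/DZ/pow_coef_graded.
Qed.

End Grading.

Lemma sum_shift (V : zmodType) (B : nat) (G : nat -> V) :
  G 0%N = 0 -> G B = 0 -> \sum_(k < B) G k.+1 = \sum_(k < B) G k.
Proof.
move=> G0 GB; have : \sum_(k < B.+1) G k = \sum_(k < B) G k.
  by rewrite big_ord_recr /= GB addr0.
by rewrite big_ord_recl /= G0 add0r.
Qed.

Section VertexAlgebra.
Variables (F : numFieldType) (V : lmodType F) (D : int -> V -> Prop).
Hypotheses (D0 : forall n, D n 0)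
           (DD : forall n v w, D n v -> D n w -> D n (v + w))
           (DZ : forall n a v, D n v -> D n (a *: v))
           (D_lt0 : forall n v, n < 0 -> D n v -> v = 0).
Variables A C : bool -> nat -> {linear V -> V}.
Hypotheses (AA : forall b b' m n v, (0 < m)%N -> (0 < n)%N ->
              A b m (A b' n v) = A b' n (A b m v))
           (CC : forall b b' m n v, (0 < m)%N -> (0 < n)%N ->
              C b m (C b' n v) = C b' n (C b m v))
           (AC : forall b b' m n v, (0 < m)%N -> (0 < n)%N ->
              A b m (C b' n v)
              = C b' n (A b m v) + (((-1) ^+ (b == b') / m%:R) *+ (n == m)) *: v)
           (CN : forall b m v, (0 < m)%N -> C (~~ b) m v = - C b m v)
           (DA : forall b m n v, (0 < m)%N -> D n v -> D (n - m%:Z) (A b m v))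
           (DC : forall b m n v, (0 < m)%N -> D n v -> D (n + m%:Z) (C b m v)).
Local Notation e b := (expz (A b)).
Local Notation f b := (expz (C b)).
Implicit Types (v : V) (b : bool).

Lemma expz_ann_graded b k n v : D n v -> D (n - k) (e b k v).
Proof.
rewrite -mulN1r; apply: expz_graded => // m n' w m0; rewrite mulN1r; exact: DA.
Qed.

Lemma expz_cre_graded b k n v : D n v -> D (n + k) (f b k v).
Proof.
rewrite -{1}[k]mul1r; apply: expz_graded => // m n' w m0; rewrite mul1r; exact: DC.
Qed.

Lemma expz_ann_eq0 b k n v : D n v -> n < k -> e b k v = 0.
Proof. by move=> /(expz_ann_graded b k) Dn nk; apply: D_lt0 Dn; lia. Qed.

Let ff b b' k j v : f b k (f b' j v) = f b' j (f b k v).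
Proof.
apply: (expz_comm (f := f b k)) => m w m0.
by apply/esym/(expz_comm (f := C b' m)) => n u n0; apply: CC.
Qed.

Let ee b b' k j v : e b k (e b' j v) = e b' j (e b k v).
Proof.
apply: (expz_comm (f := e b k)) => m w m0.
by apply/esym/(expz_comm (f := A b' m)) => n u n0; apply: AA.
Qed.

(** The coefficient of z^p in f(z) e(z), the vertex operator stripped of its
    zero modes; a cutoff B above the degree of the vector loses nothing. *)
Definition vertex_mode b (B : nat) (p : int) v : V :=
  \sum_(k < B) f b (p + k%:Z) (e b k%:Z v).

Lemma vertex_mode_is_linear b B p : linear (vertex_mode b B p).
Proof.
move=> a v w; rewrite /vertex_mode scaler_sumr -big_split.
by apply: eq_bigr => k _; rewrite !linearP.
Qed.
HB.instance Definition _ b B p :=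
  GRing.isLinear.Build F V V *:%R (vertex_mode b B p) (vertex_mode_is_linear b B p).

Lemma vertex_mode_comm (h : {linear V -> V}) b B p v :
  (forall m w, (0 < m)%N -> h (A b m w) = A b m (h w)) ->
  (forall m w, (0 < m)%N -> h (C b m w) = C b m (h w)) ->
  h (vertex_mode b B p v) = vertex_mode b B p (h v).
Proof.
move=> hA hC; rewrite linear_sum; apply: eq_bigr => k _.
by rewrite !(expz_comm (f := h)).
Qed.

Lemma vertex_mode_graded b B p n v : D n v -> D (n + p) (vertex_mode b B p v).
Proof.
move=> Dv; apply: graded_sum => // k _ _.
rewrite -[n + p](_ : n - k%:Z + (p + k%:Z) = _); last by lia.
exact/expz_cre_graded/expz_ann_graded.
Qed.

(** The coefficient of z^p w^p' in the normal ordered product. *)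
Definition normal_mode b b' (B : nat) (p p' : int) v : V :=
  \sum_(k < B) \sum_(j < B) f b (p + k%:Z) (f b' (p' + j%:Z)
                              (e b k%:Z (e b' j%:Z v))).

Lemma normal_modeC b b' B p p' v :
  normal_mode b b' B p p' v = normal_mode b' b B p' p v.
Proof.
rewrite /normal_mode exchange_big; apply: eq_bigr => j _; apply: eq_bigr => k _.
by rewrite ff ee.
Qed.

(** The exchange factor 1 - w/z of equal vertex operators becomes a difference
    of two normal ordered modes. *)
Lemma vertex_mode_same (d B : nat) b p p' v : D d%:Z v -> (d < B.-1)%N ->
  vertex_mode b B p (vertex_mode b B p' v)
  = normal_mode b b B p p' v - normal_mode b b B (p + 1) (p' - 1) v.
Proof.
move=> Dv dB; rewrite /vertex_mode /normal_mode -sumrB.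
have -> : \sum_(k < B) f b (p + k%:Z) (e b k%:Z (\sum_(j < B) f b (p' + j%:Z) (e b j%:Z v)))
  = \sum_(k < B) \sum_(j < B) (f b (p + k%:Z) (f b (p' + j%:Z) (e b k%:Z (e b j%:Z v)))
     - f b (p + k%:Z) (f b (p' - 1 + j%:Z) (e b (k%:Z - 1) (e b j%:Z v)))).
  apply: eq_bigr => k _; rewrite !expz_sum; apply: eq_bigr => j _.
  rewrite (@expz_exchange_same _ _ (A b) (C b) (-1)) //.
  - by rewrite linearB; congr (_ - f b _ (f b _ _)); lia.
  - by move=> *; apply: AA.
  - by move=> *; apply: CC.
  - by move=> m n w m0 n0; rewrite AC // eqxx expr1.
rewrite !sumrB; under eq_bigr do rewrite sumrB.
rewrite sumrB; congr (_ - _); apply/esym.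
pose G k := \sum_(j < B) f b (p + k%:Z) (f b (p' - 1 + j%:Z) (e b (k%:Z - 1) (e b j%:Z v))).
transitivity (\sum_(k < B) G k.+1).
  apply: eq_bigr => k _; apply: eq_bigr => j _.
  by congr (f b _ (f b _ (e b _ _))); lia.
apply: sum_shift; rewrite /G big1 // => j _; first by rewrite (@expz_lt0 _ _ (A b)) ?expz_zero.
rewrite (@expz_ann_eq0 b _ (d%:Z - j%:Z)) ?expz_zero //; last by lia.
exact: expz_ann_graded.
Qed.

(** For adjacent modes the two normal ordered modes of [vertex_mode_same] differ
    by the order of the factors only, and cancel. This is the fermionic
    behaviour of a vertex operator. *)
Lemma vertex_mode_sqr0 (d B : nat) b p v : D d%:Z v -> (d < B.-1)%N ->
  vertex_mode b B p (vertex_mode b B (p + 1) v) = 0.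
Proof.
by move=> Dv dB; rewrite (vertex_mode_same _ _ _ Dv dB) addrK normal_modeC subrr.
Qed.

(** Multiplied by 1 - w/z, a product of opposite vertex operators is normal
    ordered: neighbouring products of modes differ by a normal ordered mode. *)
Lemma vertex_mode_opp (d B : nat) b p v :
  D d%:Z v -> (d + `|p| < B)%N ->
  vertex_mode b B p (vertex_mode (~~ b) B (- p) v)
  = normal_mode b (~~ b) B p (- p) v
    + vertex_mode b B (p + 1) (vertex_mode (~~ b) B (- (p + 1)) v).
Proof.
move=> Dv dB; rewrite /normal_mode.
have -> : \sum_(k < B) \sum_(j < B) f b (p + k%:Z) (f (~~ b) (- p + j%:Z)
                              (e b k%:Z (e (~~ b) j%:Z v))) =
  vertex_mode b B p (vertex_mode (~~ b) B (- p) v) -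
  \sum_(k < B) f b (p + k%:Z) (e b (k%:Z - 1) (vertex_mode (~~ b) B (- (p + 1)) v)).
  rewrite -sumrB; apply: eq_bigr => k _; rewrite !expz_sum -sumrB.
  apply: eq_bigr => j _; rewrite (@expz_exchange_opp _ _ (A b) (C (~~ b)) 1) //.
  - by rewrite linearB; congr (_ - f b _ (e b _ (f _ _ _))); lia.
  - by move=> *; apply: AA.
  - by move=> *; apply: CC.
  - by move=> m n w m0 n0; rewrite AC // (_ : (b == ~~ b) = false) ?expr0 //; case: (b).
rewrite -addrA addrC -[X in X = _]add0r; congr (_ + _).
apply/esym/eqP; rewrite addrC subr_eq0; apply/eqP.
pose w := vertex_mode (~~ b) B (- (p + 1)) v.
pose G k := f b (p + k%:Z) (e b (k%:Z - 1) w).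
transitivity (\sum_(k < B) G k.+1).
  by apply: eq_bigr => k _; congr (f b _ (e b _ _)); lia.
apply: sum_shift; rewrite /G; first by rewrite (@expz_lt0 _ _ (A b)) ?expz_zero.
rewrite (@expz_ann_eq0 b _ (d%:Z - (p + 1))) ?expz_zero //; last by lia.
exact: vertex_mode_graded.
Qed.

Lemma vertex_mode0 b B p : vertex_mode b B p 0 = 0.
Proof. by apply: big1 => k _; rewrite !expz_zero. Qed.

Let vertex_mode_opp_iter (d B n : nat) b p v :
  D d%:Z v -> (d + `|p| + n < B)%N ->
  vertex_mode b B p (vertex_mode (~~ b) B (- p) v)
  = \sum_(i < n) normal_mode b (~~ b) B (p + i%:Z) (- (p + i%:Z)) v
    + vertex_mode b B (p + n%:Z) (vertex_mode (~~ b) B (- (p + n%:Z)) v).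
Proof.
move=> Dv; elim: n => [|n IHn] dB; first by rewrite big_ord0 add0r addr0.
rewrite IHn; last by lia.
rewrite (@vertex_mode_opp d B b (p + n%:Z)) //; last by lia.
rewrite big_ord_recr /= addrA; congr (_ + vertex_mode b B _ (vertex_mode _ B _ v)); lia.
Qed.

Let vertex_mode_eq0 (d B : nat) b (p : int) v :
  D d%:Z v -> d%:Z < p -> vertex_mode b B (- p) v = 0.
Proof.
move=> Dv dp; apply: big1 => k _.
have [kd|dk] := ltnP d k; last by rewrite expz_lt0 //; lia.
by rewrite (expz_ann_eq0 _ Dv) ?expz_zero //; lia.
Qed.

(** The normal ordered product of opposite vertex operators at coinciding points
    is 1: the creation exponentials cancel, and so nothing remains of the
    annihilation exponentials but their constant terms. *)
Let normal_mode_sum (d T B : nat) b v : D d%:Z v -> (d < T)%N -> (d < B)%N ->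
  \sum_(i < T.*2) normal_mode b (~~ b) B (i%:Z - T%:Z) (- (i%:Z - T%:Z)) v = v.
Proof.
move=> Dv dT dB; rewrite exchange_big.
have inner (k j : nat) : \sum_(i < T.*2) f b (i%:Z - T%:Z + k%:Z) (f (~~ b)
    (- (i%:Z - T%:Z) + j%:Z) (e b k%:Z (e (~~ b) j%:Z v)))
    = if (k == 0%N) && (j == 0%N) then v else 0.
  set w := e b _ _.
  have [kj|kj] := ltnP d (k + j).
    have -> : w = 0.
      apply: (@expz_ann_eq0 b k%:Z (d%:Z - j%:Z)); last by lia.
      exact: expz_ann_graded.
    rewrite big1 => [|i _]; last by rewrite !expz_zero.
    by case: ifP => //; lia.
  have := @expz_inverse _ _ (C b) (C (~~ b)) _ _ _ (T + k) (k + j)%:Z w.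
  have -> : (if (k + j)%:Z == 0 then w else 0) = if (k == 0%N) && (j == 0%N) then v else 0.
    have -> : ((k + j)%:Z == 0) = (k == 0%N) && (j == 0%N) by lia.
    by case: ifP => // /andP[/eqP k0 /eqP j0]; rewrite /w k0 j0 !expz0.
  move=> <-; try by move=> *; apply: CC.
  - rewrite -!(big_mkord xpredT (fun i : nat => f b i%:Z (f (~~ b) ((k + j)%:Z - i%:Z) w))).
    rewrite -!(big_mkord xpredT (fun i : nat => f b (i%:Z - T%:Z + k%:Z)
                                    (f (~~ b) (- (i%:Z - T%:Z) + j%:Z) w))).
    rewrite (big_cat_nat (n := (T - k)%N)) //=; last by lia.
    rewrite [X in X + _]big_nat [X in X + _]big1 ?add0r => [|i ik]; last first.
      by rewrite expz_lt0 //; lia.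
    rewrite -[X in \sum_(X <= _ < _) _]add0n big_addn.
    have -> : (T.*2 - (T - k) = T + k)%N by lia.
    by apply: eq_bigr => i _; congr (f b _ (f _ _ w)); lia.
  - by move=> m u m0; apply: CN.
  - by lia.
transitivity (\sum_(k < B) \sum_(j < B) if (k == 0%N :> nat) && (j == 0%N :> nat) then v else 0).
  apply: eq_bigr => k _; rewrite exchange_big /=; apply: eq_bigr => j _; exact: inner.
case: B dB => // B dB.
rewrite big_ord_recl big_ord_recl /= big1 ?addr0 // big1 ?addr0 // => i _.
by rewrite big1.
Qed.

(** Each of the two products telescopes into normal ordered modes, the first one
    into those from p upwards and the second one into those below p. Together
    they give all coefficients of the normal ordered product at coinciding
    points, which is 1. *)
Lemma vertex_mode_anticomm (d B : nat) b p v :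
  D d%:Z v -> ((d + `|p|).+2.*2.*2 < B)%N ->
  vertex_mode b B p (vertex_mode (~~ b) B (- p) v)
  + vertex_mode (~~ b) B (1 - p) (vertex_mode b B (p - 1) v) = v.
Proof.
move=> Dv dB; pose T := (d + `|p|).+2.
have [n1 n1E] : exists n : nat, n%:Z = T%:Z - p.
  by exists (absz (T%:Z - p)%R); lia.
have [n2 n2E] : exists n : nat, n%:Z = T%:Z + p.
  by exists (absz (T%:Z + p)%R); lia.
(* The first product telescopes up to the mode T, the second one, in its own
   index, up to T + 1; there the right factor annihilates v. *)
rewrite (@vertex_mode_opp_iter d B n1 b) //; last by lia.
rewrite (@vertex_mode_eq0 d B (~~ b) (p + n1%:Z)) //; last by lia.
have := @vertex_mode_opp_iter d B n2 (~~ b) (1 - p) v Dv; rewrite negbK.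
have -> : - (1 - p) = p - 1 by lia.
move=> ->; last by lia.
rewrite (@vertex_mode_eq0 d B b (1 - p + n2%:Z)) //; last by lia.
rewrite !vertex_mode0 !addr0 -[RHS](@normal_mode_sum d T B b) //; try lia.
rewrite -(big_mkord xpredT (fun i : nat => normal_mode b (~~ b) B (i%:Z - T%:Z) (- (i%:Z - T%:Z)) v)).
rewrite [RHS](big_cat_nat (n := n2)) //=; last by lia.
rewrite big_mkord [RHS]addrC; congr (_ + _).
  rewrite -[X in \sum_(X <= _ < _) _]add0n big_addn.
  have -> : (T.*2 - n2 = n1)%N by lia.
  by rewrite big_mkord; apply: eq_bigr => i _; congr (normal_mode _ _ _ _ _ v); lia.
rewrite (reindex_inj rev_ord_inj) /=; apply: eq_bigr => i _; rewrite normal_modeC.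
by have := ltn_ord i; move=> ?; congr (normal_mode _ _ _ _ _ v); lia.
Qed.

End VertexAlgebra.

(** * Oscillators on the Fock space *)

Section FreeModule.
Variables (K : nzRingType) (T : choiceType).
Implicit Types (v w : {freeg T / K}) (s : T).

Lemma freegE v : v = \sum_(s <- dom v) coeff s v *: << s >>.
Proof.
rewrite -{1}[v]freeg_sumE; apply: eq_bigr => s _.
by apply/eqP/freeg_eqP => x; rewrite coeffZ !coeffU mul1r.
Qed.

Lemma freegUZ a s : << a *g s >> = a *: << s >> :> {freeg T / K}.
Proof. by apply/eqP/freeg_eqP => x; rewrite coeffZ !coeffU mul1r. Qed.

Lemma coeff1U s s' : coeff s' (<< s >> : {freeg T / K}) = (s == s')%:R.
Proof. by rewrite coeffU mul1r. Qed.

Lemma fglift_is_linear (M : lmodType K) (f : T -> M) : linear (fglift f).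
Proof.
have fD v w : fglift f (v + w) = fglift f v + fglift f w.
  by rewrite -[w]opprK !(lift_is_additive f) !opprK -[- w]sub0r
    (lift_is_additive f) -(subrr w) (lift_is_additive f) subrr sub0r opprK.
have f0 : fglift f 0 = 0 by have := fD 0 0; rewrite addr0 => /eqP; rewrite eq_sym -subr_eq0 addrK => /eqP.
have fS (I : Type) (r : seq I) (G : I -> {freeg T / K}) :
    fglift f (\sum_(i <- r) G i) = \sum_(i <- r) fglift f (G i).
  by elim: r => [|i r IHr]; rewrite ?big_nil // !big_cons fD IHr.
move=> a v w; rewrite fD; congr (_ + _).
rewrite [in LHS](freegE v) [in RHS](freegE v) scaler_sumr !fS scaler_sumr.
by apply: eq_bigr => s _; rewrite scalerA -!freegUZ !liftU scalerA.
Qed.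

Lemma fglift1 (M : lmodType K) (f : T -> M) s : fglift f << s >> = f s.
Proof. by rewrite liftU scale1r. Qed.

Lemma freeg_linear_ext (M : lmodType K) (f g : {linear {freeg T / K} -> M}) :
  (forall s, f << s >> = g << s >>) -> forall v, f v = g v.
Proof.
move=> fg v; rewrite [v]freegE !linear_sum; apply: eq_bigr => s _.
by rewrite !linearZ /= fg.
Qed.

Definition supported (P : T -> Prop) v := forall s, s \in dom v -> P s.

Lemma supported0 P : supported P 0.
Proof. by move=> s; rewrite dom0. Qed.

Lemma supportedD P v w : supported P v -> supported P w -> supported P (v + w).
Proof.
by move=> Pv Pw s /domD_subset; rewrite mem_cat => /orP[]; [apply: Pv|apply: Pw].
Qed.

Lemma supportedZ P a v : supported P v -> supported P (a *: v).
Proof. by move=> Pv s /domZ_subset; apply: Pv. Qed.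

Lemma supported1 (P : T -> Prop) s : P s -> supported P << s >>.
Proof. by move=> Ps s'; rewrite domU1 inE => /eqP->. Qed.

Lemma supported_sum (I : eqType) (r : seq I) (C : pred I) (G : I -> {freeg T / K}) P :
  (forall i, i \in r -> C i -> supported P (G i)) ->
  supported P (\sum_(i <- r | C i) G i).
Proof.
move=> PG; rewrite big_seq_cond; apply: big_ind => [||i /andP[]]; auto.
  exact: supported0.
by move=> *; apply: supportedD.
Qed.

End FreeModule.

Lemma supported_linear (K : nzRingType) (T U : choiceType)
    (f : {linear {freeg T / K} -> {freeg U / K}}) (P : T -> Prop) (Q : U -> Prop) v :
  (forall s, P s -> supported Q (f << s >>)) -> supported P v -> supported Q (f v).
Proof.
move=> fPQ Pv; rewrite [v]freegE linear_sum; apply: supported_sum => s sv _.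
by rewrite linearZ; apply: supportedZ; apply: fPQ; apply: Pv.
Qed.

Section Oscillators.
Variables (R : realType) (logq : R[i]).
Local Notation C := R[i].
Local Notation V := (fock R).
Local Notation state := (charge R * occupation)%type.
Implicit Types (v : V) (s : state) (b : boson).

HB.instance Definition _ b n :=
  GRing.isLinear.Build C V V *:%R (osc logq b n) (fglift_is_linear _).
HB.instance Definition _ b e :=
  GRing.isLinear.Build C V V *:%R (@expQ R b e) (fglift_is_linear _).
HB.instance Definition _ b r :=
  GRing.isLinear.Build C V V *:%R (@eig0 R b r) (fglift_is_linear _).

Lemma cmode_is_linear l e n : linear (cmode logq l e n).
Proof. by move=> a v w; rewrite /cmode linearP scalerDr !scalerA mulrC. Qed.
HB.instance Definition _ l e n :=
  GRing.isLinear.Build C V V *:%R (cmode logq l e n) (cmode_is_linear l e n).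

Lemma raiseE (n : occupation) k x : raise n k x = (n x + (x == k))%N.
Proof.
rewrite /raise fsfunE !inE mem_finsupp; case: eqP => //= _.
by case: eqP => //= ->.
Qed.

Lemma lowerE (n : occupation) k x : lower n k x = (n x - (x == k))%N.
Proof. by rewrite /lower fsfunE mem_finsupp; case: eqP => //= ->. Qed.

Definition weight (n : occupation) : nat :=
  (\sum_(k <- finsupp n) k.2.+1 * n k)%N.

Lemma weightE (A : {fset (boson * nat)%type}) (n : occupation) :
  (finsupp n `<=` A)%fset -> weight n = (\sum_(k <- A) k.2.+1 * n k)%N.
Proof.
move=> nA; apply: big_fset_incl => // k _.
by rewrite mem_finsupp negbK => /eqP->; rewrite muln0.
Qed.

Lemma weight_ge (n : occupation) k : (k.2.+1 * n k <= weight n)%N.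
Proof.
have [ks|ks] := boolP (k \in finsupp n); first by rewrite /weight (big_fsetD1 _ ks) leq_addr.
by rewrite fsfun_dflt // muln0.
Qed.

Lemma weight_raise (n : occupation) k : weight (raise n k) = (weight n + k.2.+1)%N.
Proof.
pose A := (k |` finsupp n)%fset.
rewrite !(@weightE A); last 2 first.
- by apply/fsubsetP => x; rewrite !inE => ->; rewrite orbT.
- apply/fsubsetP => x; rewrite mem_finsupp raiseE !inE mem_finsupp.
  by case: (x == k); rewrite ?addn0.
have kA : k \in A by rewrite !inE eqxx.
rewrite !(big_fsetD1 _ kA) /= raiseE eqxx mulnDr muln1 addnAC; congr (_ + _ + _)%N.
rewrite big_seq [RHS]big_seq; apply: eq_bigr => x.
by rewrite !inE => /andP[/negPf xk _]; rewrite raiseE xk addn0.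
Qed.

Lemma mode_le_weight (n : occupation) k : n k != 0%N -> (k.2 < weight n)%N.
Proof. by move=> nk; apply: leq_trans (weight_ge n k); rewrite leq_pmulr // lt0n. Qed.

(** The weight as a sum over mode numbers below a cutoff, the form in which d
    yields it. *)
Lemma weight_nat (n : occupation) (B : nat) : (weight n < B)%N ->
  weight n = (\sum_(1 <= m < B) \sum_b m * n (b, m.-1))%N.
Proof.
move=> nB.
pose s := [seq (b, k) | k <- iota 0 B, b <- enum boson].
rewrite (weightE (A := [fset x in s]%fset)); last first.
  apply/fsubsetP => -[b k]; rewrite mem_finsupp !inE => nk.
  apply/allpairsP; exists (k, b); rewrite mem_enum mem_iota; split=> //=.
  have := weight_ge n (b, k); have : (0 < n (b, k))%N by rewrite lt0n.
  by move: nB => /=; nia.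
have us : uniq s by rewrite allpairs_uniq ?iota_uniq ?enum_uniq // => -[? ?] [? ?] _ _ [-> ->].
rewrite (perm_big s) /=; last first.
  by apply: uniq_perm => //; [apply: fset_uniq | move=> x; rewrite !inE].
rewrite /s big_allpairs_dep.
transitivity (\sum_(0 <= k < B) \sum_b k.+1 * n (b, k))%N.
  by rewrite /index_iota subn0; apply: eq_bigr => k _; rewrite big_enum.
case: B nB {s us} => // B nB.
rewrite big_nat_recr //= [X in (_ + X)%N](_ : _ = 0)%N ?addn0.
  by rewrite big_add1.
apply: big1 => b _; have := weight_ge n (b, B); rewrite /=.
by case: (n (b, B)) => [|x]; rewrite ?muln0 //; nia.
Qed.

Lemma lowerK (n : occupation) k : (0 < n k)%N -> raise (lower n k) k = n.
Proof.
move=> nk; apply/fsfunP => x; rewrite raiseE lowerE subnK //.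
by case: eqP => // ->.
Qed.

Lemma raiseK (n : occupation) k : lower (raise n k) k = n.
Proof. by apply/fsfunP => x; rewrite lowerE raiseE addnK. Qed.

Lemma raiseC (n : occupation) k k' : raise (raise n k) k' = raise (raise n k') k.
Proof. by apply/fsfunP => x; rewrite !raiseE addnAC. Qed.

Lemma lowerC (n : occupation) k k' : lower (lower n k) k' = lower (lower n k') k.
Proof. by apply/fsfunP => x; rewrite !lowerE subnAC. Qed.

Lemma raise_lower (n : occupation) k k' : k != k' ->
  lower (raise n k') k = raise (lower n k) k'.
Proof.
move=> kk'; apply/fsfunP => x; rewrite !(raiseE, lowerE).
by case: (x =P k) => [->|]; rewrite ?(negPf kk') ?addn0 ?subn0.
Qed.

Lemma osc_neg b m s : osc logq b (- m.+1%:Z) << s >> = << (s.1, raise s.2 (b, m)) >>.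
Proof. by rewrite /osc fglift1. Qed.

Definition osc_norm b m : C := bsign R b * qnum logq m.+1%:R ^+ 2 / m.+1%:R.

Lemma osc_pos b m s : osc logq b m.+1%:Z << s >>
  = ((s.2 (b, m))%:R * osc_norm b m) *: << (s.1, lower s.2 (b, m)) >>.
Proof. by rewrite /osc fglift1. Qed.

Lemma osc_zero b s : osc logq b 0 << s >> = s.1 b *: << s >>.
Proof. by rewrite /osc fglift1. Qed.

Lemma expQE b e s : @expQ R b e << s >> =
  << ([ffun b' => s.1 b' + (if b' == b then e%:~R else 0)] : charge R, s.2) >>.
Proof. by rewrite /expQ fglift1. Qed.

Lemma eig0E b r s : @eig0 R b r << s >> = if s.1 b == r%:~R then << s >> else 0.
Proof. by rewrite /eig0 fglift1. Qed.

Lemma osc_pos_comm b b' m m' v :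
  osc logq b m.+1%:Z (osc logq b' m'.+1%:Z v)
  = osc logq b' m'.+1%:Z (osc logq b m.+1%:Z v).
Proof.
apply: (freeg_linear_ext (f := osc logq b m.+1%:Z \o osc logq b' m'.+1%:Z)
  (g := osc logq b' m'.+1%:Z \o osc logq b m.+1%:Z)) => s /=.
rewrite !osc_pos !linearZ /= !osc_pos /= !scalerA !lowerE lowerC.
have [[-> ->]|kk'] := eqVneq (b, m) (b', m'); first by rewrite mulrC.
rewrite !subn0; congr (_ *: _); ring.
Qed.

Lemma osc_neg_comm b b' m m' v :
  osc logq b (- m.+1%:Z) (osc logq b' (- m'.+1%:Z) v)
  = osc logq b' (- m'.+1%:Z) (osc logq b (- m.+1%:Z) v).
Proof.
apply: (freeg_linear_ext (f := osc logq b (- m.+1%:Z) \o osc logq b' (- m'.+1%:Z))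
  (g := osc logq b' (- m'.+1%:Z) \o osc logq b (- m.+1%:Z))) => s /=.
by rewrite !osc_neg raiseC.
Qed.

Lemma osc_bracket b b' m m' v :
  osc logq b m.+1%:Z (osc logq b' (- m'.+1%:Z) v)
  = osc logq b' (- m'.+1%:Z) (osc logq b m.+1%:Z v)
    + (osc_norm b m *+ ((b, m) == (b', m'))) *: v.
Proof.
apply: (freeg_linear_ext (f := osc logq b m.+1%:Z \o osc logq b' (- m'.+1%:Z))
  (g := osc logq b' (- m'.+1%:Z) \o osc logq b m.+1%:Z
    \+ (osc_norm b m *+ ((b, m) == (b', m'))) \*: idfun)) => s /=.
rewrite osc_neg !osc_pos linearZ /= osc_neg /= raiseE.
have [[<- <-]|kk'] := eqVneq (b, m) (b', m'); last first.
  by rewrite mulr0n scale0r addr0 addn0 raise_lower.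
rewrite raiseK; have [n0|n0] := posnP (s.2 (b, m)).
  by rewrite n0 mul0r scale0r add0r mul1r; case: s {n0}.
by rewrite lowerK // natrD mulrDl scalerDl mul1r; case: s {n0}.
Qed.

Lemma osc_expQ b b' e n v : n != 0 ->
  osc logq b n (expQ b' e v) = expQ b' e (osc logq b n v).
Proof.
move=> n0; apply: (freeg_linear_ext (f := osc logq b n \o expQ b' e)
  (g := expQ b' e \o osc logq b n)) => s /=.
case: n n0 => [[//|n]|n] _; last by rewrite NegzE expQE !osc_neg expQE.
by rewrite expQE !osc_pos linearZ /= expQE.
Qed.

Lemma expQC b b' e e' v : expQ b e (expQ b' e' v) = expQ b' e' (@expQ R b e v).
Proof.
apply: (freeg_linear_ext (f := @expQ R b e \o expQ b' e')
  (g := expQ b' e' \o @expQ R b e)) => s /=.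
rewrite !expQE; congr << (_, _) >>; apply/ffunP => c; rewrite !ffunE; ring.
Qed.

Lemma expQK b e v : expQ b e (@expQ R b (- e) v) = v.
Proof.
apply: (freeg_linear_ext (f := @expQ R b e \o expQ b (- e)) (g := idfun)) => s /=.
rewrite !expQE; case: s => s n; congr << (_, _) >>; apply/ffunP => c; rewrite !ffunE /=.
by case: ifP => _; rewrite ?addr0 // mulrNz subrK.
Qed.

Lemma osc_supported b n s :
  supported (fun s' => s'.1 = s.1 /\ (weight s'.2)%:Z = (weight s.2)%:Z - n)
    (osc logq b n << s >>).
Proof.
case: n => [[|m]|m].
- by rewrite osc_zero subr0; apply: supportedZ; apply: supported1.
- rewrite osc_pos; have [n0|n0] := posnP (s.2 (b, m)).
    by rewrite n0 mul0r scale0r; apply: supported0.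
  apply: supportedZ; apply: supported1; split=> //=.
  by rewrite -[in RHS](lowerK n0) weight_raise /=; lia.
- by rewrite NegzE osc_neg; apply: supported1; rewrite /= weight_raise /=; split=> //; lia.
Qed.

(** The vectors of degree n for the grading by the number operator, relaxed to
    any condition T on the charge and the excess over n of the weight. *)
Definition graded (T : charge R -> int -> Prop) (n : int) v : Prop :=
  supported (fun s => T s.1 ((weight s.2)%:Z - n)) v.

Lemma osc_graded T b m n v : graded T n v -> graded T (n - m) (osc logq b m v).
Proof.
apply: supported_linear => s Ts s' /osc_supported[-> ->].
have -> : (weight s.2)%:Z - m - (n - m) = (weight s.2)%:Z - n by lia.
exact: Ts.
Qed.

End Oscillators.

(** * The fermions bosonized by c^1 and c^2 *)

Section GhostModes.
Variables (R : realType) (logq : R[i]).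
Local Notation C := R[i].
Local Notation V := (fock R).
Hypothesis qnum_neq0 : forall m : nat, qnum logq m.+1%:R != 0.
Implicit Types (v : V) (l : 'I_2) (b : bool).

Definition csign (b : bool) : int := if b then -1 else 1.

(** The annihilation and creation parts of the exponent e c^l(z), for
    e = -1 if b and e = 1 otherwise. *)
Definition ghost_ann l b (m : nat) : {linear V -> V} := cmode logq l (csign b) m%:Z.
Definition ghost_cre l b (m : nat) : {linear V -> V} := cmode logq l (csign b) (- m%:Z).

Lemma qnumN (x : C) : qnum logq (- x) = - qnum logq x.
Proof. by rewrite /qnum opprK -mulNr opprB. Qed.

Let cmode_cmode l l' (e e' m n : int) v :
  cmode logq l e m (cmode logq l' e' n v)
  = (- e%:~R / qnum logq m%:~R * (- e'%:~R / qnum logq n%:~R))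
    *: osc logq (inr l) m (osc logq (inr l') n v).
Proof. by rewrite /cmode [osc _ _ _ (_ *: _)]linearZ scalerA. Qed.

Lemma ghost_annC l l' b b' m n v : (0 < m)%N -> (0 < n)%N ->
  ghost_ann l b m (ghost_ann l' b' n v) = ghost_ann l' b' n (ghost_ann l b m v).
Proof.
move=> /prednK<- /prednK<-.
by rewrite [LHS]cmode_cmode [RHS]cmode_cmode osc_pos_comm [in LHS]mulrC.
Qed.

Lemma ghost_creC l l' b b' m n v : (0 < m)%N -> (0 < n)%N ->
  ghost_cre l b m (ghost_cre l' b' n v) = ghost_cre l' b' n (ghost_cre l b m v).
Proof.
move=> /prednK<- /prednK<-.
by rewrite [LHS]cmode_cmode [RHS]cmode_cmode osc_neg_comm [in LHS]mulrC.
Qed.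

(** The denominators [m]_q of the exponents cancel the factor [m]_q^2 of the
    oscillator bracket: the c^l bosonize undeformed fermions. *)
Lemma ghost_bracket l l' b b' m n v : (0 < m)%N -> (0 < n)%N ->
  ghost_ann l b m (ghost_cre l' b' n v) = ghost_cre l' b' n (ghost_ann l b m v)
    + (((-1) ^+ (b == b') / m%:R) *+ ((l == l') && (n == m))) *: v.
Proof.
case: m n => [//|m] [//|n] _ _.
rewrite [LHS]cmode_cmode [X in _ = X + _]cmode_cmode osc_bracket.
rewrite scalerDr scalerA; congr (_ + _); first by congr (_ *: _); rewrite mulrC.
have -> : ((inr l : boson, m) == (inr l', n)) = (l == l') && (n.+1 == m.+1).
  by rewrite xpair_eqE eqSS (eq_sym m).
case: eqVneq => [->|_] /=; last by rewrite !mulr0n mulr0.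
case: eqVneq => [[->]|_]; last by rewrite !mulr0n mulr0.
rewrite !mulr1n; congr (_ *: _); rewrite /osc_norm /=.
have m0 : (m.+1%:R : C) != 0 by rewrite pnatr_eq0.
have -> : (- m.+1%:Z)%:~R = - m.+1%:R :> C by rewrite mulrNz.
rewrite qnumN; move: (qnum_neq0 m) => q0.
have -> : (m.+1 : int)%:~R = m.+1%:R :> C by [].
move: q0 m0; set Q := qnum _ _; move: Q => Q; set N := _%:R; move: N => N q0 m0.
by case: b; case: b'; rewrite /= ?expr1 ?expr0 ?mulrN1z ?mulr1z; field; rewrite q0 m0.
Qed.

Lemma ghost_creN l b m v : (0 < m)%N -> ghost_cre l (~~ b) m v = - ghost_cre l b m v.
Proof.
by move=> _; rewrite /= /cmode -scaleNr -mulNr; case: b; rewrite /= ?mulrN1z ?mulr1z ?opprK.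
Qed.

Lemma ghost_ann_graded T l b m n v : (0 < m)%N ->
  graded T n v -> graded T (n - m%:Z) (ghost_ann l b m v).
Proof. by move=> _ Tv; apply: supportedZ; apply: osc_graded. Qed.

Lemma ghost_cre_graded T l b m n v : (0 < m)%N ->
  graded T n v -> graded T (n + m%:Z) (ghost_cre l b m v).
Proof.
move=> _ Tv; apply: supportedZ.
by have := @osc_graded _ logq T (inr l) (- m%:Z) n v Tv; rewrite opprK.
Qed.

Lemma graded0 T n : @graded R T n 0.
Proof. exact: supported0. Qed.
Lemma gradedD T n v w : graded T n v -> graded T n w -> graded T n (v + w).
Proof. exact: supportedD. Qed.
Lemma gradedZ T n a v : graded T n v -> graded T n (a *: v).
Proof. exact: supportedZ. Qed.
Lemma graded_lt0 (T : charge R -> int -> Prop) n v : (forall c x, T c x -> x <= 0) ->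
  n < 0 -> graded T n v -> v = 0.
Proof.
move=> T0 n0 Tv; apply/eqP; rewrite -dom_eq0; apply/eqP.
case E: (dom v) => [//|s r]; have /Tv/T0 : s \in dom v by rewrite E mem_head.
by lia.
Qed.

(** The modes of the oscillator part of :exp(e c^l(z)):. *)
Notation ghost_mode l := (vertex_mode (ghost_ann l) (ghost_cre l)).

Lemma ghost_mode_graded T l b B p n v :
  graded T n v -> graded T (n + p) (ghost_mode l b B p v).
Proof.
apply: vertex_mode_graded => *; [exact: graded0|exact: gradedD|exact: gradedZ|..].
- exact: ghost_ann_graded.
- exact: ghost_cre_graded.
Qed.

Lemma expQ_cmode (d : boson) (e : int) l (e' n : int) v : n != 0 ->
  expQ d e (cmode logq l e' n v) = cmode logq l e' n (expQ d e v).
Proof. by move=> n0; rewrite /cmode [LHS]linearZ /= osc_expQ. Qed.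

Lemma ghost_mode_expQ l l' b B p e v :
  ghost_mode l b B p (expQ (inr l') e v) = expQ (inr l') e (ghost_mode l b B p v).
Proof.
apply/esym.
have := @vertex_mode_comm _ V (ghost_ann l) (ghost_cre l) (expQ (inr l') e) b B p v.
by apply => -[//|m] w _; exact: expQ_cmode.
Qed.

Lemma ghost_modeC l l' b b' B B' p p' v : l != l' ->
  ghost_mode l b B p (ghost_mode l' b' B' p' v)
  = ghost_mode l' b' B' p' (ghost_mode l b B p v).
Proof.
move=> ll'.
have hA m w : (0 < m)%N -> ghost_mode l b B p (ghost_ann l' b' m w)
    = ghost_ann l' b' m (ghost_mode l b B p w).
  move=> m0; apply/esym.
  have := @vertex_mode_comm _ V (ghost_ann l) (ghost_cre l) (ghost_ann l' b' m) b B p w.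
  apply => n u n0; first exact: ghost_annC.
  by rewrite ghost_bracket // [l' == _]eq_sym (negPf ll') mulr0n scale0r addr0.
have hC m w : (0 < m)%N -> ghost_mode l b B p (ghost_cre l' b' m w)
    = ghost_cre l' b' m (ghost_mode l b B p w).
  move=> m0; apply/esym.
  have := @vertex_mode_comm _ V (ghost_ann l) (ghost_cre l) (ghost_cre l' b' m) b B p w.
  apply => n u n0; last exact: ghost_creC.
  by rewrite ghost_bracket // (negPf ll') mulr0n scale0r addr0.
exact: (@vertex_mode_comm _ V (ghost_ann l') (ghost_cre l') (ghost_mode l b B p)).
Qed.

(** A bound on the weights and a finite list of the integral c^l-charges make
    the sum that defines the coefficients of vertex operators finite; every
    vector satisfies such a condition. *)
Definition charge_bounded l (rs : seq int) (c : charge R) (x : int) : Prop :=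
  x <= 0 /\ forall r : int, c (inr l) = r%:~R -> r \in rs.

Lemma eig0_graded0 l rs r n v : graded (charge_bounded l rs) n v -> r \notin rs ->
  eig0 (inr l) r v = 0.
Proof.
move=> rsv rrs; rewrite [v]freegE linear_sum big_seq big1 // => s sv.
rewrite linearZ /= eig0E; case: eqP => [E|_]; last by rewrite scaler0.
by have [_ /(_ _ E)] := rsv _ sv; rewrite (negPf rrs).
Qed.

(** Only charges r in rs and annihilation degrees below B contribute, and these
    two determine the creation degree. *)
Lemma vertex_coefE l b p v rs d (B : nat) : uniq rs ->
  graded (charge_bounded l rs) d v -> d < B%:Z ->
  vertex_coef logq l (csign b) p v = \sum_(r <- rs) \sum_(0 <= k < B)
    expz (ghost_cre l b) (p - csign b * r + k%:Z)
      (expQ (inr l) (csign b) (eig0 (inr l) r (expz (ghost_ann l b) k%:Z v))).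
Proof.
move=> urs bv dB; set e := csign b.
pose t (x : int * nat) := p - e * x.1 + x.2%:Z.
pose rk := [seq (r, k) | r <- rs, k <- iota 0 B].
pose h (x : int * nat) : nat * nat * int := (absz (t x), x.2, x.1).
pose s := [seq h x | x <- rk & 0 <= t x].
have bvk k : graded (charge_bounded l rs) (d - k%:Z) (expz (ghost_ann l b) k v).
  apply: expz_ann_graded bv => *; [exact: graded0|exact: gradedD|exact: gradedZ|].
  exact: ghost_ann_graded.
rewrite /vertex_coef (@fsbigE _ _ _ _ _ s) /=; first last.
- move=> [[k k'] r] /= tp; rewrite -(expz_nat (ghost_ann l b)) => ns.
  have [Bk|kB] := leqP B k'.
    rewrite (_ : expz _ _ v = 0) ?linear0 ?linear0 ?linear0 //.
    apply: (@graded_lt0 _ (d - k'%:Z)) (bvk _); last by lia.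
    by move=> c x [].
  have [rrs|rrs] := boolP (r \in rs); last first.
    by rewrite (eig0_graded0 (bvk _)) // !linear0.
  move: ns; rewrite (_ : _ \in s = true) //; apply/mapP; exists (r, k').
    rewrite mem_filter; apply/andP; split; first by rewrite /t /=; lia.
    by apply/allpairsP; exists (r, k'); rewrite mem_iota.
  by rewrite /h /t /=; congr (_, _, _); lia.
- move=> _ /= /mapP[[r k] + ->]; rewrite mem_filter => /andP[t0 _] /=.
  by move: t0; rewrite /t /=; lia.
- rewrite map_inj_in_uniq ?filter_uniq ?allpairs_uniq ?iota_uniq //.
    by move=> [? ?] [? ?].
  by move=> [r k] [r' k'] _ _ [_ -> ->].
rewrite big_mkcond big_seq.
transitivity (\sum_(i <- s) exp_coef (fun m : nat => cmode logq l e (- m%:Z)) i.1.1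
    (expQ (inr l) e (eig0 (inr l) i.2
      (exp_coef (fun m : nat => cmode logq l e m%:Z) i.1.2 v)))).
  rewrite [RHS]big_seq; apply: eq_bigr => i /mapP[x + ->].
  rewrite mem_filter => /andP[t0 _]; rewrite ifT // inE /h /t /=.
  by move: t0; rewrite /t /=; lia.
rewrite /s big_map big_filter big_mkcond /rk big_allpairs.
apply: eq_bigr => r _; rewrite /index_iota subn0; apply: eq_bigr => k _.
rewrite /h /= -[p - e * r + k%:Z]/(t (r, k)); case: ifPn => [t0|]; last first.
  by rewrite -ltNge => t0; rewrite expz_lt0.
by rewrite expz_nat -{2}(gez0_abs t0) expz_nat.
Qed.

Lemma exists_charge_bounded l (S : seq (charge R * occupation)%type) :
  exists d rs, uniq rs /\
    forall v, {subset dom v <= S} -> graded (charge_bounded l rs) d v.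
Proof.
pose ri (s : charge R * occupation) : int := xget 0 [set r : int | s.1 (inr l) = r%:~R]%classic.
exists (\sum_(s <- S) weight s.2)%N%:Z, (undup (map ri S)); split; first exact: undup_uniq.
move=> v vS s /vS sS; split.
  by rewrite (big_rem _ sS) /=; lia.
move=> r rE; rewrite mem_undup; apply/mapP; exists s => //; rewrite /ri.
case: xgetP => [r' _ /= r'E|/(_ r)//].
by apply/eqP; rewrite -(eqr_int C) -rE r'E.
Qed.

Lemma vertex_coef_is_linear l b p : linear (vertex_coef logq l (csign b) p).
Proof.
move=> a v w; have [d [rs [urs bS]]] := exists_charge_bounded l (dom v ++ dom w).
have dB : d < (absz d).+1%:Z by lia.
have bv : graded (charge_bounded l rs) d v by apply: bS => s sv; rewrite mem_cat sv.
have bw : graded (charge_bounded l rs) d w by apply: bS => s sw; rewrite mem_cat sw orbT.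
have bvw : graded (charge_bounded l rs) d (a *: v + w) by apply: gradedD => //; apply: gradedZ.
rewrite !(vertex_coefE b p urs _ dB) // scaler_sumr -big_split; apply: eq_bigr => r _.
rewrite scaler_sumr -big_split; apply: eq_bigr => k _ /=.
by rewrite !linearP.
Qed.

(** The zero modes xi^l_0 for b = true, and eta^l_0 for b = false. *)
Definition ghost l b : V -> V :=
  locked (vertex_coef logq l (csign b) (if b then 0 else -1)).

Lemma ghost_is_linear l b : linear (ghost l b).
Proof. by rewrite /ghost -lock; exact: vertex_coef_is_linear. Qed.

HB.instance Definition _ l b :=
  GRing.isLinear.Build C V V *:%R (ghost l b) (ghost_is_linear l b).

(** On c^l-charge r the factor z^(e c_0) contributes e r to the exponent; this
    is what it leaves for the oscillator part of the zero mode. *)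
Definition ghost_degree b (r : int) : int := if b then r else - 1 - r.

Definition shift_charge (c : charge R) l (e : int) : charge R :=
  [ffun b' => c b' + (if b' == inr l then e%:~R else 0)].

Definition homog (c : charge R) (n : int) : V -> Prop :=
  graded (fun c' x => c' = c /\ x = 0) n.

(** The reduction of the zero modes to modes of the oscillator part, for which
    the relations are known. *)
Lemma ghostE l b c r n v (B : nat) : homog c n v -> c (inr l) = r%:~R ->
  n < B%:Z ->
  ghost l b v = expQ (inr l) (csign b) (ghost_mode l b B (ghost_degree b r) v).
Proof.
move=> hv cr nB; have bv : graded (charge_bounded l [:: r]) n v.
  move=> s /hv[-> ->]; split=> // r' /eqP.
  by rewrite cr eqr_int inE eq_sym.
rewrite /ghost -lock (vertex_coefE _ _ _ bv nB) // big_seq1 big_mkord [RHS]linear_sum.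
apply: eq_bigr => k _; set e := csign b.
have cQ := @expz_comm _ V (ghost_cre l b) (expQ (inr l) e).
transitivity (expz (ghost_cre l b) (ghost_degree b r + k) (expQ (inr l) e (expz (ghost_ann l b) k v))); last first.
  by apply/esym/cQ => -[//|m] w _; apply: expQ_cmode.
congr (expz _ _ (expQ _ _ _)); first by rewrite /e; case: (b); rewrite /ghost_degree /=; lia.
have hk : homog c (n - k%:Z) (expz (ghost_ann l b) k v).
  apply: expz_ann_graded hv => *; [exact: graded0|exact: gradedD|exact: gradedZ|].
  exact: ghost_ann_graded.
rewrite [X in eig0 _ _ X]freegE [RHS]freegE linear_sum big_seq [RHS]big_seq.
apply: eq_bigr => s sk; rewrite linearZ /= eig0E.
by have [-> _] := hk _ sk; rewrite cr eqxx.
Qed.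

Lemma expQ_homog l e c n v : homog c n v -> homog (shift_charge c l e) n (expQ (inr l) e v).
Proof.
apply: (supported_linear (f := @expQ R (inr l) e)) => s [sc sn] /=.
rewrite expQE; apply: supported1 => /=.
by rewrite -sc.
Qed.

Lemma ghost_homog l b c r n v : homog c n v -> c (inr l) = r%:~R ->
  homog (shift_charge c l (csign b)) (n + ghost_degree b r) (ghost l b v).
Proof.
move=> hv cr; have nB : n < (absz n).+1%:Z by lia.
by rewrite (ghostE _ hv cr nB); apply: expQ_homog; apply: ghost_mode_graded.
Qed.

Lemma shiftE (c : charge R) l (e r : int) : c (inr l) = r%:~R -> shift_charge c l e (inr l) = (r + e)%:~R.
Proof. by move=> cr; rewrite ffunE eqxx cr intrD. Qed.

Lemma shift_neq (c : charge R) l l' e : l != l' -> shift_charge c l e (inr l') = c (inr l').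
Proof.
move=> ll'; rewrite ffunE; case: eqP => [[E]|_]; last exact: addr0.
by rewrite E eqxx in ll'.
Qed.

(** The zero modes commute instead of anticommuting since no cocycle is attached
    to the shifts of the charges of c^1 and c^2. *)
Lemma ghostC l l' b b' c r r' n v : l != l' -> homog c n v ->
  c (inr l) = r%:~R -> c (inr l') = r'%:~R ->
  ghost l b (ghost l' b' v) = ghost l' b' (ghost l b v).
Proof.
move=> ll' hv cr cr'.
pose B := (absz n + absz (ghost_degree b r) + absz (ghost_degree b' r')).+1.
have l'l : l' != l by rewrite eq_sym.
have dB : n < B%:Z by rewrite /B; lia.
have dBb : n + ghost_degree b r < B%:Z by rewrite /B; lia.
have dBb' : n + ghost_degree b' r' < B%:Z by rewrite /B; lia.
have sr : shift_charge c l' (csign b') (inr l) = r%:~R by rewrite shift_neq.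
have sr' : shift_charge c l (csign b) (inr l') = r'%:~R by rewrite shift_neq.
rewrite (ghostE b (ghost_homog (b := b') hv cr') sr dBb') (ghostE b' hv cr' dB).
rewrite (ghostE b' (ghost_homog (b := b) hv cr) sr' dBb) (ghostE b hv cr dB).
by rewrite !ghost_mode_expQ (ghost_modeC _ _ _ _ _ _ _ ll') expQC.
Qed.

Let homog_lt0 c n v : n < 0 -> homog c n v -> v = 0.
Proof. by apply: graded_lt0 => c' x [_ ->]. Qed.

(** The shift of the charge by the first factor makes the two oscillator modes
    adjacent. *)
Lemma ghost_sqr0 l b c r n v : homog c n v -> c (inr l) = r%:~R ->
  ghost l b (ghost l b v) = 0.
Proof.
move=> hv cr; have [n0|n0] := ltrP n 0; first by rewrite (homog_lt0 n0 hv) !linear0.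
pose B := (absz n + absz r).+4.
have dB : n < B%:Z by rewrite /B; lia.
have dBb : n + ghost_degree b r < B%:Z by rewrite /B /ghost_degree; case: (b); lia.
rewrite (ghostE b (ghost_homog (b := b) hv cr) (shiftE _ cr) dBb) (ghostE b hv cr dB).
rewrite ghost_mode_expQ.
have -> : ghost_degree b r = ghost_degree b (r + csign b) + 1.
  by rewrite /ghost_degree; case: (b) => /=; lia.
have -> : ghost_mode l b B (ghost_degree b (r + csign b))
    (ghost_mode l b B (ghost_degree b (r + csign b) + 1) v) = 0; last by rewrite !linear0.
apply: (@vertex_mode_sqr0 _ V (homog c) _ _ _ _ (ghost_ann l) (ghost_cre l) _ _ _ _ (absz n)).
- exact: graded0.
- exact: gradedD.
- exact: gradedZ.
- by move=> *; apply: homog_lt0; eauto.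
- by move=> *; apply: ghost_annC.
- by move=> *; apply: ghost_creC.
- by move=> b1 b2 m m' w m0 m'0; rewrite (ghost_bracket _ _ _ _ _ m0 m'0) eqxx.
- by move=> *; apply: ghost_ann_graded.
- by rewrite gez0_abs.
- by lia.
Qed.

(** In the two orders the zero modes act on charges that differ by one, which
    yields exactly the two products of [vertex_mode_anticomm]. *)
Lemma ghost_anticomm l b c r n v : homog c n v -> c (inr l) = r%:~R ->
  ghost l (~~ b) (ghost l b v) + ghost l b (ghost l (~~ b) v) = v.
Proof.
wlog -> : b / b = true => [H hv cr|hv cr].
  case: b; first exact: H.
  by rewrite addrC; have := H true erefl hv cr.
have [n0|n0] := ltrP n 0; first by rewrite (homog_lt0 n0 hv) !linear0 addr0.
pose B := (absz n + absz r).+4.*2.*2.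
have dB : n < B%:Z by rewrite /B; lia.
have dBt : n + ghost_degree true r < B%:Z by rewrite /B /ghost_degree; lia.
have dBf : n + ghost_degree false r < B%:Z by rewrite /B /ghost_degree; lia.
rewrite (ghostE false (ghost_homog (b := true) hv cr) (shiftE _ cr) dBt).
rewrite (ghostE true (ghost_homog (b := false) hv cr) (shiftE _ cr) dBf).
rewrite (ghostE true hv cr dB) (ghostE false hv cr dB) !ghost_mode_expQ.
have Q1 (w : V) : expQ (inr l) (csign false) (expQ (inr l) (csign true) w) = w.
  exact: expQK.
have Q2 (w : V) : expQ (inr l) (csign true) (expQ (inr l) (csign false) w) = w.
  exact: (expQK (inr l) (-1)).
rewrite Q1 Q2 -[RHS](@vertex_mode_anticomm _ V (homog c) _ _ _ _ (ghost_ann l) (ghost_cre l)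
  _ _ _ _ _ _ (absz n) B false (- r)).
- congr (ghost_mode l _ B _ (ghost_mode l _ B _ v) + ghost_mode l _ B _ (ghost_mode l _ B _ v)); rewrite /ghost_degree /=; lia.
- exact: graded0.
- exact: gradedD.
- exact: gradedZ.
- by move=> *; apply: homog_lt0; eauto.
- by move=> *; apply: ghost_annC.
- by move=> *; apply: ghost_creC.
- by move=> b1 b2 m m' w m0 m'0; rewrite (ghost_bracket _ _ _ _ _ m0 m'0) eqxx.
- by move=> *; apply: ghost_creN.
- by move=> *; apply: ghost_ann_graded.
- by move=> *; apply: ghost_cre_graded.
- by rewrite gez0_abs.
- by lia.
Qed.

End GhostModes.

(** * Dimensions as traces *)

(** In a rank factorization A = U W idempotence forces W U = 1, and tr (U W) =
    tr (W U). *)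
Lemma mxtrace_idempotent (K : fieldType) n (A : 'M[K]_n) :
  A *m A = A -> \tr A = (\rank A)%:R.
Proof.
move=> AA; rewrite -[in LHS](mulmx_base A) mxtrace_mulC -[RHS]mxtrace1; congr (\tr _).
have /row_freeP[B RB] := row_base_free A.
have /row_fullP[B' CB] := col_base_full A.
have := mulmx_base A; move: (col_base A) (row_base A) RB CB => U W WB BU UW.
transitivity (B' *m ((U *m W) *m (U *m W)) *m B).
  by rewrite !mulmxA BU mul1mx -mulmxA WB mulmx1.
transitivity (B' *m (U *m W) *m B); first by rewrite UW AA.
by rewrite !mulmxA BU mul1mx WB.
Qed.

Section Trace.
Variables (R : realType).
Local Notation C := R[i].
Local Notation state := (charge R * occupation)%type.
Local Notation V := (fock R).
Implicit Types (S : seq state) (s : state) (v : V).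

Definition trace_on S (f : V -> V) : C := \sum_(s <- S) coeff s (f << s >>).

Definition spanned S : V -> Prop := supported (fun s => s \in S).

Lemma spannedE S v : uniq S -> spanned S v -> v = \sum_(s <- S) coeff s v *: << s >>.
Proof.
move=> uS Sv; rewrite {1}[v]freegE [RHS](bigID (mem (dom v))) /= [X in _ = _ + X]big1 ?addr0.
  rewrite -[RHS]big_filter; apply/perm_big/uniq_perm; rewrite ?filter_uniq ?uniq_dom //.
  by move=> s; rewrite mem_filter; case: (boolP (s \in dom v)) => // /Sv ->.
by move=> s ds; rewrite coeff_outdom // scale0r.
Qed.

(** Cyclicity of the trace, for operators that exchange two coordinate spaces.
    *)
Lemma trace_onC S S' (f g : {linear V -> V}) : uniq S -> uniq S' ->
  (forall s, s \in S -> spanned S' (g << s >>)) ->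
  (forall s, s \in S' -> spanned S (f << s >>)) ->
  trace_on S (f \o g) = trace_on S' (g \o f).
Proof.
move=> uS uS' gS fS'; rewrite /trace_on /=.
transitivity (\sum_(s <- S) \sum_(s' <- S') coeff s' (g << s >>) * coeff s (f << s' >>)).
  rewrite big_seq [RHS]big_seq; apply: eq_bigr => s sS.
  rewrite {1}(spannedE uS' (gS s sS)) linear_sum raddf_sum; apply: eq_bigr => s' _.
  by rewrite linearZ /= coeffZ.
rewrite exchange_big /= big_seq [RHS]big_seq; apply: eq_bigr => s' sS'.
rewrite {2}(spannedE uS (fS' s' sS')) linear_sum raddf_sum; apply: eq_bigr => s _.
by rewrite linearZ /= coeffZ mulrC.
Qed.

Lemma eq_trace_on S (f g : V -> V) :
  (forall s, s \in S -> f << s >> = g << s >>) -> trace_on S f = trace_on S g.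
Proof. by move=> fg; apply: eq_big_seq => s sS; rewrite fg. Qed.

Lemma trace_onB S (f g : V -> V) :
  trace_on S (fun v => f v - g v) = trace_on S f - trace_on S g.
Proof. by rewrite /trace_on -sumrB; apply: eq_bigr => s _; rewrite coeffB. Qed.

Lemma trace_on_id S : uniq S -> trace_on S id = (size S)%:R.
Proof.
move=> uS; rewrite /trace_on -sum1_size natr_sum; apply: eq_bigr => s _.
by rewrite coeff1U eqxx.
Qed.

(** Dimensions become traces, for which cyclicity is available: in the
    coordinates S the idempotent is a matrix, whose row space is the range. *)
Lemma has_dim_idempotent S (P : {linear V -> V}) : uniq S ->
  (forall s, s \in S -> spanned S (P << s >>)) ->
  (forall s, s \in S -> P (P << s >>) = P << s >>) ->
  exists2 n, has_dim [set v | spanned S v /\ P v = v]%classic n & n%:R = trace_on S P.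
Proof.
move=> uS PS PP; pose N := size S; pose st (i : 'I_N) := tnth (in_tuple S) i.
have stS i : st i \in S by exact: mem_tnth.
have sumS (M : zmodType) (G : state -> M) : \sum_(s <- S) G s = \sum_i G (st i).
  exact: big_tnth.
have st_inj : injective st.
  move=> i j; rewrite /st !(tnth_nth (st i)) => /eqP.
  by rewrite nth_uniq // => /eqP/val_inj.
pose phi (x : 'rV[C]_N) : V := \sum_j x 0 j *: << st j >>.
have phi_coeff x j : coeff (st j) (phi x) = x 0 j.
  rewrite raddf_sum (bigD1 j) //= coeffZ coeff1U eqxx mulr1 big1 ?addr0 // => i ij.
  by rewrite coeffZ coeff1U (inj_eq st_inj) (negPf ij) mulr0.
have phiS x : spanned S (phi x).
  by apply: supported_sum => j _ _; apply: supportedZ; apply: supported1.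
have phi_onto v : spanned S v -> v = phi (\row_j coeff (st j) v).
  by move=> Sv; rewrite {1}(spannedE uS Sv) sumS; apply: eq_bigr => j _; rewrite mxE.
have phi_inj x y : phi x = phi y -> x = y.
  by move=> xy; apply/rowP => j; rewrite -!phi_coeff xy.
pose A := \matrix_(i < N, j < N) coeff (st j) (P << st i >>).
have Pphi x : P (phi x) = phi (x *m A).
  rewrite linear_sum (phi_onto (\sum_i P _)); last first.
    by apply: supported_sum => j _ _; rewrite linearZ; apply: supportedZ; apply: PS.
  congr phi; apply/rowP => j; rewrite !mxE raddf_sum; apply: eq_bigr => i _.
  by rewrite linearZ /= coeffZ mxE.
have AA : A *m A = A.
  apply/row_matrixP => i; rewrite row_mul; apply: phi_inj; rewrite -Pphi.
  have rowA : phi (row i A) = P << st i >>.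
    by rewrite [RHS](phi_onto _ (PS _ (stS i))); congr phi; apply/rowP => j; rewrite !mxE.
  by rewrite rowA PP.
exists (\rank A); last first.
  rewrite -(mxtrace_idempotent AA) /trace_on sumS.
  by apply: eq_bigr => i _; rewrite mxE.
have comb (x : {ffun 'I_(\rank A) -> C}) :
    \sum_i x i *: phi (row i (row_base A)) = phi ((\row_i x i) *m row_base A).
  rewrite mulmx_sum_row /phi; under [RHS]eq_bigr do rewrite summxE scaler_suml.
  rewrite exchange_big /=; apply: eq_bigr => i _; rewrite scaler_sumr.
  by apply: eq_bigr => j _; rewrite !mxE scalerA.
exists (fun i => phi (row i (row_base A))); split.
  apply/seteqP; split=> [v [Sv Pv]|v [x _ <-]]; last first.
    rewrite comb; split; first exact: phiS.
    have /submxP[y ->] : ((\row_i x i) *m row_base A <= A)%MS.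
      by rewrite (submx_trans (submxMl _ _)) // eq_row_base.
    by rewrite Pphi -mulmxA AA.
  move: (Pv); rewrite (phi_onto v Sv) Pphi => /phi_inj vA.
  have /submxP[y yE] : (\row_j coeff (st j) v <= row_base A)%MS.
    by rewrite eq_row_base -vA submxMl.
  exists [ffun i => y 0 i] => //; rewrite comb yE; congr (phi (_ *m _)).
  by apply/rowP => i; rewrite !mxE ffunE.
move=> x; rewrite comb => x0.
have : (\row_i x i) *m row_base A = 0.
  by apply: phi_inj; rewrite x0 /phi big1 // => j _; rewrite mxE scale0r.
move/eqP; rewrite mulmx_free_eq0 ?row_base_free // => /eqP/rowP xi.
by apply/ffunP => i; have := xi i; rewrite !mxE ffunE.
Qed.

End Trace.

Section States.
Variables (R : realType).
Local Notation state := (charge R * occupation)%type.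
Local Notation V := (fock R).
Implicit Types (c : charge R) (n : int).

Lemma finite_weight (m : nat) : finite_set [set x : occupation | weight x = m]%classic.
Proof.
pose A : {fset (boson * nat)%type} :=
  [fset x in [seq (b, k) | b <- enum boson, k <- iota 0 m.+1]]%fset.
pose h (f : {ffun (boson * 'I_m.+1)%type -> 'I_m.+1}) : occupation :=
  [fsfun x in A => val (f (x.1, inord x.2))].
apply: (@sub_finite_set _ _ (h @` setT)%classic); last first.
  exact/finite_image/finite_finset.
move=> x /= xm; exists [ffun k => inord (x (k.1, val k.2))] => //.
apply/fsfunP => -[b k]; rewrite /h fsfunE /=.
have xk := weight_ge x (b, k); rewrite xm in xk.
case: ifPn => kA.
  have km : (k < m.+1)%N.
    by move: kA; rewrite !inE => /allpairsP[[b' k'] [_ + [_ ->]]]; rewrite mem_iota.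
  rewrite ffunE /= (inordK km) inordK //.
  by rewrite ltnS; apply: leq_trans xk; apply: leq_pmull.
apply/esym/eqP; rewrite -leqn0 leqNgt; apply: contra kA => xk0.
rewrite !inE; apply/allpairsP; exists (b, k); rewrite mem_enum mem_iota; split=> //=.
by rewrite ltnS; apply: leq_trans xk; apply: leq_trans (leqnSn k) _; apply: leq_pmulr.
Qed.

Definition occupations n : seq occupation :=
  if n is Posz m then fset_set [set x : occupation | weight x = m]%classic else [::].

Lemma mem_occupations n x : (x \in occupations n) = ((weight x)%:Z == n).
Proof.
case: n => m /=; last by rewrite in_nil.
rewrite in_fset_set; last exact: finite_weight.
by apply/idP/eqP => [|[xm]]; rewrite inE /= => // ->.
Qed.

Lemma uniq_occupations n : uniq (occupations n).
Proof. by case: n => //= m; apply: fset_uniq. Qed.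

Definition states c n : seq state := [seq (c, x) | x <- occupations n].

Lemma mem_states c n s : (s \in states c n) = (s.1 == c) && ((weight s.2)%:Z == n).
Proof.
apply/mapP/andP => [[x + ->]|[/eqP <- sn]]; first by rewrite mem_occupations.
by exists s.2; rewrite ?mem_occupations //; case: s sn.
Qed.

Lemma uniq_states c n : uniq (states c n).
Proof. by rewrite map_inj_uniq ?uniq_occupations // => x y []. Qed.

Lemma homog_spanned c n (v : V) : homog c n v <-> spanned (states c n) v.
Proof.
split=> hv s /hv; rewrite mem_states.
  by move=> [-> /eqP]; rewrite subr_eq0 eqxx.
by move=> /andP[/eqP-> /eqP->]; rewrite subrr.
Qed.

Lemma homog1 c n s : s \in states c n -> homog c n (<< s >> : V).
Proof. by move=> sS; apply/homog_spanned; apply: supported1. Qed.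

Lemma size_states c n : size (states c n) = size (occupations n).
Proof. exact: size_map. Qed.

End States.

(** * Dimensions of the images of the projectors *)

Section Projectors.
Variables (R : realType) (logq : R[i]).
Local Notation C := R[i].
Local Notation V := (fock R).
Hypothesis qnum_neq0 : forall m : nat, qnum logq m.+1%:R != 0.
Implicit Types (v : V) (l : 'I_2) (b : bool) (c : charge R).
Local Notation ghost := (ghost logq).

(** eta_0 xi_0 for b = true and xi_0 eta_0 for b = false. *)
Definition proj l b : V -> V := ghost l (~~ b) \o ghost l b.
HB.instance Definition _ l b := GRing.Linear.on (proj l b).

Lemma shift_shift c l e e' : shift_charge (shift_charge c l e) l e' = shift_charge c l (e + e').
Proof.
apply/ffunP => d; rewrite !ffunE; case: eqP => _; last by rewrite !addr0.
by rewrite intrD addrA.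
Qed.

Lemma shift0 c l : shift_charge c l 0 = c.
Proof. by apply/ffunP => d; rewrite ffunE mulr0z if_same addr0. Qed.

Lemma proj_homog l b c (r n : int) v : homog c n v -> c (inr l) = r%:~R ->
  homog c n (proj l b v).
Proof.
move=> hv cr; have h1 := ghost_homog (logq := logq) (b := b) hv cr.
have := ghost_homog (logq := logq) (b := ~~ b) h1 (shiftE _ cr).
rewrite shift_shift (_ : csign b + csign (~~ b) = 0) ?shift0; last by case: (b).
suff -> : n + ghost_degree b r + ghost_degree (~~ b) (r + csign b) = n by [].
by rewrite /ghost_degree; case: (b) => /=; lia.
Qed.

Lemma proj_idem l b c (r n : int) v : homog c n v -> c (inr l) = r%:~R ->
  proj l b (proj l b v) = proj l b v.
Proof.
move=> hv cr; rewrite /proj /=.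
have h1 := ghost_homog (logq := logq) (b := b) hv cr.
have := ghost_anticomm qnum_neq0 b h1 (shiftE _ cr).
rewrite (ghost_sqr0 qnum_neq0 b hv cr) linear0 add0r => E.
by rewrite E.
Qed.

Lemma projC l l' b b' c (r r' n : int) v : l != l' -> homog c n v ->
  c (inr l) = r%:~R -> c (inr l') = r'%:~R ->
  proj l b (proj l' b' v) = proj l' b' (proj l b v).
Proof.
move=> ll' hv cr cr'; rewrite /proj /=.
have h1 := ghost_homog (logq := logq) (b := b') hv cr'.
have s1 : shift_charge c l' (csign b') (inr l) = r%:~R by rewrite shift_neq // eq_sym.
have h2 := ghost_homog (logq := logq) (b := b) hv cr.
have s2 : shift_charge c l (csign b) (inr l') = r'%:~R by rewrite shift_neq.
have C b1 b2 c1 r1 r2 n1 v1 : homog c1 n1 v1 -> c1 (inr l) = (r1 : int)%:~R ->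
    c1 (inr l') = (r2 : int)%:~R ->
    ghost l b1 (ghost l' b2 v1) = ghost l' b2 (ghost l b1 v1).
  by move=> h c1r c1r'; apply: (ghostC qnum_neq0) h c1r c1r'.
rewrite (C b (~~ b') _ _ _ _ _ h1 s1 (shiftE _ cr')).
rewrite (C b b' _ _ _ _ _ hv cr cr').
have h3 := ghost_homog (logq := logq) (b := b') h2 s2.
have s3 : shift_charge (shift_charge c l (csign b)) l' (csign b') (inr l) = (r + csign b)%:~R.
  by rewrite shift_neq ?(shiftE _ cr) // eq_sym.
rewrite (C (~~ b) (~~ b') _ _ _ _ _ h3 s3 (shiftE _ s2)).
by rewrite (C (~~ b) b' _ _ _ _ _ h2 (shiftE _ cr) s2).
Qed.

(** The lowering of the degree after m applications of [ghost l b], starting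
    from the c^l-charge r. *)
Definition descent b (r : int) (m : nat) : int :=
  - \sum_(i < m) ghost_degree b (r + csign b * i%:Z).

Lemma descentS b r m :
  descent b r m.+1 = descent b r m - ghost_degree b (r + csign b * m%:Z).
Proof. by rewrite /descent big_ord_recr /= opprD. Qed.

(** This quadratic growth in m produces the exponents (l^2 + s l) / 2 of the
    character, and bounds the dimension count. *)
Lemma descentE b r m : 2 * descent b r m = m%:Z ^+ 2 + csign b * (2 * r + 1) * m%:Z.
Proof.
elim: m => [|m IHm]; first by rewrite /descent big_ord0 expr2; lia.
by rewrite descentS mulrBr IHm /ghost_degree !expr2; case: (b) => /=; nia.
Qed.

(** The step of the dimension count: cyclicity of the trace moves [ghost l b]
    around, and the anticommutator turns the opposite projector into the
    complement of [proj l b]. The operator H is the identity or the projector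
    of the other fermion. *)
Lemma trace_proj_step l b (H : {linear V -> V}) c (r n : int) :
  c (inr l) = r%:~R ->
  let c' := shift_charge c l (csign b) in let n' := n + ghost_degree b r in
  (forall v, homog c n v -> homog c n (H v)) ->
  (forall v, homog c' n' v -> homog c' n' (H v)) ->
  (forall v, homog c' n' v -> ghost l (~~ b) (H v) = H (ghost l (~~ b) v)) ->
  trace_on (states c n) (proj l b \o H)
  = trace_on (states c' n') H - trace_on (states c' n') (proj l b \o H).
Proof.
move=> cr c' n' Hc Hc' gH; pose f := ghost l (~~ b); pose g := ghost l b \o H.
have uS := uniq_states; have c'r := shiftE (csign b) cr.
transitivity (trace_on (states c' n') (g \o f)).
  apply: (@trace_onC _ _ _ (ghost l (~~ b)) (ghost l b \o H)) => // s sS.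
    apply/homog_spanned; apply: ghost_homog => //; apply: Hc.
    exact: homog1.
  apply/homog_spanned.
  have := ghost_homog (logq := logq) (b := ~~ b) (homog1 sS) c'r.
  rewrite /c' shift_shift (_ : csign b + csign (~~ b) = 0) ?shift0; last by case: (b).
  suff -> : n' + ghost_degree (~~ b) (r + csign b) = n by [].
  by rewrite /n' /ghost_degree; case: (b) => /=; lia.
rewrite -trace_onB; apply: eq_trace_on => s sS; have hs := homog1 sS.
rewrite /g /f /= -gH //; apply/eqP; rewrite -subr_eq opprK.
rewrite addrC; exact/eqP/(ghost_anticomm qnum_neq0 b (Hc' _ hs) c'r).
Qed.

(** Iteration of [trace_proj_step] ends after L steps, where the degree has
    become negative and the homogeneous component is zero. *)
Lemma trace_proj l b (H : {linear V -> V}) c (r n : int) (L : nat) :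
  c (inr l) = r%:~R ->
  (forall e n' v, homog (shift_charge c l e) n' v -> homog (shift_charge c l e) n' (H v)) ->
  (forall e n' v, homog (shift_charge c l e) n' v ->
    ghost l (~~ b) (H v) = H (ghost l (~~ b) v)) ->
  n < descent b r L ->
  trace_on (states c n) (proj l b \o H)
  = \sum_(m < L) (-1) ^+ m *
      trace_on (states (shift_charge c l (csign b * m.+1%:Z)) (n - descent b r m.+1)) H.
Proof.
move=> cr Hc gH nL.
suff -> : trace_on (states c n) (proj l b \o H) =
   \sum_(m < L) (-1) ^+ m *
      trace_on (states (shift_charge c l (csign b * m.+1%:Z)) (n - descent b r m.+1)) H
   + (-1) ^+ L *
      trace_on (states (shift_charge c l (csign b * L%:Z)) (n - descent b r L)) (proj l b \o H).
  have : n - descent b r L < 0 by lia.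
  case: (n - descent b r L) => // k _; rewrite [X in _ + _ * X](_ : _ = 0) ?mulr0 ?addr0 //.
  exact: big_nil.
elim: L {nL} => [|L IHL].
  by rewrite big_ord0 add0r mul1r mulr0 shift0 /descent big_ord0 oppr0 subr0.
rewrite IHL big_ord_recr /= -addrA; congr (_ + _).
set k := n - descent b r L; set cL := shift_charge c l _.
have cLr : cL (inr l) = (r + csign b * L%:Z)%:~R by rewrite (shiftE _ cr).
have sE : shift_charge cL l (csign b) = shift_charge c l (csign b * L.+1%:Z).
  by rewrite shift_shift; congr (shift_charge c l _); lia.
have kE : k + ghost_degree b (r + csign b * L%:Z) = n - descent b r L.+1.
  by rewrite descentS /k; lia.
rewrite (@trace_proj_step l b H cL (r + csign b * L%:Z) k cLr) ?sE ?kE.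
- by rewrite mulrBr exprS mulN1r mulNr.
- exact: Hc.
- exact: Hc.
- exact: gH.
Qed.

Let c1 : 'I_2 := ord0.
Let c2 : 'I_2 := ord_max.

(** As L grows, the descent of one fermion exceeds any bound, while that of the
    other is bounded from below independently of i. *)
Lemma descent_gt b1 b2 (r1 r2 n : int) : exists L0 : nat, forall L i, (L0 <= L)%N ->
  n < descent b1 r1 L + descent b2 r2 i /\ n < descent b1 r1 i + descent b2 r2 L.
Proof.
pose a1 := absz (2 * r1 + 1); pose a2 := absz (2 * r2 + 1).
(* m^2 + t m is at least - t^2 for all m, and at least x once m >= |t| + x. *)
exists (a1 + a2 + a1 * a1 + a2 * a2 + 2 * absz n + 2)%N => L i LL.
have lb b (r : int) m : exists2 t : int, 2 * descent b r m = m%:Z * m%:Z + t * m%:Z &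
    `|t| = (absz (2 * r + 1))%:Z.
  exists (csign b * (2 * r + 1)); first by rewrite descentE expr2.
  by rewrite normrM; case: b; rewrite /= ?normrN1 ?normr1 mul1r abszE.
have weak b (r : int) m : 2 * descent b r m >= - (absz (2 * r + 1)%R * absz (2 * r + 1)%R)%N%:Z.
  by have [t -> T] := lb b r m; nia.
have strong b (r : int) a : absz (2 * r + 1) = a -> forall x : nat, (a + x <= L)%N ->
    (0 < x)%N -> 2 * descent b r L >= x%:Z.
  by move=> aE x xL x0; have [t -> T] := lb b r L; nia.
have w1 := weak b1 r1 i; have w2 := weak b2 r2 i.
have s1 := strong b1 r1 a1 erefl (a2 * a2 + 2 * absz n + 2)%N.
have s2 := strong b2 r2 a2 erefl (a1 * a1 + 2 * absz n + 2)%N.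
have {}s1 : 2 * descent b1 r1 L >= (a2 * a2 + 2 * absz n + 2)%N%:Z by apply: s1; lia.
have {}s2 : 2 * descent b2 r2 L >= (a1 * a1 + 2 * absz n + 2)%N%:Z by apply: s2; lia.
rewrite -/a1 in w1; rewrite -/a2 in w2.
by split; lia.
Qed.

(** [trace_proj] for the two fermions in turn leaves traces of the identity,
    which count occupations. *)
Lemma trace_proj2 b1 b2 c (r1 r2 n : int) :
  c (inr c1) = r1%:~R -> c (inr c2) = r2%:~R ->
  exists L0 : nat, forall L, (L0 <= L)%N ->
  trace_on (states c n) (proj c1 b1 \o proj c2 b2)
  = \sum_(i < L) \sum_(j < L) (-1) ^+ (i.+1 + j.+1) *
      (size (occupations (n - descent b1 r1 i.+1 - descent b2 r2 j.+1)))%:R.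
Proof.
move=> cr1 cr2; have [L0 L0P] := descent_gt b1 b2 r1 r2 n; exists L0 => L L0L.
have c12 : c1 != c2 by [].
have se e : shift_charge c c1 e (inr c2) = r2%:~R by rewrite shift_neq.
have dL i : n < descent b1 r1 L + descent b2 r2 i by have [] := L0P L i L0L.
have dL' i : n < descent b1 r1 i + descent b2 r2 L by have [] := L0P L i L0L.
have d0 b r : descent b r 0 = 0 by rewrite /descent big_ord0 oppr0.
rewrite (@trace_proj c1 b1 (proj c2 b2) c r1 n L cr1); first last.
- by rewrite -[descent b1 r1 L]addr0 -(d0 b2 r2).
- move=> e n' v hv; rewrite /proj /=.
  have se1 : shift_charge c c1 e (inr c1) = (r1 + e)%:~R by rewrite (shiftE _ cr1).
  have h2 := ghost_homog (logq := logq) (b := b2) hv (se e).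
  have h2r : shift_charge (shift_charge c c1 e) c2 (csign b2) (inr c1) = (r1 + e)%:~R.
    by rewrite shift_neq.
  rewrite (ghostC qnum_neq0 (~~ b1) (~~ b2) c12 h2 h2r (shiftE _ (se e))).
  by rewrite (ghostC qnum_neq0 (~~ b1) b2 c12 hv se1 (se e)).
- by move=> e n' v hv; apply: proj_homog hv (se e).
apply: eq_bigr => i _.
have := @trace_proj c2 b2 idfun (shift_charge c c1 (csign b1 * i.+1%:Z)) r2
  (n - descent b1 r1 i.+1) L (se _).
move=> -> //; last by rewrite ltrBlDl.
rewrite mulr_sumr; apply: eq_bigr => j _.
rewrite trace_on_id ?uniq_states // size_states mulrA; congr (_ * _).
by rewrite addSn addnS !exprS exprD !mulN1r opprK.
Qed.

End Projectors.

(** * The derivation and the Cartan operators *)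

Section Cartan.
Variables (R : realType) (logq : R[i]).
Local Notation C := R[i].
Local Notation V := (fock R).
Local Notation state := (charge R * occupation)%type.
Hypothesis qnum_neq0 : forall m : nat, qnum logq m.+1%:R != 0.
Hypothesis qplus_neq0 : forall m : nat, qplus logq m != 0.
Implicit Types (v : V) (i j p : 'I_4) (n : int).

Lemma sum_ord4 (M : zmodType) (G : 'I_4 -> M) :
  \sum_p G p = G (inord 0) + G (inord 1) + G (inord 2) + G (inord 3).
Proof.
rewrite !big_ord_recr big_ord0 /= add0r; congr (G _ + G _ + G _ + G _);
  by apply: val_inj; rewrite /= inordK.
Qed.

Lemma ord4P (P : 'I_4 -> Prop) :
  P (inord 0) -> P (inord 1) -> P (inord 2) -> P (inord 3) -> forall i, P i.
Proof.
by move=> P0 P1 P2 P3 k; rewrite -[k]inord_val; case: k => -[|[|[|[|?]]]] ?.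
Qed.

(** Row i holds the coefficients of A^(i+1)_0 in the zero modes of the a^p. *)
Definition rootmx : 'M[C]_4 :=
  \matrix_(i, j) nth 0 (nth [::]
    [:: [:: 1;  1;  0;  0];
        [:: 0; -1; -1;  0];
        [:: 0;  0;  1;  1];
        [:: 1; -1;  1; -1]] i) j.

Definition inv_amat : 'M[C]_4 :=
  \matrix_(i, j) nth 0 (nth [::]
    [:: [:: 2^-1;   2^-1;      0; 4^-1];
        [:: 2^-1;      0; - 2^-1;    0];
        [::    0; - 2^-1; - 2^-1; 4^-1];
        [:: 4^-1;      0;   4^-1;    0]] i) j.

Lemma invmx_amat : invmx (amat R) = inv_amat.
Proof.
have H : amat R *m inv_amat = 1%:M.
  apply/matrixP => i j; move: i j; apply: ord4P; apply: ord4P;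
  rewrite !mxE sum_ord4 !mxE !inordK //= -val_eqE /= !inordK //=; by field.
have U : amat R \in unitmx by have [] := mulmx1_unit H.
by rewrite -[invmx _]mulmx1 -H mulmxA mulVmx // mul1mx.
Qed.

(** With R = [rootmx] and D the diagonal matrix of the signs of the brackets,
    the matrix (a_ij) is the Gram matrix R D R^T, whence R^T (a_ij)^-1 R = D. *)
Lemma rootmx_diag i j :
  (rootmx^T *m inv_amat *m rootmx) i j = if i == j then (-1) ^+ i else 0.
Proof.
(* The product of [inv_amat] and [rootmx], which splits the verification into
   two products. *)
pose half : 'M[C]_4 := \matrix_(i, j) nth 0 (nth [::]
    [:: [:: 3 / 4; - 4^-1; - 4^-1; - 4^-1];
        [::  2^-1;   2^-1; - 2^-1; - 2^-1];
        [::  4^-1;   4^-1;   4^-1; - (3 / 4)];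
        [::  4^-1;   4^-1;   4^-1;   4^-1]] i) j.
have -> : rootmx^T *m inv_amat *m rootmx = rootmx^T *m half.
  rewrite -mulmxA; congr (_ *m _); apply/matrixP => {}i {}j; move: i j;
  apply: ord4P; apply: ord4P; rewrite !mxE sum_ord4 !mxE !inordK //=; by field.
move: i j; apply: ord4P; apply: ord4P;
  rewrite !mxE sum_ord4 !mxE !inordK //= -val_eqE /= !inordK //=; by field.
Qed.

Definition A_norm i n : C := if (i < 3)%N then 1 else qplus logq n / 2.

Let A_comb (W : lmodType C) (w : 'I_4 -> W) (k : C) i :
  (if (i < 3)%N then (-1) ^+ i *: (w i + w (inord i.+1))
   else k *: \sum_(l < 4) (-1) ^+ l *: w l)
  = (if (i < 3)%N then 1 else k) *: \sum_p rootmx i p *: w p.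
Proof.
move: i; apply: ord4P; rewrite !sum_ord4 !mxE !inordK //= ?scale1r
  ?scale0r ?addr0 ?add0r //.
- by rewrite expr1 scalerDr !scaleN1r.
- by rewrite expr2 mulrNN mulr1 scale1r.
- by rewrite expr1 expr2 mulrNN mulr1 !exprS expr0 mulr1 mulrNN !mulr1 !scaleN1r !scale1r.
Qed.

Lemma A_E i n v : A_ logq i n v = A_norm i n *: \sum_p rootmx i p *: a_ logq p n v.
Proof. exact: (A_comb (fun p => a_ logq p n v) (qplus logq n / 2) i). Qed.

Lemma qplusN n : qplus logq (- n) = qplus logq n.
Proof. by rewrite /qplus intrN opprK addrC. Qed.

Lemma qplus0 : qplus logq 0 = 2.
Proof.
by rewrite /qplus oppr0 /qpow mul0r /cexp /= expR0 cos0 sin0 mulr1 mulr0 complexr0 -[2]/(1 + 1).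
Qed.

Lemma A_norm0 i : A_norm i 0 = 1.
Proof. by rewrite /A_norm qplus0 divff ?if_same // pnatr_eq0. Qed.

Let simple n v i : V := \sum_p rootmx i p *: a_ logq p n v.

Let Astar0_E i v : Astar logq i 0 v = \sum_l inv_amat i l *: simple 0 v l.
Proof.
rewrite /Astar eqxx invmx_amat; apply: eq_bigr => l _.
by rewrite A_E A_norm0 scale1r.
Qed.

Let ord3E i : (i < 3)%N = (i != ord_max).
Proof. by rewrite -val_eqE /=; have := ltn_ord i; lia. Qed.

Let Astar_E i (m : nat) v : (0 < m)%N ->
  Astar logq i m v = (if (i < 3)%N then 1 else 4) *: \sum_l inv_amat i l *: simple m v l.
Proof.
move=> m0; rewrite /Astar (_ : (m%:Z == 0) = false) ?invmx_amat; last by lia.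
have q0 := qplus_neq0 m.
case: ifPn => i3; last first.
  congr (_ *: _); apply: eq_bigr => l _; rewrite A_E scalerA /A_norm.
  case: ifPn => l3; first by rewrite mulr1.
  have -> : inv_amat i l = 0; last by rewrite mul0r !scale0r.
  move: i3 l3; rewrite !ord3E !negbK => /eqP-> /eqP->; by rewrite mxE.
rewrite scale1r [RHS](bigD1 ord_max) //= [LHS]addrC; congr (_ + _).
  rewrite A_E scalerA /A_norm /=; congr (_ *: _).
  move: (qplus _ _) (inv_amat _ _) q0 => Q e Q0; by field.
apply: eq_big => [l|l l3]; first exact: ord3E.
by rewrite A_E /A_norm l3 scale1r.
Qed.

(** Paired with their duals, the A^i give the diagonal form of the free
    oscillators. *)
Let dual_sum (W : lmodType C) (x : 'I_4 -> {linear W -> W}) (w : 'I_4 -> W) :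
  \sum_i \sum_p rootmx i p *: x p (\sum_l inv_amat i l *: \sum_r rootmx l r *: w r)
  = \sum_(p < 4) (-1) ^+ p *: x p (w p).
Proof.
transitivity (\sum_p \sum_r (rootmx^T *m inv_amat *m rootmx) p r *: x p (w r)); last first.
  apply: eq_bigr => p _; rewrite (bigD1 p) //= big1 ?addr0 => [|r rp].
    by rewrite rootmx_diag eqxx.
  by rewrite rootmx_diag eq_sym (negPf rp) scale0r.
rewrite exchange_big; apply: eq_bigr => p _ /=.
transitivity (\sum_i \sum_l \sum_r (rootmx i p * inv_amat i l * rootmx l r) *: x p (w r)).
  apply: eq_bigr => i _; rewrite linear_sum scaler_sumr; apply: eq_bigr => l _.
  rewrite linearZ /= linear_sum !scaler_sumr; apply: eq_bigr => r _.
  by rewrite [x p (_ *: _)]linearZ /= !scalerA mulrA.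
transitivity (\sum_i \sum_r \sum_l (rootmx i p * inv_amat i l * rootmx l r) *: x p (w r)).
  by apply: eq_bigr => i _; exact: exchange_big.
rewrite exchange_big; apply: eq_bigr => r _ /=.
rewrite exchange_big /= [(_ *m _) _ _]mxE scaler_suml; apply: eq_bigr => l _.
rewrite [(_ *m _) _ _]mxE mulr_suml scaler_suml; apply: eq_bigr => i _.
by rewrite [rootmx^T _ _]mxE.
Qed.

(** The factor (q^m + q^-m)/2 of A^4 and the factor 4 of A^{*4} cancel against
    1/(2 (q^m + q^-m)). *)
Lemma casimir_pos (m : nat) v : (0 < m)%N ->
  \sum_(i < 4 | (i < 3)%N) A_ logq i (- m%:Z) (Astar logq i m%:Z v)
  + (2 * qplus logq m%:Z)^-1 *: A_ logq ord_max (- m%:Z) (Astar logq ord_max m%:Z v)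
  = \sum_(p < 4) (-1) ^+ p *: a_ logq p (- m%:Z) (a_ logq p m%:Z v).
Proof.
move=> m0; rewrite -(@dual_sum V (fun p => osc logq (inl p) (- m%:Z)) (fun p => a_ logq p m%:Z v)).
rewrite [RHS](bigD1 ord_max) //= [LHS]addrC; congr (_ + _).
  rewrite A_E Astar_E // /A_norm /= qplusN scalerA scaler_sumr; apply: eq_bigr => p _.
  rewrite /a_ [osc _ _ _ (4 *: _)]linearZ /= !scalerA; congr (_ *: _).
  have := qplus_neq0 m; move: (qplus _ _) (rootmx _ _) => Q r Q0; field.
  by [].
apply: eq_big => [l|l l3]; first exact: ord3E.
by rewrite A_E Astar_E // /A_norm l3 !scale1r.
Qed.

Lemma casimir_zero v :
  \sum_(i < 4) A_ logq i 0 (Astar logq i 0 v)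
  = \sum_(p < 4) (-1) ^+ p *: a_ logq p 0 (a_ logq p 0 v).
Proof.
rewrite -(@dual_sum V (fun p => osc logq (inl p) 0) (fun p => a_ logq p 0 v)).
by apply: eq_bigr => i _; rewrite A_E Astar0_E A_norm0 scale1r.
Qed.

(** The eigenvalue of -d on a basis state is its weight plus this energy of
    its charge. *)
Definition energy (c : charge R) : C :=
  2^-1 * (\sum_(p < 4) (-1) ^+ p * c (inl p) ^+ 2
          + \sum_(l < 2) c (inr l) * (c (inr l) + 1)).

Definition number_op (m : nat) v : V :=
  \sum_(p < 4) (-1) ^+ p *: a_ logq p (- m%:Z) (a_ logq p m v)
  + \sum_(l < 2) c_ logq l (- m%:Z) (c_ logq l m v).

(** The coefficient m^2/[m]_q^2 cancels the norm of the oscillators, and the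
    signs of the a^p cancel those of their brackets; what remains counts the
    occupations of the mode, weighted by m. *)
Lemma number_opE m (s : state) :
  (m.+1%:R ^+ 2 / qnum logq m.+1%:R ^+ 2) *: number_op m.+1 << s >>
  = (\sum_b (m.+1 * s.2 (b, m)))%N%:R *: << s >>.
Proof.
have q0 := qnum_neq0 m; have m0 : m.+1%:R != 0 :> C by rewrite pnatr_eq0.
have E b : osc logq b (- m.+1%:Z) (osc logq b m.+1 << s >>)
    = ((s.2 (b, m))%:R * osc_norm logq b m) *: << s >>.
  rewrite osc_pos linearZ /= osc_neg /=.
  have [n0|n0] := posnP (s.2 (b, m)); first by rewrite n0 mul0r !scale0r.
  by rewrite lowerK //; case: (s).
rewrite /number_op scalerDr !scaler_sumr natr_sum scaler_suml big_sumType /=.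
congr (_ + _); apply: eq_bigr => p _; rewrite /a_ /c_ E !scalerA; congr (_ *: _).
  rewrite /osc_norm /= natrM.
  have : (-1) ^+ p * (-1) ^+ p = 1 :> C by rewrite -expr2 sqrr_sign.
  move: (qnum _ _) q0 => Q q0; move: ((-1) ^+ p) (m.+1%:R) (s.2 _)%:R m0 => e N x m0 ee.
  have -> : N ^+ 2 / Q ^+ 2 * e * (x * (e * Q ^+ 2 / N)) = (e * e) * (N * x).
    by field; rewrite q0 m0.
  by rewrite ee mul1r.
rewrite /osc_norm /= natrM.
move: (qnum _ _) q0 => Q q0; move: (m.+1%:R) (s.2 _)%:R m0 => N x m0.
by field; rewrite q0 m0.
Qed.

Lemma number_op_is_linear m : linear (number_op m).
Proof.
move=> a v w; rewrite /number_op scalerDr addrACA !scaler_sumr -!big_split.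
by congr (_ + _); apply: eq_bigr => p _; rewrite /a_ /c_ !linearP //=
  scalerDr !scalerA mulrC.
Qed.
HB.instance Definition _ m :=
  GRing.isLinear.Build C V V *:%R (number_op m) (number_op_is_linear m).

Lemma number_op_eq0 m (s : state) : (weight s.2 < m)%N -> number_op m << s >> = 0.
Proof.
case: m => // m sm; have E b : osc logq b m.+1 << s >> = 0.
  rewrite osc_pos (_ : s.2 (b, m) = 0)%N ?mul0r ?scale0r //.
  have := leq_ltn_trans (weight_ge s.2 (b, m)) sm.
  by rewrite /= -[X in (_ < X)%N]muln1 ltn_pmul2l // ltnS leqn0 => /eqP.
by rewrite /number_op !big1 ?addr0 // => p _; rewrite /a_ /c_ E linear0 ?scaler0.
Qed.

Lemma d_E v : d_ logq v
  = \sum_(s <- dom v) coeff s v *: (- ((weight s.2)%:R + energy s.1) *: << s >>).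
Proof.
have [B vB] : exists B : nat, forall s, s \in dom v -> (weight s.2 < B)%N.
  exists (\sum_(s <- dom v) weight s.2).+1 => s sv.
  by rewrite ltnS (big_rem _ sv) leq_addr.
pose k (m : nat) : C := m%:R ^+ 2 / qnum logq m%:R ^+ 2.
have expand (f : {linear V -> V}) : f v = \sum_(s <- dom v) coeff s v *: f << s >>.
  by rewrite {1}[v]freegE linear_sum; apply: eq_bigr => s _; rewrite linearZ.
pose G (m : nat) := k m *: number_op m v.
have dE : d_ logq v = - (\sum_(m \in [set m : nat | (0 < m)%N]%classic) G m)
   - 2^-1 *: (\sum_(p < 4) (-1) ^+ p *: a_ logq p 0 (a_ logq p 0 v)
              + \sum_(l < 2) c_ logq l 0 (c_ logq l 0 v + v)).
  pose Y := \sum_(l < 2) c_ logq l 0 (c_ logq l 0 v + v).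
  apply: (congr2 (fun x y => - x - 2^-1 *: (y + Y)) _ (casimir_zero v)).
  by apply: eq_fsbigr => m; rewrite inE /= => m0; congr (_ *: (_ + _)); exact: casimir_pos.
have {}dE : d_ logq v = - \sum_(1 <= m < B) G m
   - 2^-1 *: (\sum_(p < 4) (-1) ^+ p *: a_ logq p 0 (a_ logq p 0 v)
              + \sum_(l < 2) c_ logq l 0 (c_ logq l 0 v + v)).
  rewrite dE (@fsbigE _ _ _ _ _ (index_iota 1 B)) ?iota_uniq //=; first last.
  - move=> m m0; rewrite mem_index_iota m0 /= -leqNgt => Bm.
    rewrite /G (expand (number_op m)) big_seq big1 ?scaler0 // => s sv.
    by rewrite /= number_op_eq0 ?scaler0 // (leq_trans (vB _ sv)).
  - by move=> m /=; rewrite mem_index_iota => /andP[].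
  have -> // : \sum_(i <- index_iota 1 B | i \in [set m : nat | (0 < m)%N]%classic) G i
     = \sum_(1 <= m < B) G m.
  rewrite big_mkcond big_seq [RHS]big_seq; apply: eq_bigr => m.
  by rewrite mem_index_iota => /andP[m0 _]; rewrite ifT // inE.
rewrite dE /G {G dE}.
have zE : 2^-1 *: (\sum_(p < 4) (-1) ^+ p *: a_ logq p 0 (a_ logq p 0 v)
      + \sum_(l < 2) c_ logq l 0 (c_ logq l 0 v + v))
    = \sum_(s <- dom v) coeff s v *: (energy s.1 *: << s >>).
  (* As a linear operator, this part is determined by its values on basis
     states. *)
  pose Z : V -> V := fun v => \sum_(p < 4) (-1) ^+ p *: osc logq (inl p) 0 (osc logq (inl p) 0 v)
    + \sum_(l < 2) osc logq (inr l) 0 (osc logq (inr l) 0 v + v).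
  have Zlin : linear Z.
    move=> a u w; rewrite /Z scalerDr addrACA !scaler_sumr -!big_split.
    congr (_ + _); apply: eq_bigr => p _;
      rewrite [osc _ _ _ (a *: u + w)]linearP /=.
      by rewrite [osc _ _ _ (a *: _ + _)]linearP /= scalerDr !scalerA mulrC.
    rewrite addrACA -scalerDr.
    by rewrite [osc _ _ _ (a *: _ + _)]linearP.
  pose Zl := GRing.isLinear.Build C V V *:%R Z Zlin.
  pose ZL : {linear V -> V} := HB.pack Z Zl.
  rewrite -[_ + _]/(ZL v) expand scaler_sumr; apply: eq_bigr => s _.
  rewrite scalerA mulrC -scalerA; congr (_ *: _); rewrite /energy -scalerA /= /Z.
  congr (_ *: _); rewrite scalerDl !scaler_suml; congr (_ + _); apply: eq_bigr => p _.
    by rewrite osc_zero [osc _ _ _ (_ *: _)]linearZ /= osc_zero !scalerA expr2 mulrA.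
  rewrite osc_zero [osc _ _ _ (_ + _)]linearD /= [osc _ _ _ (_ *: _)]linearZ /= osc_zero.
  by rewrite scalerA -scalerDl mulrDr mulr1.
rewrite zE.
have -> : \sum_(1 <= m < B) k m *: number_op m v
    = \sum_(s <- dom v) coeff s v *: ((weight s.2)%:R *: << s >>).
  transitivity (\sum_(1 <= m < B) \sum_(s <- dom v)
     coeff s v *: ((\sum_b (m * s.2 (b, m.-1)))%N%:R *: (<< s >> : V))).
    rewrite big_nat [RHS]big_nat; apply: eq_bigr => -[//|m] _.
    rewrite (expand (number_op m.+1)) scaler_sumr; apply: eq_bigr => s _.
    by rewrite scalerA mulrC -scalerA -number_opE.
  rewrite exchange_big /= big_seq [RHS]big_seq; apply: eq_bigr => s sv.
  by rewrite -scaler_sumr -scaler_suml -natr_sum -(weight_nat (vB _ sv)).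
rewrite -opprD -big_split -sumrN; apply: eq_bigr => s _ /=.
by rewrite -scalerDr -scalerDl scaleNr scalerN.
Qed.

End Cartan.

(** * Unordered sums of complex families *)

Section HasSum.
Variable R : realType.
Local Notation C := R[i].

Lemma partial_sumE (T : choiceType) (f : T -> C) (A : {fset T}) :
  partial_sum f A = \sum_(t <- A) f t.
Proof. by rewrite /partial_sum big_seq_fsetE. Qed.

Lemma has_sumP (T : choiceType) (f : T -> C) (s : C) :
  has_sum f s <-> forall e : C, 0 < e ->
    exists A : {fset T}, forall B : {fset T}, (A `<=` B)%fset ->
      `|s - \sum_(t <- B) f t| < e.
Proof.
have [H1 H2] := @cvgrPdist_lt C C^o _ totally totally_filter (partial_sum f) s.
split.
  move=> /H1 fs e /fs[A _ AB].
  by exists A => B /AB /=; rewrite partial_sumE.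
move=> fs; apply: H2 => e /fs[A AB].
by exists A => // B /AB /=; rewrite partial_sumE.
Qed.

Lemma has_sum_unique (T : choiceType) (f : T -> C) s s' :
  has_sum f s -> has_sum f s' -> s = s'.
Proof.
move=> /has_sumP fs /has_sumP fs'; apply/eqP; rewrite -subr_eq0 -normr_eq0.
apply: contraT => s0; have {}s0 : 0 < `|s - s'| by rewrite lt_def s0 normr_ge0.
have e0 : 0 < `|s - s'| / 2 by rewrite divr_gt0.
have [A AP] := fs _ e0; have [A' AP'] := fs' _ e0.
have := ltrD (AP (A `|` A')%fset (fsubsetUl _ _)) (AP' (A `|` A')%fset (fsubsetUr _ _)).
rewrite -splitr => /(le_lt_trans (ler_normB _ _)).
by rewrite opprB addrA subrK ltxx.
Qed.

Lemma has_sumD (T : choiceType) (f g : T -> C) s s' :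
  has_sum f s -> has_sum g s' -> has_sum (fun t => f t + g t) (s + s').
Proof.
move=> /has_sumP fs /has_sumP gs; apply/has_sumP => e e0.
have e2 : 0 < e / 2 by rewrite divr_gt0.
have [A AP] := fs _ e2; have [A' AP'] := gs _ e2.
exists (A `|` A')%fset => B; rewrite fsubUset => /andP[/AP h /AP' h'].
rewrite big_split opprD addrACA (splitr e).
exact: le_lt_trans (ler_normD _ _) (ltrD h h').
Qed.

Lemma has_sumZ (T : choiceType) (f : T -> C) s a :
  has_sum f s -> has_sum (fun t => a * f t) (a * s).
Proof.
move=> /has_sumP fs; apply/has_sumP => e e0.
have a1 : 0 < `|a| + 1 by rewrite ltr_wpDl.
have [A AP] := fs _ (divr_gt0 e0 a1); exists A => B /AP h.
rewrite -mulr_sumr -mulrBr normrM.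
have : (`|a| + 1) * `|s - \sum_(t <- B) f t| < e by rewrite mulrC -ltr_pdivlMr.
by apply: le_lt_trans; rewrite ler_wpM2r // lerDl.
Qed.

Arguments has_sumZ [T f s] a _.

Lemma eq_has_sum (T : choiceType) (f g : T -> C) s : f =1 g -> has_sum f s -> has_sum g s.
Proof. by move=> /funext->. Qed.

Lemma has_sum_finite (T : choiceType) (f : T -> C) (r : seq T) : uniq r ->
  (forall t, t \notin r -> f t = 0) -> has_sum f (\sum_(t <- r) f t).
Proof.
move=> ur f0; apply/has_sumP => e e0; exists [fset t in r]%fset => B rB.
rewrite (_ : \sum_(t <- B) f t = \sum_(t <- r) f t) ?subrr ?normr0 //.
rewrite (bigID (mem r)) /= [X in _ + X]big1 ?addr0 => [|t /f0//].
rewrite -big_filter; apply/perm_big/uniq_perm; rewrite ?filter_uniq ?fset_uniq //.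
move=> t; rewrite mem_filter; case: (boolP (t \in r)) => //= tr.
by apply: (fsubsetP rB); rewrite inE.
Qed.

Lemma has_sum0 (T : choiceType) : has_sum (fun _ : T => 0 : C) 0.
Proof. by have := @has_sum_finite T (fun=> 0) [::] isT; rewrite big_nil; apply. Qed.

(** Finitely many fibre sums are approximated by one finite sum of F, over a set
    that can be taken to contain any finite set lying in these fibres; hence it
    is close to s. *)
Lemma has_sum_fibres (T A : choiceType) (F : T -> C) (s : C) (pi : T -> A) (g : A -> C) :
  has_sum F s ->
  (forall a, has_sum (fun t => if pi t == a then F t else 0) (g a)) ->
  has_sum g s.
Proof.
move=> /has_sumP Fs Fg; apply/has_sumP => e e0.
have e2 : 0 < e / 2 by rewrite divr_gt0.
have [J0 J0P] := Fs _ e2; exists [fset pi t | t in J0]%fset => B pB.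
pose n : C := (size B).+1%:R; have n0 : 0 < n by rewrite ltr0n.
have en : 0 < e / 2 / n by rewrite divr_gt0.
have /choice[K KP] : forall a, exists A : {fset T}, forall B : {fset T}, (A `<=` B)%fset ->
    `|g a - \sum_(t <- B) if pi t == a then F t else 0| < e / 2 / n.
  by move=> a; have /has_sumP/(_ _ en) := Fg a.
pose J := (J0 `|` \bigcup_(a <- B) K a)%fset.
pose J' := [fset t in J | pi t \in B]%fset.
have JJ' a : a \in B -> \sum_(t <- J) (if pi t == a then F t else 0)
    = \sum_(t <- J') (if pi t == a then F t else 0).
  move=> aB; rewrite (bigID (fun t => pi t \in B)) /= [X in _ + X]big1 ?addr0.
    rewrite -big_filter; apply/perm_big/uniq_perm; rewrite ?filter_uniq ?fset_uniq //.
    by move=> t; rewrite mem_filter !inE andbC.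
  by move=> t tB; case: eqP => // ta; rewrite ta aB in tB.
have h1 : `|s - \sum_(t <- J') F t| < e / 2.
  apply: J0P; apply/fsubsetP => t tJ; rewrite !inE tJ /=.
  by apply: (fsubsetP pB); apply: in_imfset.
have E : \sum_(t <- J') F t = \sum_(a <- B) \sum_(t <- J) if pi t == a then F t else 0.
  rewrite big_seq; under [RHS]eq_big_seq => a aB do rewrite JJ' //.
  rewrite exchange_big /= big_seq; apply: eq_bigr => t.
  rewrite !inE => /andP[_ tB]; rewrite (bigD1_seq (pi t)) ?fset_uniq //= eqxx.
  by rewrite big1 ?addr0 // => a /negPf; rewrite eq_sym => ->.
have h2 : `|\sum_(t <- J') F t - \sum_(a <- B) g a| <= e / 2.
  rewrite E -sumrB; apply: le_trans (ler_norm_sum _ _ _) _.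
  apply: (@le_trans _ _ (\sum_(a <- B) e / 2 / n)).
    rewrite big_seq [leRHS]big_seq; apply: ler_sum => a aB; rewrite distrC; apply/ltW/KP.
    by apply: fsubset_trans (fsubsetUr _ _); apply: bigfcup_sup.
  rewrite big_const_seq count_predT iter_addr_0.
  have -> : e / 2 / n *+ size B = e / 2 * ((size B)%:R / n) by rewrite -mulr_natr; ring.
  by rewrite ler_piMr ?(ltW e2) // ler_pdivrMr // mul1r ler_nat.
rewrite (splitr e) -[s](subrK (\sum_(t <- J') F t)) -addrA.
exact: le_lt_trans (ler_normD _ _) (ltr_leD h1 h2).
Qed.

Lemma has_sum_inj (U T : choiceType) (h : U -> T) (f : T -> C) s : injective h ->
  (forall t, f t != 0 -> exists u, t = h u) ->
  has_sum (f \o h) s -> has_sum f s.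
Proof.
move=> hI fh fs; apply: (has_sum_fibres (pi := h) fs) => t /=.
have [ft0|/fh[u ->]] := eqVneq (f t) 0.
  rewrite ft0; apply: eq_has_sum (@has_sum0 U) => u.
  by case: eqP => // ->.
have := @has_sum_finite U (fun u' => if h u' == h u then f (h u') else 0) [:: u] isT.
rewrite big_seq1 eqxx; apply => u'; rewrite inE => /negPf.
by rewrite (inj_eq hI) => ->.
Qed.

Lemma sum_fset_le (T : choiceType) (f : T -> C) (A B : {fset T}) :
  (forall t, 0 <= f t) -> (A `<=` B)%fset -> \sum_(t <- A) f t <= \sum_(t <- B) f t.
Proof.
move=> f0 AB; rewrite [leRHS](bigID (fun t => t \in A)) /=.
rewrite (_ : \sum_(t <- B | t \in A) f t = \sum_(t <- A) f t) ?lerDl ?sumr_ge0 //.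
rewrite -big_filter; apply/perm_big/uniq_perm; rewrite ?filter_uniq ?fset_uniq //.
move=> t; rewrite mem_filter; case: (boolP (t \in A)) => //= tA.
exact: (fsubsetP AB).
Qed.

Lemma sum_le_has_sum (T : choiceType) (f : T -> C) s (A : {fset T}) : 0 <= s ->
  (forall t, 0 <= f t) -> has_sum f s -> \sum_(t <- A) f t <= s.
Proof.
move=> s0 f0 /has_sumP fs; have S0 (B : {fset T}) : 0 <= \sum_(t <- B) f t by exact: sumr_ge0.
rewrite real_leNgt ?ger0_real //; apply/negP => sA.
have e0 : 0 < \sum_(t <- A) f t - s by rewrite subr_gt0.
have [B BP] := fs _ e0; have := BP (A `|` B)%fset (fsubsetUr _ _).
have AB := sum_fset_le f0 (fsubsetUl A B).
have sB : s <= \sum_(t <- (A `|` B)%fset) f t by apply: le_trans (ltW sA) AB.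
by rewrite distrC ger0_norm ?subr_ge0 // ltrD2r => /lt_geF; rewrite AB.
Qed.

Definition abs_bound (T : choiceType) (f : T -> C) (M : C) : Prop :=
  forall A : {fset T}, \sum_(t <- A) `|f t| <= M.

(** The supremum of the finite sums is the sum. *)
Let has_sum_real (T : choiceType) (u : T -> R) (M : R) : (forall t, 0 <= u t) ->
  (forall A : {fset T}, \sum_(t <- A) u t <= M) -> exists s, has_sum (fun t => (u t)%:C) s.
Proof.
move=> u0 uM; pose E : set R := [set \sum_(t <- A) u t | A in [set: {fset T}]]%classic.
have supE : has_sup E.
  split; first by exists (\sum_(t <- fset0) u t), fset0.
  by exists M => _ [A _ <-].
exists (sup E)%:C; apply/has_sumP => e e0.
have [d eE] : exists d : R, e = d%:C.
  by exists (complex.Re e); apply/eqP; rewrite eq_complex /= eqxx /= ger0_Im // ltW.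
have d0 : 0 < d by move: e0; rewrite eE ltcR.
have [_ [A _ <-] Ad] := sup_adherent d0 supE; exists A => B AB.
rewrite eE -rmorph_sum -rmorphB /= -[X in X%:C]/(sup E - _).
have AleB : \sum_(t <- A) u t <= \sum_(t <- B) u t.
  have := @sum_fset_le T (fun t => (u t)%:C) A B _ AB.
  by rewrite -!rmorph_sum lecR; apply => t; rewrite lecR.
have Bs : \sum_(t <- B) u t <= sup E by apply: sup_ubound; [case: supE|exists B].
rewrite ger0_norm ?lecR ?subr_ge0 // ltcR ltrBlDr -ltrBlDl.
by apply: lt_le_trans AleB; rewrite ltrBlDr -ltrBlDl in Ad *; lra.
Qed.

(** The positive and negative parts of the real and imaginary parts are bounded
    families of nonnegative reals. *)
Lemma abs_bound_has_sum (T : choiceType) (f : T -> C) M :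
  abs_bound f M -> exists s, has_sum f s.
Proof.
move=> fM; pose re t := complex.Re (f t); pose im t := complex.Im (f t).
have bd (u : T -> R) : (forall t, 0 <= u t) -> (forall t, (u t)%:C <= `|f t|) ->
    exists s, has_sum (fun t => (u t)%:C) s.
  move=> u0 uf; apply: (@has_sum_real _ _ (complex.Re M)) => // A.
  have : (\sum_(t <- A) u t)%:C <= M.
    by rewrite rmorph_sum; apply: le_trans (fM A); apply: ler_sum => t _; apply: uf.
  by case: (M) => a b; rewrite lecE /= => /andP[].
have nRe t : `|re t|%:C <= `|f t| by rewrite normc_ge_Re.
have nIm t : `|im t|%:C <= `|f t|.
  rewrite /im normc_def lecR -sqrtr_sqr ler_wsqrtr //.
  by rewrite lerDr sqr_ge0.
have max0 (x : R) : Num.max x 0 <= `|x| by rewrite ge_max normr_ge0 ler_norm.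
have [s1 h1] : exists s, has_sum (fun t => (Num.max (re t) 0)%:C) s.
  by apply: bd => t; [rewrite le_max lexx orbT | apply: le_trans (nRe t); rewrite lecR].
have [s2 h2] : exists s, has_sum (fun t => (Num.max (- re t) 0)%:C) s.
  by apply: bd => t; [rewrite le_max lexx orbT |
    apply: le_trans (nRe t); rewrite lecR -normrN].
have [s3 h3] : exists s, has_sum (fun t => (Num.max (im t) 0)%:C) s.
  by apply: bd => t; [rewrite le_max lexx orbT | apply: le_trans (nIm t); rewrite lecR].
have [s4 h4] : exists s, has_sum (fun t => (Num.max (- im t) 0)%:C) s.
  by apply: bd => t; [rewrite le_max lexx orbT |
    apply: le_trans (nIm t); rewrite lecR -normrN].
have h := has_sumD (has_sumD h1 (has_sumZ (-1) h2))
  (has_sumD (has_sumZ ('i : C) h3) (has_sumZ (- 'i : C) h4)).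
eexists; apply: eq_has_sum h => t.
have mm (x : R) : Num.max x 0 - Num.max (- x) 0 = x.
  by case: (leP x 0) => x0; [rewrite max_l|rewrite max_r]; lra.
rewrite mulN1r mulNr -mulrBr -!rmorphB /= !mm /re /im.
by case: (f t) => a b; apply/eqP; rewrite eq_complex /= !(mul0r, mulr0, mul1r, mulr1, subr0, add0r, addr0) !eqxx.
Qed.

Lemma abs_bound_prod (T U : choiceType) (f : T -> C) (g : U -> C) M N : 0 <= N ->
  abs_bound f M -> abs_bound g N -> abs_bound (fun x : T * U => f x.1 * g x.2) (M * N).
Proof.
move=> N0 fM gN A.
pose A1 := [fset x.1 | x in A]%fset; pose A2 := [fset x.2 | x in A]%fset.
have AA : (A `<=` A1 `*` A2)%fset.
  by apply/fsubsetP => x xA; rewrite in_fsetM !in_imfset.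
apply: le_trans (sum_fset_le _ AA) _; first by move=> x; apply: normr_ge0.
rewrite (perm_big [seq (x, y) | x <- A1, y <- A2]); last first.
  apply: uniq_perm; rewrite ?fset_uniq ?allpairs_uniq ?fset_uniq //; first by move=> [? ?] [? ?].
  move=> [x y]; rewrite in_fsetM /=; apply/andP/allpairsP => [[xA yA]|[[x' y'] [/= ? ? [-> ->]]]].
    by exists (x, y).
  by [].
rewrite big_allpairs /=.
under eq_bigr => x _ do under eq_bigr => y _ do rewrite normrM.
under eq_bigr => x _ do rewrite -mulr_sumr.
rewrite -mulr_suml; apply: ler_pM (fM A1) (gN A2); exact: sumr_ge0.
Qed.

(** The double family is absolutely bounded, hence summable, and its sum can be
    computed fibre by fibre. *)
Lemma has_sum_prod (T U : choiceType) (f : T -> C) (g : U -> C) s s' M N : 0 <= N ->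
  abs_bound f M -> abs_bound g N -> has_sum f s -> has_sum g s' ->
  has_sum (fun x : T * U => f x.1 * g x.2) (s * s').
Proof.
move=> N0 fM gN fs gs.
have [p fgp] := abs_bound_has_sum (abs_bound_prod N0 fM gN).
have fs' : has_sum (fun t => f t * s') p.
  apply: (has_sum_fibres (pi := fst) fgp) => t.
  apply: (@has_sum_inj U _ (fun u => (t, u))).
  - by move=> u u' [].
  - by move=> [t' u] /=; case: (t' =P t) => [-> _|_]; [exists u | rewrite eqxx].
  - by apply: eq_has_sum (has_sumZ (f t) gs) => u; rewrite /= eqxx.
suff -> : s * s' = p by [].
apply: has_sum_unique fs'; rewrite mulrC.
by apply: eq_has_sum (has_sumZ s' fs) => t; rewrite mulrC.
Qed.

(** Once D M contains a finite set that carries the sum up to e/2, restricting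
    to D M changes little. Applied to the occupations of finitely many modes,
    this turns the sum over all occupations into an infinite product. *)
Lemma has_sum_exhaust (T : choiceType) (f : T -> C) s (D : nat -> pred T) (sg : nat -> C) :
  has_sum f s -> (forall A : {fset T}, exists M0, forall M t, (M0 <= M)%N -> t \in A -> D M t) ->
  (forall M, has_sum (fun t => if D M t then f t else 0) (sg M)) ->
  forall e, 0 < e -> exists M0, forall M, (M0 <= M)%N -> `|s - sg M| < e.
Proof.
move=> /has_sumP fs DA fD e e0; have e2 : 0 < e / 2 by rewrite divr_gt0.
have [A AP] := fs _ e2; have [M0 M0P] := DA A; exists M0 => M M0M.
have /has_sumP/(_ _ e2)[B BP] := fD M.
pose J := (A `|` B)%fset; pose J' := [fset t in J | D M t]%fset.
have h1 : `|s - \sum_(t <- J') f t| < e / 2.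
  by apply: AP; apply/fsubsetP => t tA; rewrite !inE tA (M0P M).
have h2 := BP J (fsubsetUr _ _).
have E : \sum_(t <- J) (if D M t then f t else 0) = \sum_(t <- J') f t.
  rewrite -big_mkcond -big_filter; apply/perm_big/uniq_perm; rewrite ?filter_uniq ?fset_uniq //.
  by move=> t; rewrite mem_filter !inE andbC.
rewrite E distrC in h2.
rewrite (splitr e) -[s](subrK (\sum_(t <- J') f t)) -addrA.
exact: le_lt_trans (ler_normD _ _) (ltrD h1 h2).
Qed.

Lemma abs_bound_geometric (x : C) : `|x| < 1 -> abs_bound (fun n : nat => x ^+ n) (1 - `|x|)^-1.
Proof.
move=> x1 A; have [N AN] : exists N : nat, (A `<=` [fset n in iota 0 N])%fset.
  exists (\sum_(n <- A) n)%N.+1; apply/fsubsetP => n nA.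
  have nN : n \in iota 0 (\sum_(n <- A) n)%N.+1; last by rewrite in_fset.
  rewrite mem_iota leq0n add0n ltnS.
  by rewrite (big_rem _ nA) leq_addr.
apply: le_trans (sum_fset_le _ AN) _; first by move=> n; apply: normr_ge0.
rewrite (perm_big (iota 0 N)); last first.
  by apply: uniq_perm; rewrite ?fset_uniq ?iota_uniq // => n; rewrite !inE.
under eq_bigr do rewrite normrX.
have -> : \sum_(n <- iota 0 N) `|x| ^+ n = \sum_(n < N) `|x| ^+ n.
  by rewrite -(big_mkord xpredT (fun n => `|x| ^+ n)) /index_iota subn0.
have d0 : 0 < 1 - `|x| by rewrite subr_gt0.
rewrite -[leRHS]mul1r ler_pdivlMr // mulrC.
by rewrite -opprB mulNr -subrX1 opprB gerBl exprn_ge0.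
Qed.

(** The sum exists and satisfies s = 1 + x s. *)
Lemma has_sum_geometric (x : C) : `|x| < 1 -> has_sum (fun n : nat => x ^+ n) (1 - x)^-1.
Proof.
move=> x1; have [s xs] := abs_bound_has_sum (abs_bound_geometric x1).
have h1 : has_sum (fun n => if n == 0%N then 1 else 0 : C) 1.
  have := @has_sum_finite nat (fun n => if n == 0%N then 1 else 0) [:: 0%N] isT.
  by rewrite big_seq1; apply => n; rewrite inE => /negPf->.
have h2 : has_sum (fun n => if n is m.+1 then x ^+ n else 0) (x * s).
  apply: (@has_sum_inj nat _ S) => [m n []//|[|n]|].
  - by rewrite eqxx.
  - by move=> _; exists n.
  - by apply: eq_has_sum (has_sumZ x xs) => n /=; rewrite exprS.
have /(has_sum_unique xs) sE : has_sum (fun n : nat => x ^+ n) (1 + x * s).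
  by apply: eq_has_sum (has_sumD h1 h2) => -[|n] /=; rewrite ?expr0 ?addr0 ?add0r.
have d0 : 1 - x != 0.
  by rewrite subr_eq0; apply: contraTneq x1 => <-; rewrite normr1 ltxx.
suff -> : (1 - x)^-1 = s by [].
apply: (mulfI d0); rewrite divff // mulrBl mul1r {1}sE addrK.
by [].
Qed.

End HasSum.
Arguments has_sumZ [R T f s] a _.

(** * The character of the Fock space of six bosons *)

Section FockCharacter.
Variable R : realType.
Local Notation C := R[i].
Local Notation mode := (boson * nat)%type.
Implicit Types (n : occupation) (k : mode) (ks : seq mode) (x : C).

Lemma weight_with n k (a : nat) : n k = 0%N ->
  weight [fsfun n with k |-> a] = (weight n + k.2.+1 * a)%N.
Proof.
move=> nk; pose A := (k |` finsupp n)%fset.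
rewrite !(@weightE A); last 2 first.
- by apply/fsubsetP => y; rewrite !inE => ->; rewrite orbT.
- apply/fsubsetP => y; rewrite mem_finsupp fsfun_withE !inE mem_finsupp.
  by case: (y == k).
have kA : k \in A by rewrite !inE eqxx.
rewrite !(big_fsetD1 _ kA) /= fsfun_with nk muln0 add0n addnC; congr (_ + _)%N.
rewrite big_seq [RHS]big_seq; apply: eq_bigr => y.
by rewrite !inE => /andP[/negPf yk _]; rewrite fsfun_withE yk.
Qed.

Definition carried ks n : bool := all (mem ks) (finsupp n).

(** Each mode contributes a geometric series in its occupation number. *)
Lemma has_sum_carried ks : uniq ks -> forall x, `|x| < 1 ->
  has_sum (fun n => if carried ks n then x ^+ weight n else 0)
          (\prod_(k <- ks) (1 - x ^+ k.2.+1)^-1).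
Proof.
elim: ks => [|k ks IH] /=.
  move=> _ x _; rewrite big_nil.
  have := @has_sum_finite R occupation (fun n => if carried [::] n then x ^+ weight n else 0)
    [:: [fsfun]] isT.
  rewrite big_seq1 /carried /weight finsupp0 big_nil /=; apply => n; rewrite inE => /eqP nf.
  case: ifP => // /allP n0; case: nf; apply/fsfunP => y; rewrite fsfun0E.
  by apply: contraTeq isT; rewrite -mem_finsupp => /n0.
move=> /andP[kks uks] x x1.
have xk1 : `|x ^+ k.2.+1| < 1 by rewrite normrX exprn_ilt1.
have nx1 : `| `|x| | < 1 by rewrite normr_id.
have prod0 : 0 <= \prod_(k0 <- ks) (1 - `|x| ^+ k0.2.+1)^-1.
  by apply: prodr_ge0 => k' _; rewrite invr_ge0 subr_ge0 exprn_ile1 // ltW.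
(* At |x| the induction hypothesis bounds the absolute values. *)
have b1 : abs_bound (fun n => if carried ks n then x ^+ weight n else 0)
    (\prod_(k0 <- ks) (1 - `|x| ^+ k0.2.+1)^-1).
  move=> A; apply: le_trans (sum_le_has_sum A prod0 _ (IH uks _ nx1)); last first.
    by move=> n; case: ifP => // _; apply: exprn_ge0.
  by apply: ler_sum => n _; case: ifP => _; rewrite ?normr0 // normrX.
have N0 : 0 <= (1 - `|x ^+ k.2.+1|)^-1 by rewrite invr_ge0 subr_ge0 ltW.
have h := has_sum_prod N0 b1 (abs_bound_geometric xk1) (IH uks x x1) (has_sum_geometric xk1).
rewrite big_cons mulrC.
apply: (has_sum_fibres (pi := fun p : occupation * nat => [fsfun p.1 with k |-> p.2]) h) => n.
pose n0 : occupation := [fsfun n with k |-> 0%N].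
have n0k : n0 k = 0%N by rewrite fsfun_with.
have n0n : [fsfun n0 with k |-> n k] = n.
  by apply/fsfunP => y; rewrite !fsfun_withE; case: eqP => // ->.
have cE : carried ks n0 = carried (k :: ks) n.
  apply/allP/allP => H y yn.
    have [->|yk] := eqVneq y k; first exact: mem_head.
    rewrite /= inE; apply/orP; right; apply: (H y).
    by rewrite mem_finsupp fsfun_withE (negPf yk) -mem_finsupp.
  have yk : y != k by apply: contraTneq yn => ->; rewrite mem_finsupp n0k.
  have := H y; rewrite /= inE (negPf yk) /=; apply.
  by move: yn; rewrite !mem_finsupp fsfun_withE (negPf yk).
have -> : (if carried (k :: ks) n then x ^+ weight n else 0) =
   \sum_(p <- [:: (n0, n k)]) (if [fsfun p.1 with k |-> p.2] == n then
     (if carried ks p.1 then x ^+ weight p.1 else 0) * (x ^+ k.2.+1) ^+ p.2 else 0).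
  rewrite big_seq1 /= n0n eqxx cE; case: ifP => _; rewrite ?mul0r //.
  by rewrite -exprM -exprD -weight_with // n0n.
apply: has_sum_finite => // -[m a]; rewrite inE /= => ma.
case: eqP => // mn; case: ifP => [|_]; last by rewrite mul0r.
move=> /allP cm; case/negP: ma; rewrite xpair_eqE; apply/andP; split.
  apply/eqP/fsfunP => y; rewrite fsfun_withE -mn !fsfun_withE.
  case: eqP => // ->; apply: contraNeq kks; rewrite -mem_finsupp; exact: cm.
by rewrite -mn fsfun_with.
Qed.

Definition first_modes (M : nat) : seq mode :=
  [seq (b, m) | m <- iota 0 M, b <- enum boson].

Lemma uniq_first_modes M : uniq (first_modes M).
Proof.
by rewrite allpairs_uniq ?iota_uniq ?enum_uniq // => -[? ?] [? ?] _ _ [-> ->].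
Qed.

Lemma mem_first_modes M k : (k \in first_modes M) = (k.2 < M)%N.
Proof.
apply/allpairsP/idP => [[[m b] [+ _ ->]]|kM]; first by rewrite mem_iota.
by exists (k.2, k.1); rewrite mem_iota mem_enum; case: (k) kM.
Qed.

Lemma prod_first_modes M (F : nat -> C) :
  \prod_(k <- first_modes M) F k.2 = \prod_(1 <= m < M.+1) F m.-1 ^+ 6.
Proof.
rewrite /first_modes big_allpairs_dep /= big_add1 /index_iota subn0.
apply: eq_bigr => m _; rewrite big_const_seq count_predT -cardE card_sum !card_ord.
by rewrite -[RHS]/(_ ^+ (6 : nat)) !exprS expr0 /= mulr1.
Qed.

Lemma carried_first_modes M n : (forall k, n k != 0%N -> (k.2 < M)%N) ->
  carried (first_modes M) n.
Proof.
by move=> nM; apply/allP => k; rewrite mem_finsupp /= mem_first_modes => /nM.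
Qed.

Lemma prod_le_expR (M : nat) (u : nat -> R) (K : R) :
  (forall m, 0 <= u m) -> \sum_(1 <= m < M) u m <= K ->
  \prod_(1 <= m < M) (1 + u m) <= expR K.
Proof.
move=> u0 uK; apply: (@le_trans _ _ (expR (\sum_(1 <= m < M) u m))).
  rewrite expR_sum; apply: ler_prod => m _.
  by rewrite addr_ge0 // expR_ge1Dx.
by rewrite ler_expR.
Qed.

Lemma sum_geometric_le (r : R) (M : nat) : 0 <= r < 1 ->
  \sum_(1 <= m < M) r ^+ m <= (1 - r)^-1.
Proof.
move=> /andP[r0 r1]; have d0 : 0 < 1 - r by rewrite subr_gt0.
apply: (@le_trans _ _ (\sum_(m < M) r ^+ m)).
  case: M => [|M]; first by rewrite big_nil big_ord0.
  by rewrite big_ord_recl big_add1 /= big_mkord lerDr exprn_ge0.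
rewrite -[leRHS]mul1r ler_pdivlMr // mulrC.
by rewrite -opprB mulNr -subrX1 opprB gerBl exprn_ge0.
Qed.

(** Absolute convergence of the product of the 1/(1 - q^n)^6 bounds the sums
    over finitely many modes, so the sum over all occupations exists and is the
    limit of the products. It does not vanish because the products of the (1 -
    q^n)^6 are bounded as well. *)
Lemma has_sum_occupations (q : C) : `|q| < 1 -> exists s M : C,
  [/\ s != 0, 0 <= M, abs_bound (fun n => q ^+ weight n) M,
      has_sum (fun n => q ^+ weight n) s &
      ((fun N : nat => \prod_(1 <= n < N.+1) (1 - q ^+ n) ^+ 6) @ \oo
        --> (s^-1 : C^o))%classic].
Proof.
move=> q1; have [r qr] : exists r : R, `|q| = r%:C.
  by exists (Num.sqrt (complex.Re q ^+ 2 + complex.Im q ^+ 2)); exact: normc_def.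
have r0 : 0 <= r by have := normr_ge0 q; rewrite qr ler0c.
have r1 : r < 1 by rewrite -(ltcR r 1) -qr.
have d0 : 0 < 1 - r by rewrite subr_gt0.
(* From (1 - r^m)^-1 <= 1 + r^m / (1 - r) and |1 - q^m| <= 1 + r^m the products
   are bounded by exponentials of geometric sums. *)
pose K1 := expR ((1 - r)^-1 / (1 - r)); pose K2 := expR (1 - r)^-1.
have K20 : 0 < K2 by exact: expR_gt0.
have rm m : r ^+ m.+1 <= r by rewrite exprS ler_piMr // exprn_ile1 // ltW.
have up M : \prod_(k <- first_modes M) (1 - `|q| ^+ k.2.+1)^-1 <= (K1 ^+ 6)%:C.
  rewrite (prod_first_modes M (fun m => (1 - `|q| ^+ m.+1)^-1)) qr.
  have -> : \prod_(1 <= m < M.+1) (1 - r%:C ^+ m.-1.+1)^-1 ^+ 6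
      = ((\prod_(1 <= m < M.+1) (1 - r ^+ m)^-1) ^+ 6)%:C.
    rewrite rmorphXn rmorph_prod -prodrXl /= big_nat [RHS]big_nat.
    apply: eq_bigr => -[//|m] _ /=.
    by rewrite fmorphV rmorphB rmorph1 rmorphXn.
  have y0 m : 0 <= (1 - r ^+ m.+1)^-1.
    by rewrite invr_ge0 subr_ge0 exprn_ile1 // ltW.
  have p0 : 0 <= \prod_(1 <= m < M.+1) (1 - r ^+ m)^-1.
    by rewrite big_nat prodr_ge0 // => -[//|m] _.
  rewrite lecR lerXn2r ?nnegrE ?expR_ge0 //.
  apply: le_trans (prod_le_expR (u := fun m => r ^+ m / (1 - r)) (K := (1 - r)^-1 / (1 - r)) _ _).
  - rewrite big_nat [leRHS]big_nat; apply: ler_prod => -[//|m] _; rewrite y0 /=.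
    have dm : 0 < 1 - r ^+ m.+1 by rewrite subr_gt0 (le_lt_trans (rm m)).
    rewrite -[leLHS]mul1r ler_pdivrMr //.
    have h : 1 <= (1 - r ^+ m.+1) / (1 - r).
      by rewrite ler_pdivlMr // mul1r lerD2l lerN2.
    have y1 : 0 <= r ^+ m.+1 by exact: exprn_ge0.
    have := ler_wpM2l y1 h; rewrite mulr1; move: (r ^+ m.+1) (1 - r)^-1 => y d; nra.
  - by move=> m; rewrite divr_ge0 ?exprn_ge0 // ltW.
  - rewrite -mulr_suml ler_pM2r ?invr_gt0 //; apply: sum_geometric_le.
    by rewrite r0.
have bd : abs_bound (fun n => q ^+ weight n) (K1 ^+ 6)%:C.
  move=> A; pose M := (\sum_(n <- A) weight n).+1.
  have nq1 : `| `|q| | < 1 by rewrite normr_id.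
  have p0 : 0 <= \prod_(k <- first_modes M) (1 - `|q| ^+ k.2.+1)^-1.
    by apply: prodr_ge0 => k _; rewrite invr_ge0 subr_ge0 exprn_ile1 // ltW.
  apply: le_trans (up M).
  apply: le_trans (sum_le_has_sum A p0 _ (has_sum_carried (uniq_first_modes M) nq1)); last first.
    by move=> n; case: ifP => // _; apply: exprn_ge0.
  rewrite big_seq [leRHS]big_seq; apply: ler_sum => n nA; rewrite normrX carried_first_modes //.
  move=> k /mode_le_weight kn; apply: leq_trans kn _.
  by rewrite /M (big_rem _ nA) /= -addnS leq_addr.
have [s qs] := abs_bound_has_sum bd.
pose sg M := \prod_(k <- first_modes M) (1 - q ^+ k.2.+1)^-1.
have sgs := has_sum_exhaust qs (D := fun M => carried (first_modes M)) (sg := sg).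
have {sgs} sgs e : 0 < e -> exists M0, forall M, (M0 <= M)%N -> `|s - sg M| < e.
  apply: sgs => [A|M]; last exact: has_sum_carried (uniq_first_modes M) _ q1.
  exists (\sum_(n <- A) weight n).+1 => M n AM nA; apply: carried_first_modes => k nk.
  apply: leq_trans (mode_le_weight nk) _; apply: leq_trans AM.
  by rewrite (big_rem _ nA) /= -addnS leq_addr.
pose P M := \prod_(1 <= n < M.+1) (1 - q ^+ n) ^+ 6.
have sgP M : sg M = (P M)^-1.
  rewrite /sg (prod_first_modes M (fun m => (1 - q ^+ m.+1)^-1)) /P -prodfV.
  by rewrite big_nat [RHS]big_nat; apply: eq_bigr => -[//|m] _; rewrite exprVn.
have Pne0 M : P M != 0.
  rewrite /P prodf_seq_neq0; apply/allP => -[|m]; first by rewrite mem_index_iota.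
  move=> _ /=; rewrite expf_neq0 // subr_eq0.
  have : `|q ^+ m.+1| < 1 by rewrite normrX exprn_ilt1.
  by apply: contraTneq => <-; rewrite normr1 ltxx.
have Ple M : `|P M| <= (K2 ^+ 6)%:C.
  rewrite normr_prod.
  apply: (@le_trans _ _ (\prod_(1 <= n < M.+1) (1 + r ^+ n)%:C ^+ 6)).
    apply: ler_prod => m _; rewrite normr_ge0 normrX /= lerXn2r ?nnegrE //.
      by rewrite lecR addr_ge0 // exprn_ge0.
    apply: le_trans (ler_normB _ _) _; rewrite normr1 normrX qr.
    by rewrite rmorphD rmorph1 rmorphXn.
  rewrite prodrXl -rmorph_prod -rmorphXn lecR lerXn2r ?nnegrE ?expR_ge0 //.
    by apply: prodr_ge0 => m _; rewrite addr_ge0 // exprn_ge0.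
  apply: prod_le_expR; first by move=> m; apply: exprn_ge0.
  by apply: sum_geometric_le; rewrite r0.
pose K := (K2 ^+ 6)%:C; have K0 : 0 < K by rewrite ltcR exprn_gt0.
have sgge M : K^-1 <= `|sg M|.
  by rewrite sgP normfV lef_pV2 ?posrE ?normr_gt0.
have sge : K^-1 / 2 <= `|s|.
  have e0 : 0 < K^-1 / 2 by rewrite divr_gt0 ?invr_gt0.
  have [M0 /(_ _ (leqnn _)) h] := sgs _ e0.
  have := ler_normD (sg M0 - s) s; rewrite subrK distrC => /(le_trans (sgge M0)).
  move=> T; rewrite -(lerD2l (K^-1 / 2)) -splitr; apply: le_trans T _.
  by rewrite lerD2r ltW.
have s0 : s != 0.
  by rewrite -normr_gt0 (lt_le_trans _ sge) // divr_gt0 ?invr_gt0.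
exists s, (K1 ^+ 6)%:C; split; [exact: s0 | | exact: bd | exact: qs |].
  by rewrite lecR exprn_ge0 // expR_ge0.
apply/(@cvgrPdist_lt C C^o) => e e0.
have e1 : 0 < e * (`|s| / K) by rewrite mulr_gt0 // divr_gt0 // normr_gt0.
have [M0 M0P] := sgs _ e1; exists M0 => // M /= M0M.
have -> : s^-1 - P M = (sg M - s) * (P M / s).
  rewrite sgP mulrBl mulrA mulVf // mul1r; congr (_ - _).
  by rewrite mulrC divfK.
rewrite normrM distrC normrM normfV.
apply: (@le_lt_trans _ _ (`|s - sg M| * (K / `|s|))).
  by rewrite ler_wpM2l // ler_pM2r ?invr_gt0 ?normr_gt0.
rewrite -ltr_pdivlMr ?divr_gt0 ?normr_gt0 // invf_div.
exact: M0P.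
Qed.

End FockCharacter.

(** * Powers of q and the sums over l_1 and l_2 *)

Section QPowers.
Variables (R : realType) (q logq : R[i]).
Hypotheses (q_norm : 0 < `|q| < 1) (q_log : cexp logq = q).
Local Notation C := R[i].

Lemma cexpD (z w : C) : cexp (z + w) = cexp z * cexp w.
Proof.
case: z w => a b [c d]; rewrite /cexp /= expRD cosD sinD.
by apply/eqP; rewrite eq_complex /=; apply/andP; split; apply/eqP; ring.
Qed.

Lemma cexp0 : cexp (0 : C) = 1.
Proof. by rewrite /cexp /= expR0 cos0 sin0 mulr1 mulr0. Qed.

Lemma cexpN (z : C) : cexp (- z) = (cexp z)^-1.
Proof.
have zz : cexp (- z) * cexp z = 1 by rewrite -cexpD addNr cexp0.
have z0 : cexp z != 0 by apply: contra_eq_neq zz => ->; rewrite mulr0 eq_sym oner_eq0.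
by rewrite -[LHS]mulr1 -(divff z0) mulrA zz mul1r.
Qed.

Lemma cexp_int (z : C) (n : int) : cexp (z * n%:~R) = cexp z ^ n.
Proof.
have nat_case (m : nat) : cexp (z * m%:R) = cexp z ^+ m.
  elim: m => [|m IHm]; first by rewrite mulr0 cexp0 expr0.
  by rewrite mulrSr mulrDr mulr1 cexpD IHm exprSr.
case: n => m; first exact: nat_case.
by rewrite NegzE mulrNz mulrN cexpN nat_case.
Qed.

Lemma cexp_ipi : cexp ('i * (pi : R)%:C) = -1 :> C.
Proof.
rewrite (_ : 'i * pi%:C = 0 +i* pi); last first.
  by apply/eqP; rewrite eq_complex /= ?mul0r ?mul1r ?mulr0 ?subr0 ?add0r ?addr0 !eqxx.
by rewrite /cexp expR0 cospi sinpi !mul1r; apply/eqP; rewrite eq_complex /= oppr0 !eqxx.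
Qed.

Lemma qpowD x y : qpow logq (x + y) = qpow logq x * qpow logq y.
Proof. by rewrite /qpow mulrDl cexpD. Qed.

Lemma qpow_nat (n : nat) : qpow logq n%:R = q ^+ n.
Proof. by rewrite /qpow mulrC -q_log; exact: (cexp_int logq n). Qed.

Lemma qpowN x : qpow logq (- x) = (qpow logq x)^-1.
Proof. by rewrite /qpow mulNr cexpN. Qed.

Lemma q_neq0 : q != 0.
Proof. by rewrite -normr_gt0; case/andP: q_norm. Qed.

Let normq_lt1 : `|q| < 1. Proof. by case/andP: q_norm. Qed.

Lemma normX_neq1 (m : nat) : `|q ^+ m.+1| != 1.
Proof. by rewrite lt_eqF // normrX exprn_ilt1. Qed.

Lemma qnum_neq0 (m : nat) : qnum logq m.+1%:R != 0.
Proof.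
have dif (k : nat) : qpow logq k.+1%:R - qpow logq (- k.+1%:R) != 0.
  rewrite qpowN qpow_nat subr_eq0; apply: contra (normX_neq1 (k + k.+1)) => /eqP E.
  by rewrite -addSn exprD {1}E mulVf ?normr1 // expf_neq0 // q_neq0.
by rewrite /qnum mulf_neq0 // invr_neq0 //; exact: (dif 0%N).
Qed.

Lemma qplus_neq0 (m : nat) : qplus logq m != 0.
Proof.
rewrite /qplus; change (qpow logq m%:R + qpow logq (- m%:R) != 0).
rewrite qpowN qpow_nat addr_eq0; case: m => [|m].
  by rewrite expr0 invr1 -addr_eq0 (_ : 1 + 1 = 2%:R) ?pnatr_eq0.
apply: contra (normX_neq1 (m + m.+1)) => /eqP E.
by rewrite -addSn exprD {1}E mulNr mulVf ?normrN1 // expf_neq0 // q_neq0.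
Qed.

(** The factor of one fermion in the alternating sum over l = m + 1. *)
Definition gauss b (r : int) (m : nat) : C :=
  (-1) ^+ m.+1 * qpow logq (descent b r m.+1)%:~R.

(** The exponent of q is quadratic in m, so a geometric series dominates. *)
Lemma abs_bound_gauss b r : exists2 K, 0 <= K & abs_bound (gauss b r) K.
Proof.
(* This c gives descent b r (m + 1) >= m - c for all m. *)
pose a := absz (2 * r + 1); pose c := ((a + 2) * (a + 2))%N.
have d0 : 0 <= (1 - `|q|)^-1 by rewrite invr_ge0 subr_ge0 ltW.
have nz0 : 0 <= `|qpow logq (- c%:R)| by [].
exists (`|qpow logq (- c%:R)| * (1 - `|q|)^-1); first by rewrite mulr_ge0.
have bd m : `|gauss b r m| <= `|qpow logq (- c%:R)| * `|q ^+ m|.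
  have [k kE] : exists k : nat, descent b r m.+1 = - c%:Z + m%:Z + k%:Z.
    have := descentE b r m.+1; set D := descent b r m.+1 => DE.
    have [t tE ta] : exists2 t : int, csign b * (2 * r + 1) = t & `|t| = a%:Z.
      exists (csign b * (2 * r + 1)) => //.
      by rewrite normrM; case: (b); rewrite /= ?normrN1 ?normr1 mul1r abszE.
    have Dge : - c%:Z + m%:Z <= D by move: DE; rewrite tE expr2 /c; nia.
    exists (absz (D + c%:Z - m%:Z)%R); lia.
  rewrite /gauss normrM normrX normrN1 expr1n mul1r kE !intrD intrN.
  change (`|qpow logq (- c%:R + m%:R + k%:R)| <= `|qpow logq (- c%:R)| * `|q ^+ m|).
  rewrite !qpowD !qpow_nat !normrM ler_piMr ?mulr_ge0 //.
  by rewrite normrX exprn_ile1 // ltW.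
move=> A; apply: (@le_trans _ _ (\sum_(m <- A) `|qpow logq (- c%:R)| * `|q ^+ m|)).
  exact: ler_sum.
by rewrite -mulr_sumr ler_wpM2l //; apply: abs_bound_geometric.
Qed.

Let c1 : 'I_2 := ord0.
Let c2 : 'I_2 := ord_max.

(** By [trace_proj2] each trace is the part of one total degree of the family
    indexed by an occupation and a pair (l_1, l_2), a product family whose sum
    is s s'. *)
Lemma has_sum_trace b1 b2 (c : charge R) (r1 r2 : int) (s M s' : C) :
  c (inr c1) = r1%:~R -> c (inr c2) = r2%:~R -> 0 <= M ->
  abs_bound (fun n : occupation => q ^+ weight n) M ->
  has_sum (fun n : occupation => q ^+ weight n) s ->
  has_sum (fun l : nat * nat => gauss b1 r1 l.1 * gauss b2 r2 l.2) s' ->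
  has_sum (fun n : int =>
    trace_on (states c n) (proj logq c1 b1 \o proj logq c2 b2) * qpow logq n%:~R) (s * s').
Proof.
move=> cr1 cr2 M0 occM occs gs.
have [K1 K10 K1P] := abs_bound_gauss b1 r1.
have [K2 K20 K2P] := abs_bound_gauss b2 r2.
have h := has_sum_prod (mulr_ge0 K10 K20) occM (abs_bound_prod K20 K1P K2P) occs gs.
pose pi (x : occupation * (nat * nat)) : int :=
  (weight x.1)%:Z + descent b1 r1 x.2.1.+1 + descent b2 r2 x.2.2.+1.
suff fib (n : int) : has_sum (fun x => if pi x == n then
      q ^+ weight x.1 * (gauss b1 r1 x.2.1 * gauss b2 r2 x.2.2) else 0)
    (trace_on (states c n) (proj logq c1 b1 \o proj logq c2 b2) * qpow logq n%:~R).
  exact: (has_sum_fibres (pi := pi) h) fib.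
have [L0 L0P] := trace_proj2 qnum_neq0 b1 b2 n cr1 cr2.
have [L1 L1P] := descent_gt b1 b2 r1 r2 n.
pose L := maxn L0 L1; rewrite (L0P L (leq_maxl _ _)).
pose occ l := occupations (n - descent b1 r1 l.1.+1 - descent b2 r2 l.2.+1).
pose ls := [seq (i, j) | i <- iota 0 L, j <- iota 0 L].
pose xs := [seq (x, l) | l <- ls, x <- occ l].
have uls : uniq ls by rewrite allpairs_uniq ?iota_uniq // => -[? ?] [? ?] _ _ [-> ->].
pose F (x : occupation * (nat * nat)) := if pi x == n then
   q ^+ weight x.1 * (gauss b1 r1 x.2.1 * gauss b2 r2 x.2.2) else 0.
have uxs : uniq xs.
  rewrite allpairs_uniq_dep // => [l _|[l x] [l' x'] _ _ /= [-> ->] //].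
  exact: uniq_occupations.
have F0 x : x \notin xs -> F x = 0.
  rewrite /F; case: eqP => // xn xxs; case/negP: xxs.
  have dn : descent b1 r1 x.2.1.+1 + descent b2 r2 x.2.2.+1 <= n.
    move: xn; rewrite /pi; move: (weight _) (descent b1 _ _) (descent b2 _ _) => w u v.
    by move=> <-; lia.
  apply/allpairsPdep; exists x.2, x.1; split; last by case: (x).
    apply/allpairsP; exists x.2; rewrite !mem_iota /=; split; last by case: (x.2).
      rewrite ltnNge; apply/negP => Li; have [] := L1P x.2.1.+1 x.2.2.+1; last first.
        by move: dn; lia.
      by apply: leq_trans (leqW Li); rewrite leq_maxr.
    rewrite ltnNge; apply/negP => Lj; have [] := L1P x.2.2.+1 x.2.1.+1; last first.
      by move: dn; lia.
    by apply: leq_trans (leqW Lj); rewrite leq_maxr.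
  rewrite mem_occupations; apply/eqP; move: xn; rewrite /pi.
  by move: (weight _) (descent b1 _ _) (descent b2 _ _) => w u v <-; lia.
have ord_iota (G : nat -> C) : \sum_(i < L) G i = \sum_(i <- iota 0 L) G i.
  by rewrite -(big_mkord xpredT G) /index_iota subn0.
have := has_sum_finite uxs F0; congr (has_sum _ _).
pose t i j := (-1) ^+ (i.+1 + j.+1) * (size (occ (i, j)))%:R * qpow logq n%:~R.
transitivity (\sum_(i <- iota 0 L) \sum_(j <- iota 0 L) t i j); last first.
  rewrite -ord_iota mulr_suml; apply: eq_bigr => i _.
  by rewrite -ord_iota mulr_suml.
rewrite /xs big_allpairs_dep /ls big_allpairs.
apply: eq_bigr => i _; apply: eq_bigr => j _; rewrite /t.
transitivity (\sum_(x <- occ (i, j)) (-1) ^+ (i.+1 + j.+1) * qpow logq n%:~R).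
  apply: eq_big_seq => x; rewrite mem_occupations /F /pi /= => /eqP wx.
  have nE : n = (weight x)%:Z + descent b1 r1 i.+1 + descent b2 r2 j.+1.
    by move: wx; move: (weight _) (descent b1 _ _) (descent b2 _ _) => w u v ->; lia.
  rewrite -nE eqxx /gauss /= nE !intrD !qpowD -pmulrn qpow_nat exprD.
  move: (qpow _ (descent b1 _ _)%:~R) (qpow _ (descent b2 _ _)%:~R) => u v.
  move: (q ^+ _) ((-1) ^+ i.+1) ((-1) ^+ j.+1) => w e e'; ring.
by rewrite big_const_seq count_predT iter_addr_0 mulrAC mulr_natr.
Qed.

End QPowers.

(** * The submodules and their joint eigenspaces *)

(** The exponents of x_3, x_2 and x_4 determine j, i - k and i + k: a monomial
    singles out one charge. *)
Lemma x_exponent_inj (R : realType) (alpha : int) (beta : R[i]) :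
  injective (x_exponent alpha beta).
Proof.
move=> [[i j] k] [[i' j'] k'] E.
have ev p := congr1 (fun f : {ffun 'I_4 -> R[i]} => f (inord p)) E.
have toint (a b : int) : a%:~R = b%:~R :> R[i] -> a = b by move/eqP; rewrite eqr_int => /eqP.
have jj : j = j' by move: (ev 2%N); rewrite !ffunE !inordK //= => /oppr_inj/toint.
have ik : i - k = i' - k'.
  move: (ev 1%N); rewrite !ffunE !inordK //= => e1; apply: toint; rewrite !intrB.
  by apply: (addrI (1 - alpha%:~R)); rewrite !addrA.
have ik2 : i + k = i' + k'.
  move: (ev 3%N); rewrite !ffunE !inordK //= jj => e3; apply: toint; rewrite !intrD.
  apply: (@mulfI _ (2 : R[i])); first by rewrite pnatr_eq0.
  apply: (addrI (4 * beta + 2 - alpha%:~R - 2 * j'%:~R)).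
  move: (i%:~R) (k%:~R) (i'%:~R) (k'%:~R) (j'%:~R) (alpha%:~R) e3 => x z x' z' y a e3.
  have -> : 4 * beta + 2 - a - 2 * y + 2 * (x + z) = 4 * beta + 2 - a + 2 * x - 2 * y + 2 * z.
    by ring.
  by rewrite e3; ring.
by congr (_, _, _) => //; lia.
Qed.

Section Weights.
Variables (R : realType) (q logq : R[i]).
Hypotheses (q_norm : 0 < `|q| < 1) (q_log : cexp logq = q).
Local Notation C := R[i].
Local Notation V := (fock R).
Local Notation state := (charge R * occupation)%type.
Variables (alpha : int) (beta : C) (b1 b2 : bool).

Let c1 : 'I_2 := ord0.
Let c2 : 'I_2 := ord_max.
Let qnum_ne0 := qnum_neq0 q_norm q_log.
Let qplus_ne0 := qplus_neq0 q_norm q_log.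

Lemma ghost_true l : ghost logq l true = Defs.xi logq l 0.
Proof. by rewrite /ghost -lock /Defs.xi oppr0. Qed.

Lemma ghost_false l : ghost logq l false = Defs.eta logq l 0.
Proof. by rewrite /ghost -lock /Defs.eta oppr0 sub0r. Qed.

Definition proj2 : V -> V := proj logq c1 b1 \o proj logq c2 b2.
HB.instance Definition _ := GRing.Linear.on proj2.

Lemma submodME : submodM logq alpha beta b1 b2 = proj2 @` calF alpha beta.
Proof.
rewrite /submodM /KKer /KCoker /CKer /CCoker /proj2 /proj.
by case: b1; case: b2; rewrite /= !ghost_true !ghost_false.
Qed.

Definition ghost_charge1 (t : int * int * int) : int :=
  let: (i, j, _) := t in - alpha + i - j.

Lemma chargeF1 t : chargeF alpha beta t (inr c1) = (ghost_charge1 t)%:~R.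
Proof. by case: t => [[i j] k]; rewrite ffunE /= !intrD !intrN. Qed.

Lemma chargeF2 t : chargeF alpha beta t (inr c2) = t.2%:~R.
Proof. by case: t => [[i j] k]; rewrite ffunE. Qed.

Lemma proj2_homog t n v : homog (chargeF alpha beta t) n v ->
  homog (chargeF alpha beta t) n (proj2 v).
Proof.
by move=> hv; apply: proj_homog (chargeF1 t); apply: proj_homog hv (chargeF2 t).
Qed.

Lemma proj2_idem t n v : homog (chargeF alpha beta t) n v -> proj2 (proj2 v) = proj2 v.
Proof.
move=> hv; rewrite /proj2 /=.
have h2 := proj_homog (logq := logq) (b := b2) hv (chargeF2 t).
have c21 : c2 != c1 by [].
rewrite (projC qnum_ne0 b2 b1 c21 h2 (chargeF2 t) (chargeF1 t)).
rewrite (proj_idem qnum_ne0 b2 hv (chargeF2 t)).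
exact: (proj_idem qnum_ne0 b1 h2 (chargeF1 t)).
Qed.

Lemma calF_homog s : s.1 \in range (chargeF alpha beta) ->
  exists2 t, s.1 = chargeF alpha beta t &
    homog (chargeF alpha beta t) (weight s.2)%:Z (<< s >> : V).
Proof.
rewrite inE => -[t _ tE]; exists t => //; apply: homog1.
by rewrite mem_states -tE !eqxx.
Qed.

Lemma calF_range (v : V) : calF alpha beta v <->
  supported (fun s => s.1 \in range (chargeF alpha beta)) v.
Proof.
split=> Fv s /Fv; first by move=> [t tE]; rewrite inE; exists t.
by rewrite inE => -[t _ <-]; exists t.
Qed.

Lemma proj2_calF v : calF alpha beta v ->
  calF alpha beta (proj2 v) /\ proj2 (proj2 v) = proj2 v.
Proof.
move=> /calF_range Fv; split.
  apply/calF_range; apply: (supported_linear (f := proj2) _ Fv) => s /calF_homog[t st ht].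
  by move=> s' /(proj2_homog ht)[-> _]; rewrite inE; exists t.
rewrite [v]freegE !linear_sum big_seq [RHS]big_seq; apply: eq_bigr => s /Fv/calF_homog[t _ ht].
by rewrite !linearZ /= (proj2_idem ht).
Qed.

Lemma submodMP v : submodM logq alpha beta b1 b2 v <-> calF alpha beta v /\ proj2 v = v.
Proof.
rewrite submodME; split=> [[w Fw <-]|[Fv <-]]; first exact: proj2_calF.
by exists v.
Qed.

Definition h_val (c : charge R) (j : 'I_4) : C := \sum_p rootmx R j p * c (inl p).
Definition Nf_val (c : charge R) : C := c (inl (inord 1)) + c (inl (inord 3)).
Definition d_val (s : state) : C := - ((weight s.2)%:R + energy s.1).

Lemma h_val_chargeF t j : h_val (chargeF alpha beta t) j = x_exponent alpha beta t j.
Proof.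
case: t => [[i k] l]; rewrite /h_val; move: j; apply: ord4P;
  rewrite sum_ord4 !mxE !ffunE !inordK //=; ring.
Qed.

Lemma diag_expand (f : {linear V -> V}) (g : state -> C) v :
  (forall s, f << s >> = g s *: << s >>) ->
  f v = \sum_(s <- dom v) coeff s v *: (g s *: << s >>).
Proof.
move=> fg; rewrite {1}[v]freegE linear_sum; apply: eq_bigr => s _.
by rewrite linearZ /= fg.
Qed.

Lemma diag_eigen (w v : V) (g : state -> C) a :
  w = \sum_(s <- dom v) coeff s v *: (g s *: << s >>) ->
  w = a *: v <-> forall s, s \in dom v -> g s = a.
Proof.
move=> ->; split=> [E s sv|ga].
  have /(congr1 (coeff s)) := E; rewrite coeffZ raddf_sum (bigD1_seq s) ?uniq_dom //=.
  rewrite !coeffZ coeff1U eqxx mulr1 big1 ?addr0 => [|s' s's]; last first.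
    by rewrite !coeffZ coeff1U (negPf s's) !mulr0.
  by rewrite mulrC => /mulIf; apply; rewrite -mem_dom.
rewrite [in RHS](freegE v) scaler_sumr big_seq [RHS]big_seq; apply: eq_bigr => s /ga->.
by rewrite !scalerA mulrC.
Qed.

Lemma h_E j v : h_ logq j v = \sum_(s <- dom v) coeff s v *: (h_val s.1 j *: << s >>).
Proof.
rewrite /h_ A_E A_norm0 scale1r.
have -> : \sum_p rootmx R j p *: a_ logq p 0 v
    = \sum_p \sum_(s <- dom v) coeff s v *: ((rootmx R j p * s.1 (inl p)) *: (<< s >> : V)).
  apply: eq_bigr => p _.
  rewrite /a_ (@diag_expand (osc logq (inl p) 0) (fun s => s.1 (inl p)) v (osc_zero logq (inl p))).
  by rewrite scaler_sumr; apply: eq_bigr => s _; rewrite !scalerA mulrCA mulrA.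
rewrite exchange_big; apply: eq_bigr => s _ /=.
by rewrite -scaler_sumr -scaler_suml.
Qed.

Lemma Nf_E v : Nf logq v = \sum_(s <- dom v) coeff s v *: (Nf_val s.1 *: << s >>).
Proof.
rewrite /Nf /a_.
rewrite (diag_expand _ (osc_zero logq (inl (inord 1)))).
rewrite (diag_expand _ (osc_zero logq (inl (inord 3)))) -big_split.
by apply: eq_bigr => s _ /=; rewrite -scalerDr -scalerDl.
Qed.

Lemma joint_eigenP mu delta nu v :
  joint_eigen logq (submodM logq alpha beta b1 b2) mu delta nu v <->
  [/\ calF alpha beta v, proj2 v = v & forall s, s \in dom v ->
    [/\ forall j, h_val s.1 j = mu j, d_val s = delta & Nf_val s.1 = nu]].
Proof.
have dE := diag_eigen delta (d_E qnum_ne0 qplus_ne0 v).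
split=> [[/submodMP[Fv Pv] hv dv Nv]|[Fv Pv H]].
  split=> // s sv; split=> [j||].
  - by have /(diag_eigen (mu j) (h_E j v))/(_ s sv) := hv j.
  - by have /dE/(_ s sv) := dv.
  - by have /(diag_eigen nu (Nf_E v))/(_ s sv) := Nv.
split; first exact/submodMP.
- by move=> j; apply/(diag_eigen (mu j) (h_E j v)) => s /H[].
- by apply/dE => s /H[].
- by apply/(diag_eigen nu (Nf_E v)) => s /H[].
Qed.

End Weights.

Section Multiplicities.
Variables (R : realType) (q logq : R[i]).
Hypotheses (q_norm : 0 < `|q| < 1) (q_log : cexp logq = q).
Local Notation C := R[i].
Local Notation V := (fock R).
Local Notation state := (charge R * occupation)%type.
Variables (alpha : int) (beta : C) (b1 b2 : bool).

Let c1 : 'I_2 := ord0.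
Let c2 : 'I_2 := ord_max.
Local Notation M := (submodM logq alpha beta b1 b2).
Local Notation P := (proj2 logq b1 b2).
Local Notation cF := (chargeF alpha beta).
Local Notation x_exp := (x_exponent alpha beta).

Definition trace2 t n : C := trace_on (states (cF t) n) P.

Definition dvalue t (n : int) : C := - (n%:~R + energy (cF t)).

(** The eigenvalues of the h_j determine the charge, and that of d then
    determines the weight. *)
Lemma joint_eigen_span t n : joint_eigen logq M (x_exp t) (dvalue t n) (Nf_val (cF t))
  = [set v | spanned (states (cF t) n) v /\ P v = v].
Proof.
apply/seteqP; split=> v.
  move=> /(joint_eigenP q_norm q_log)[Fv Pv H]; split=> // s sv.
  have [hs ds _] := H s sv; have [t' st'] := Fv s sv.
  have tt' : t' = t.
    apply: (x_exponent_inj (alpha := alpha) (beta := beta)); apply/ffunP => j.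
    by rewrite -h_val_chargeF -st' hs.
  rewrite mem_states st' tt' eqxx /=; move: ds; rewrite /d_val /dvalue st' tt'.
  move/oppr_inj/addIr => E; apply/eqP/eqP; rewrite -(eqr_int C); apply/eqP.
  by rewrite -E.
move=> [Sv Pv]; apply/(joint_eigenP q_norm q_log); split=> //.
  by move=> s /Sv; rewrite mem_states => /andP[/eqP-> _]; exists t.
move=> s /Sv; rewrite mem_states => /andP[/eqP sc /eqP sn]; split.
- by move=> j; rewrite sc h_val_chargeF.
- by rewrite /d_val /dvalue sc -sn.
- by rewrite sc.
Qed.

Lemma has_dim0 : has_dim [set 0 : V] 0.
Proof.
exists (fun=> 0); split; last by move=> x _; apply/ffunP => -[].
apply/seteqP; split=> [v ->|v [x _ <-]]; last by rewrite big_ord0.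
by exists [ffun=> 0] => //; rewrite big_ord0.
Qed.

(** Either the eigenvalues belong to a charge and a degree, and the eigenspace
    is the range of the projector there, or the eigenspace is zero. *)
Lemma exists_multiplicity mu delta nu : exists m : nat,
  [/\ has_dim (joint_eigen logq M mu delta nu) m,
      forall t n, mu = x_exp t -> delta = dvalue t n -> nu = Nf_val (cF t) ->
        m%:R = trace2 t n &
      m != 0%N -> exists t n, [/\ mu = x_exp t, delta = dvalue t n & nu = Nf_val (cF t)]].
Proof.
have [[t [n [-> -> ->]]]|no] := pselect (exists t n,
    [/\ mu = x_exp t, delta = dvalue t n & nu = Nf_val (cF t)]).
  have hS s : s \in states (cF t) n -> homog (cF t) n (<< s >> : V) by exact: homog1.
  have PS s : s \in states (cF t) n -> spanned (states (cF t) n) (P << s >>).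
    by move=> sS; apply/homog_spanned; apply: proj2_homog; apply: hS.
  have PP s : s \in states (cF t) n -> P (P << s >>) = P << s >>.
    by move=> sS; apply: (proj2_idem q_norm q_log); apply: hS.
  have [m dm mE] := has_dim_idempotent (uniq_states (cF t) n) PS PP.
  exists m; split.
  - by rewrite joint_eigen_span.
  - move=> t' n' /x_exponent_inj <- /oppr_inj/addIr/eqP; rewrite eqr_int => /eqP <- _.
    exact: mE.
  - by move=> _; exists t, n.
exists 0%N; split=> //; last first.
  by move=> t n muE dE nuE; case: no; exists t, n.
suff -> : joint_eigen logq M mu delta nu = [set 0] by exact: has_dim0.
apply/seteqP; split=> v /=.
  move=> /(joint_eigenP q_norm q_log)[Fv _ H]; apply/eqP; rewrite -dom_eq0.
  case E : (dom v) => [//|s r]; case: no.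
  have sv : s \in dom v by rewrite E mem_head.
  have [t st] := Fv s sv; have [hs ds ns] := H s sv.
  exists t, (weight s.2)%:Z; split.
  - by apply/ffunP => j; rewrite -h_val_chargeF -st hs.
  - by rewrite -ds /d_val /dvalue st.
  - by rewrite -ns st.
move=> ->; apply/(joint_eigenP q_norm q_log); split; first by move=> s; rewrite dom0.
  by rewrite linear0.
by move=> s; rewrite dom0.
Qed.

(** The projector preserves charge and degree, so it maps basis states to joint
    eigenvectors. *)
Lemma submodM_diagonalizable v : M v -> exists2 s : seq V, v = \sum_(u <- s) u &
  forall u, u \in s -> exists mu delta nu, joint_eigen logq M mu delta nu u.
Proof.
move=> Mv; have [w Fw <-] : (P @` calF alpha beta) v by rewrite -submodME.
exists [seq coeff s w *: P << s >> | s <- dom w].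
  by rewrite big_map {1}[w]freegE linear_sum; apply: eq_bigr => s _; rewrite linearZ.
move=> u /mapP[s sw ->]; have [t st] := Fw s sw.
exists (x_exp t), (dvalue t (weight s.2)%:Z), (Nf_val (cF t)).
have hs : homog (cF t) (weight s.2)%:Z (<< s >> : V).
  by apply: homog1; rewrite mem_states st !eqxx.
suff : [set v | spanned (states (cF t) (weight s.2)%:Z) v /\ P v = v] (coeff s w *: P << s >>).
  by rewrite -joint_eigen_span.
split.
  by apply: supportedZ; apply/homog_spanned; apply: proj2_homog hs.
by rewrite linearZ /=; congr (_ *: _); apply: (proj2_idem q_norm q_log); apply: hs.
Qed.

(** The exponents of the prefactor of the character and of its part free of l_1
    and l_2. *)
Lemma energy_chargeF i j k : energy (cF (i, j, k)) =
  2^-1 * alpha%:~R * (2 * beta + 1) +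
  2^-1 * (i%:~R ^+ 2 + j%:~R ^+ 2 + k%:~R ^+ 2 - 2 * k%:~R * j%:~R
          + i%:~R + j%:~R + k%:~R).
Proof.
rewrite /energy sum_ord4 !big_ord_recl big_ord0 !ffunE !inordK //=.
move: (i%:~R) (j%:~R) (k%:~R) (alpha%:~R) => x y z a; by field.
Qed.

Lemma descent_complex b r m : (descent b r m)%:~R =
  2^-1 * (m%:R ^+ 2 + (-1) ^+ b * (2 * r%:~R + 1) * m%:R) :> C.
Proof.
have : (2 * descent b r m)%:~R = (m%:Z ^+ 2 + csign b * (2 * r + 1) * m%:Z)%:~R :> C.
  by rewrite descentE.
rewrite !(intrM, intrD) /= => /(canRL (mulKf _)) -> //.
  by congr (_ * (_ + _ * _ * _)); case: b; rewrite ?expr1 ?expr0.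
by rewrite -intrD intr_eq0.
Qed.

Lemma x_seriesE (u : int * int * int -> C) t : x_series alpha beta u (x_exp t) = u t.
Proof.
rewrite /x_series (_ : [set _ | _] = [set t]) ?fsbig_set1 //.
by apply/seteqP; split=> [t' /x_exponent_inj|t' ->].
Qed.

Lemma x_series0 (u : int * int * int -> C) mu : (forall t, mu <> x_exp t) ->
  x_series alpha beta u mu = 0.
Proof. by move=> no; apply: fsbig1 => t /esym/no. Qed.

End Multiplicities.

(** * The character formulas *)

Section TraceSeries.
Variables (R : realType) (q logq : R[i]).
Hypotheses (q_norm : 0 < `|q| < 1) (q_log : cexp logq = q).
Local Notation C := R[i].
Variables (alpha : int) (beta : C) (b1 b2 : bool).
Local Notation M := (submodM logq alpha beta b1 b2).
Local Notation cF := (chargeF alpha beta).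
Local Notation x_exp := (x_exponent alpha beta).

(** The terms of the sum over l_1, l_2 at the charge t, without the factors that
    do not depend on l_1, l_2. *)
Definition fermion_term (t : int * int * int) (l : nat * nat) : C :=
  gauss logq b1 (ghost_charge1 alpha t) l.1 * gauss logq b2 t.2 l.2.

Lemma exists_fermion_sum t : exists s, has_sum (fermion_term t) s.
Proof.
have [K1 K10 K1P] := abs_bound_gauss q_norm q_log b1 (ghost_charge1 alpha t).
have [K2 K20 K2P] := abs_bound_gauss q_norm q_log b2 t.2.
exact: abs_bound_has_sum (abs_bound_prod K20 K1P K2P).
Qed.

(** At this mu only the eigenvalue pairs of the charge t and some degree n have
    nonzero multiplicity, so that the joint trace is a sum over n. *)
Lemma has_sum_multiplicity (mult : {ffun 'I_4 -> C} -> C -> C -> nat)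
    (phi : C -> C -> C) t (kappa s s' K : C) :
  (forall mu delta nu,
    [/\ has_dim (joint_eigen logq M mu delta nu) (mult mu delta nu),
      forall t n, mu = x_exp t -> delta = dvalue alpha beta t n -> nu = Nf_val (cF t) ->
        (mult mu delta nu)%:R = trace2 logq alpha beta b1 b2 t n &
      mult mu delta nu != 0%N -> exists t n,
        [/\ mu = x_exp t, delta = dvalue alpha beta t n & nu = Nf_val (cF t)]]) ->
  (forall n : int, phi (dvalue alpha beta t n) (Nf_val (cF t)) = kappa * qpow logq n%:~R) ->
  0 <= K -> abs_bound (fun n : occupation => q ^+ weight n) K ->
  has_sum (fun n : occupation => q ^+ weight n) s ->
  has_sum (fermion_term t) s' ->
  has_sum (fun p : (C * C)%type => (mult (x_exp t) p.1 p.2)%:R * phi p.1 p.2)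
    (kappa * (s * s')).
Proof.
move=> multP phiE K0 occK occs fs.
pose h (n : int) : C * C := (dvalue alpha beta t n, Nf_val (cF t)).
apply: (@has_sum_inj _ _ _ h).
- by move=> n n' [/oppr_inj/addIr/eqP]; rewrite eqr_int => /eqP.
- move=> [d nu] /=; rewrite mulf_eq0 negb_or pnatr_eq0 => /andP[m0 _].
  have [_ _ /(_ m0)[t' [n [/x_exponent_inj <- -> ->]]]] := multP (x_exp t) d nu.
  by exists n.
have := has_sum_trace q_norm q_log (chargeF1 alpha beta t) (chargeF2 alpha beta t)
  K0 occK occs fs.
move=> /(has_sumZ kappa); apply: eq_has_sum => n; rewrite /= phiE mulrCA; congr (_ * _).
have [_ /(_ t n erefl erefl erefl) -> _] := multP (x_exp t) (dvalue alpha beta t n) (Nf_val (cF t)).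
by [].
Qed.

End TraceSeries.

Theorem proposition8 (R : realType) (q logq : R[i])
  (q_norm : 0 < `|q| < 1) (q_log : cexp logq = q)
  (alpha : int) (beta : R[i]) (b1 b2 : bool) :
  let s1 : R[i] := (-1) ^+ b1 in
  let s2 : R[i] := (-1) ^+ b2 in
  let M := submodM logq alpha beta b1 b2 in
  let outer (l1 l2 : R[i]) : R[i] :=
    qpow logq (2^-1 * (l1 ^+ 2 + l2 ^+ 2
                       + s1 * (1 - 2 * alpha%:~R) * l1 + s2 * l2)) in
  let inner (l1 l2 i j k : R[i]) : R[i] :=
    qpow logq (2^-1 * (i ^+ 2 + j ^+ 2 + k ^+ 2 - 2 * k * j
                       + (1 + 2 * s1 * l1) * i + (1 - 2 * s1 * l1) * j
                       + (1 + 2 * s2 * l2) * k)) in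
  exists (P : R[i]) (S T : {ffun 'I_4 -> R[i]} -> R[i]),
  [/\ [/\ (fun N : nat => \prod_(1 <= n < N.+1) (1 - q ^+ n) ^+ 6) @ \oo
            --> (P : R[i]^o),
          P != 0,
          forall mu, has_sum (fun l : (nat * nat)%type =>
            let l1 := l.1.+1 in let l2 := l.2.+1 in
            (-1) ^+ (l1 + l2) * outer l1%:R l2%:R *
            x_series alpha beta (fun t : int * int * int =>
              let: (i, j, k) := t in
              inner l1%:R l2%:R i%:~R j%:~R k%:~R) mu) (S mu) &
          forall mu, has_sum (fun l : (nat * nat)%type =>
            let l1 := l.1.+1 in let l2 := l.2.+1 in
            (-1) ^+ (l1 + l2) * outer l1%:R l2%:R *
            x_series alpha beta (fun t : int * int * int =>
              let: (i, j, k) := t in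
              (-1) ^ (1 - alpha + i - j + k) *
              inner l1%:R l2%:R i%:~R j%:~R k%:~R) mu) (T mu)],
      has_character logq M (fun mu =>
        qpow logq (2^-1 * alpha%:~R * (2 * beta + 1)) / P * S mu) &
      has_supercharacter logq beta M (fun mu =>
        qpow logq (2^-1 * alpha%:~R * (2 * beta + 1)) / P * T mu)].
Proof.
move=> s1 s2 M outer inner.
have [|s [K [s0 K0 occK occs prodP]]] := @has_sum_occupations R q.
  by case/andP: q_norm.
pose e0 (t : int * int * int) : R[i] := let: (i, j, k) := t in
  qpow logq (2^-1 * (i%:~R ^+ 2 + j%:~R ^+ 2 + k%:~R ^+ 2 - 2 * k%:~R * j%:~R
          + i%:~R + j%:~R + k%:~R)).
pose sg (t : int * int * int) : R[i] := let: (i, j, k) := t in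
  (-1) ^ (1 - alpha + i - j + k).
(* The exponents split into the part in [e0] and the quadratic exponents of
   [descent] for the two fermions. *)
have termE t (l : nat * nat) :
    (-1) ^+ (l.1.+1 + l.2.+1) * outer l.1.+1%:R l.2.+1%:R *
      (let: (i, j, k) := t in inner l.1.+1%:R l.2.+1%:R i%:~R j%:~R k%:~R)
    = e0 t * fermion_term logq alpha b1 b2 t l.
  case: t l => [[i j] k] [m1 m2].
  have E : outer m1.+1%:R m2.+1%:R * inner m1.+1%:R m2.+1%:R i%:~R j%:~R k%:~R
      = e0 (i, j, k) * qpow logq (descent b1 (- alpha + i - j) m1.+1)%:~R
        * qpow logq (descent b2 k m2.+1)%:~R.
    rewrite /outer /inner /e0 -!qpowD; congr (qpow logq _).
    rewrite !descent_complex -/s1 -/s2 !intrD !intrN.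
    move: (i%:~R) (j%:~R) (k%:~R) (alpha%:~R) (m1.+1%:R) (m2.+1%:R).
    by move=> x y z a l1 l2; ring.
  move: (e0 _) E => w E; rewrite /fermion_term /gauss /= -mulrA E exprD.
  move: (qpow _ (descent b1 _ _)%:~R) (qpow _ (descent b2 _ _)%:~R) => x y.
  by move: (_ ^+ m1.+1) (_ ^+ m2.+1) => u v; ring.
have /choice[S0 S0P] := exists_fermion_sum q_norm q_log alpha b1 b2.
(* No charge belongs to the monomials where S and T are put to zero. *)
have pick mu : exists S T, (forall t, mu = x_exponent alpha beta t ->
    S = e0 t * S0 t /\ T = sg t * (e0 t * S0 t)) /\
    ((forall t, mu <> x_exponent alpha beta t) -> S = 0 /\ T = 0).
  have [[t ->]|no] := pselect (exists t, mu = x_exponent alpha beta t).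
    exists (e0 t * S0 t), (sg t * (e0 t * S0 t)); split=> [t' /x_exponent_inj <- //|].
    by move=> /(_ t).
  exists 0, 0; split=> // t mut; by case: no; exists t.
have /choice[S pickS] := pick; have /choice[T ST] := pickS.
have multE := exists_multiplicity q_norm q_log alpha beta b1 b2.
have /choice[mult0 mult0P] : forall x : {ffun 'I_4 -> R[i]} * R[i] * R[i], exists m : nat,
    [/\ has_dim (joint_eigen logq M x.1.1 x.1.2 x.2) m,
      forall t n, x.1.1 = x_exponent alpha beta t -> x.1.2 = dvalue alpha beta t n ->
        x.2 = Nf_val (chargeF alpha beta t) -> m%:R = trace2 logq alpha beta b1 b2 t n &
      m != 0%N -> exists t n, [/\ x.1.1 = x_exponent alpha beta t,
        x.1.2 = dvalue alpha beta t n & x.2 = Nf_val (chargeF alpha beta t)]].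
  by move=> x; apply: multE.
pose mult mu delta nu := mult0 (mu, delta, nu).
have multP mu delta nu := mult0P (mu, delta, nu).
have absent mu : (forall t, mu <> x_exponent alpha beta t) ->
    forall delta nu, mult mu delta nu = 0%N.
  move=> no delta nu; apply/eqP; rewrite -[_ == _]negbK; apply/negP.
  by have [_ _ H] := multP mu delta nu; move=> /H[t [n [/no]]].
exists s^-1, S, T; split; [split| |].
- exact: prodP.
- by rewrite invr_eq0 s0.
- move=> mu; have [[t muE]|no] := pselect (exists t, mu = x_exponent alpha beta t).
    have [/(_ t muE)[-> _] _] := ST mu; apply: eq_has_sum (has_sumZ (e0 t) (S0P t)) => l.
    by rewrite muE -termE /= x_seriesE.
  have {}no t : mu <> x_exponent alpha beta t by move=> muE; apply: no; exists t.
  have [_ /(_ no)[-> _]] := ST mu; apply: eq_has_sum (@has_sum0 _ _) => l.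
  by rewrite /= x_series0 ?mulr0.
- move=> mu; have [[t muE]|no] := pselect (exists t, mu = x_exponent alpha beta t).
    have [/(_ t muE)[_ ->] _] := ST mu.
    apply: eq_has_sum (has_sumZ (sg t) (has_sumZ (e0 t) (S0P t))) => l.
    rewrite muE -termE /= x_seriesE; case: (t) => [[i j] k] /=.
    by rewrite mulrCA.
  have {}no t : mu <> x_exponent alpha beta t by move=> muE; apply: no; exists t.
  have [_ /(_ no)[_ ->]] := ST mu; apply: eq_has_sum (@has_sum0 _ _) => l.
  by rewrite /= x_series0 ?mulr0.
- split; first by move=> v; apply: (submodM_diagonalizable q_norm q_log).
  exists mult => [mu delta nu|mu]; first by have [] := multP mu delta nu.
  have [[t muE]|no] := pselect (exists t, mu = x_exponent alpha beta t); last first.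
    have {}no t : mu <> x_exponent alpha beta t by move=> muE; apply: no; exists t.
    have [_ /(_ no)[-> _]] := ST mu; rewrite mulr0.
    by apply: eq_has_sum (@has_sum0 _ _) => p; rewrite absent // mul0r.
  have [/(_ t muE)[-> _] _] := ST mu; rewrite invrK muE.
  have := has_sum_multiplicity q_norm q_log multP
    (phi := fun delta _ => qpow logq (- delta)) (t := t)
    (kappa := qpow logq (energy (chargeF alpha beta t))) _ K0 occK occs (S0P t).
  rewrite (_ : qpow logq (energy _) * (s * S0 t)
     = qpow logq (2^-1 * alpha%:~R * (2 * beta + 1)) * s * (e0 t * S0 t)); last first.
    case: (t) => [[i j] k]; rewrite energy_chargeF qpowD /e0.
    by rewrite mulrACA -!mulrA; congr (_ * _); rewrite mulrCA.
  apply=> n; by rewrite opprK qpowD mulrC.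
- split; first by move=> v; apply: (submodM_diagonalizable q_norm q_log).
  exists mult => [mu delta nu|mu]; first by have [] := multP mu delta nu.
  have [[t muE]|no] := pselect (exists t, mu = x_exponent alpha beta t); last first.
    have {}no t : mu <> x_exponent alpha beta t by move=> muE; apply: no; exists t.
    have [_ /(_ no)[_ ->]] := ST mu; rewrite mulr0.
    by apply: eq_has_sum (@has_sum0 _ _) => p; rewrite absent // mul0r.
  have [/(_ t muE)[_ ->] _] := ST mu; rewrite invrK muE.
  have := has_sum_multiplicity q_norm q_log multP
    (phi := fun delta nu => cexp ('i * pi%:C * (nu + 2 * beta)) * qpow logq (- delta))
    (t := t) (kappa := sg t * qpow logq (energy (chargeF alpha beta t)))
    _ K0 occK occs (S0P t).
  rewrite (_ : sg t * qpow logq (energy _) * (s * S0 t)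
     = qpow logq (2^-1 * alpha%:~R * (2 * beta + 1)) * s * (sg t * (e0 t * S0 t))); last first.
    move: (sg t) => e; case: (t) => [[i j] k]; rewrite energy_chargeF qpowD /e0.
    by move: (qpow _ _) (qpow _ _) (S0 _) => x y z; ring.
  apply=> n; rewrite opprK qpowD -[RHS]mulrA [qpow _ _ * qpow _ _]mulrC; congr (_ * _).
  (* With the phase of 2 beta removed, N_f takes integral values, whose parity
     is the sign of the supercharacter. *)
  have -> : Nf_val (chargeF alpha beta t) + 2 * beta
      = - (let: (i, j, k) := t in 1 - alpha + i - j + k)%:~R.
    case: (t) => [[i j] k]; rewrite /Nf_val !ffunE !inordK //= !(intrD, intrN).
    by move: (i%:~R) (j%:~R) (k%:~R) (alpha%:~R) => x y z a; ring.
  by rewrite mulrN -mulNr cexp_int cexpN cexp_ipi invrN1; case: (t) => [[i j] k].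
Qed.
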